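(* Let $1\le p\le\infty$, $\alpha>\max(-1/p,-1/2)$, $\gamma>1/3$ with $(\gamma,\alpha)\in\mathcal{D}'$, $v_0\in\mathcal{F}L^{\alpha,p}$, and let $v:[0,T]\to\mathcal{F}L^{\alpha,p}$ be the unique $\gamma$-Hölder path with $v(0)=v_0$ and $v_t=v_s+X_{ts}(v_s,v_s)+X^2_{ts}(v_s,v_s,v_s)+o(|t-s|)$, $T>0$ being its existence time. For $n\ge1$ define $y^n_0=v_0$ and $y^n_i=y^n_{i-1}+X_{i/n,(i-1)/n}(y^n_{i-1},y^n_{i-1})+X^2_{i/n,(i-1)/n}(y^n_{i-1},y^n_{i-1},y^n_{i-1})$ for $i\ge1$, and $\Delta^n_i=y^n_i-v_{i/n}$. Then $$\sup_{0\le i<j\le nT}\frac{|\Delta^n_i-\Delta^n_j|_{\mathcal{F}L^{\alpha,p}}}{|i-j|^\gamma}=O(n^{1-3\gamma}).$$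
   Context: $\mathbb{T}=[-\pi,\pi]$, $f=\sum_k\hat f(k)e^{ik\xi}$; $\mathcal{F}L^{\alpha,p}$: real distributions with $\hat f(0)=0$, $\|\langle k\rangle^\alpha\hat f(k)\|_{\ell^p}<\infty$, $\langle x\rangle=(1+x^2)^{1/2}$. $\dot X_\sigma$: $\widehat{\dot X_\sigma(\varphi_1,\varphi_2)}(k)=\frac{ik}{2}\sum_{k_1\ne0,k}e^{-3ikk_1k_2\sigma}\hat\varphi_1(k_1)\hat\varphi_2(k_2)$, $k_2=k-k_1$; $X_{ts}=\int_s^t\dot X_\sigma d\sigma$, $\widehat{X_{ts}(\varphi_1,\varphi_2)}(k)=\sum_{k_1\ne0,k}\frac{e^{-3ikk_1k_2s}-e^{-3ikk_1k_2t}}{6k_1k_2}\hat\varphi_1(k_1)\hat\varphi_2(k_2)$; $X^2_{ts}(\varphi_1,\varphi_2,\varphi_3)=2\int_s^td\sigma\int_s^\sigma d\sigma_1\dot X_\sigma(\varphi_1,\dot X_{\sigma_1}(\varphi_2,\varphi_3))$. $\mathcal{D}$: for $2\le p\le\infty$, $\{\alpha\ge-\tfrac12-\tfrac1p+\gamma,0\le\gamma<\tfrac14\}\cup\{\alpha>-1-\tfrac1p+3\gamma,\tfrac14\le\gamma\le\tfrac12\}$; for $1\le p\le2$, $\{\alpha\ge-1+\gamma,0\le\gamma<\tfrac1{2p}\}\cup\{\alpha>-1-\tfrac1p+3\gamma,\tfrac1{2p}\le\gamma\le\tfrac12\}$; $\mathcal{D}'=\mathcal{D}\cap\{\alpha>\max(-1/p,-1/2)\}$.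 ''$o(|t-s|)$'': the remainder $R_{ts}$ satisfies $\sup_{|t-s|\le h}|R_{ts}|/h\to0$. *)

(* Defs.v *)
(* MathComp-Analysis over an abstract R : realType,
   complex numbers R[i] from mathcomp-real-closed. *)
From HB Require Import structures.
From mathcomp Require Import all_boot all_order all_algebra.
From mathcomp Require Import complex.
From mathcomp Require Import all_classical all_reals all_analysis.
Set Implicit Arguments. Unset Strict Implicit. Unset Printing Implicit Defensive.
Import Order.TTheory GRing.Theory Num.Theory.
Import numFieldNormedType.Exports.
Local Open Scope ring_scope.
Local Open Scope classical_set_scope.

Section KdV.
Variable R : realType.

(* e^{i th} *)
Definition cre (z : R[i]) : R := let: Complex a _ := z in a.
Definition cim (z : R[i]) : R := let: Complex _ b := z in b.

Definition Cexpi (th : R) : R[i] := (cos th +i* sin th)%C.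

(* modulus of a complex number *)
Definition cabs (z : R[i]) : R := Num.sqrt (cre z ^+ 2 + cim z ^+ 2).

(* Japanese bracket <k> = (1 + k^2)^(1/2) *)
Definition jbr (k : int) : R := Num.sqrt (1 + (k%:~R) ^+ 2).

(* a (Fourier-side) distribution on T = [-pi,pi] is the family of its Fourier
   coefficients  k |-> \hat f(k) *)
Definition dist := int -> R[i].

Definition flsub (f g : dist) : dist := fun k => f k - g k.
Definition fladd (f g : dist) : dist := fun k => f k + g k.

(* 1/p, with 1/oo = 0 *)
Definition recp (p : \bar R) : R :=
  match p with EFin r => r^-1 | _ => 0 end.

(* |f|_{FL^{alpha,p}} = || <k>^alpha \hat f(k) ||_{l^p(Z)}, valued in [0,+oo] *)
Definition flnorm (alpha : R) (p : \bar R) (f : dist) : \bar R :=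
  match p with
  | EFin r => ((\esum_(k in [set: int]) ((jbr k `^ alpha * cabs (f k)) `^ r)%:E)
               `^ r^-1)%E
  | _ => ereal_sup (range (fun k : int => (jbr k `^ alpha * cabs (f k))%:E))
  end.

(* membership in FL^{alpha,p}: real distribution, zero mean, finite norm *)
Definition in_FL (alpha : R) (p : \bar R) (f : dist) : Prop :=
  f 0 = 0 /\ (forall k : int, f (- k) = ((f k)^*)%C) /\ (flnorm alpha p f < +oo)%E.

(* sum over Z (limit of symmetric partial sums, real and imaginary parts) *)
Definition zsum (a : int -> R[i]) : R[i] :=
  (limn (fun N : nat => \sum_(0 <= j < (2 * N).+1) cre (a (j%:Z - N%:Z)))
   +i* limn (fun N : nat => \sum_(0 <= j < (2 * N).+1) cim (a (j%:Z - N%:Z))))%C.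

(* integral over [s,t] (s <= t) of a complex-valued function, w.r.t. Lebesgue *)
Definition cint (s t : R) (f : R -> R[i]) : R[i] :=
  (Rintegral (@lebesgue_measure R) `[s, t] (fun x => cre (f x))
   +i* Rintegral (@lebesgue_measure R) `[s, t] (fun x => cim (f x)))%C.

(* X_{ts}(phi1,phi2) *)
Definition Xop (t s : R) (phi1 phi2 : dist) : dist := fun k =>
  zsum (fun k1 => if (k1 == 0) || (k1 == k) then 0 else
    let k2 := k - k1 in
    (Cexpi ((-3 * k * k1 * k2)%:~R * s) - Cexpi ((-3 * k * k1 * k2)%:~R * t))
      / ((6 * k1 * k2)%:~R) * phi1 k1 * phi2 k2).

(* X^2_{ts}(phi1,phi2,phi3)
   = 2 \int_s^t dsigma \int_s^sigma dsigma1 Xdot_sigma(phi1, Xdot_sigma1(phi2,phi3)),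
   written coefficientwise in Fourier variables, time integrals inside the sums *)
Definition X2op (t s : R) (phi1 phi2 phi3 : dist) : dist := fun k =>
  zsum (fun k1 => if (k1 == 0) || (k1 == k) then 0 else
    let k2 := k - k1 in
    zsum (fun k3 => if (k3 == 0) || (k3 == k2) then 0 else
      let k4 := k2 - k3 in
      2 * (('i)%C * k%:~R / 2) * (('i)%C * k2%:~R / 2)
        * cint s t (fun sg => Cexpi ((-3 * k * k1 * k2)%:~R * sg)
              * cint s sg (fun sg1 => Cexpi ((-3 * k2 * k3 * k4)%:~R * sg1)))
        * phi1 k1 * phi2 k3 * phi3 k4)).

(* the numerical scheme y^n_i *)
Fixpoint scheme (n : nat) (v0 : dist) (i : nat) : dist :=
  match i with
  | O => v0
  | S i' => let y := scheme n v0 i' in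
      fladd (fladd y (Xop (i'.+1%:R / n%:R) (i'%:R / n%:R) y y))
           (X2op (i'.+1%:R / n%:R) (i'%:R / n%:R) y y y)
  end.

(* the region D *)
Definition regD (p : \bar R) (alpha gamma : R) : Prop :=
  ((2%:E <= p)%E /\
     ((-(1/2) - recp p + gamma <= alpha /\ 0 <= gamma /\ gamma < 1/4) \/
      (-1 - recp p + 3 * gamma < alpha /\ 1/4 <= gamma /\ gamma <= 1/2)))
  \/
  ((1%:E <= p)%E /\ (p <= 2%:E)%E /\
     ((-1 + gamma <= alpha /\ 0 <= gamma /\ gamma < recp p / 2) \/
      (-1 - recp p + 3 * gamma < alpha /\ recp p / 2 <= gamma /\ gamma <= 1/2))).

(* D' *)
Definition regD' (p : \bar R) (alpha gamma : R) : Prop :=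
  regD p alpha gamma /\ Num.max (- recp p) (-(1/2)) < alpha.

End KdV.

(* Main.v *)
Require Import Defs.
From HB Require Import structures.
From mathcomp Require Import all_boot all_order all_algebra.
From mathcomp Require Import complex.
From mathcomp Require Import all_classical all_reals all_analysis.
From mathcomp Require Import ring lra zify.
Set Implicit Arguments. Unset Strict Implicit. Unset Printing Implicit Defensive.
Import Order.TTheory GRing.Theory Num.Theory.
Import numFieldNormedType.Exports.
Local Open Scope ring_scope.

(* Davie's argument. With [kap = 2 + alpha - 3 gamma > 1 - 1/p], the phases give [X = O(|t-s|^gamma)] and [X2 = O(|t-s|^(2 gamma))]: Hoelder's inequality with the weight [<k>^-kap] handles X, and X2 splits into a composition of two X-type kernels plus a near-resonant kernel. By Chen's relations the one-step map has defect [O(|t-s|^(3 gamma))]; as [3 gamma > 1], cutting in the middle bounds the distance of many steps from a single one. Applied to pairs (x, y) this yields a Lipschitz flow. The remainder [o(|t-s|)] of v is thus in fact [O(|t-s|^(3 gamma))], and n such errors propagate to [O(n^(1 - 3 gamma))]. *)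

(** * Abstract rough differential equations *)

(** The constants of the abstract estimates depend on [g], [c] and [M] only and are chosen before
    the group and its norm, because the same estimate is used on [V] and on [V * V]. Bounding [X2]
    by a square of [(t - s)^g] lets one small number [a] control both operators, and the defect is
    then a multiple of [a ^+ 3]. The obstacle on the analytic side is resonance. The two phases A
    and B in the double time integral of X2 may almost cancel, and integration then gains 1/|A| once
    instead of the product |A|^(g-1) |B|^(g-1) that a composition of two X-type kernels would need.
    Near cancellation forces, up to exchanging the last two inputs j and k - i - j, that i + j is
    small compared with i and k. Then |j| is comparable to |i| and |k - i - j| to |k|, so the
    weights at k and k - i - j compensate each other and those at i and j merge into |i|^(-1 - 2
    al). This is where al > -1/2 and al > -1/p enter. The Lipschitz estimate holds on a short time
    [h] only; the whole of [0,T] is reached through finitely many blocks, each of which at most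
    doubles the error, up to an additive term of the final order. *)

Record rough_driver (R : realType) (V : zmodType) (N : V -> R)
    (X : R -> R -> V -> V -> V) (X2 : R -> R -> V -> V -> V -> V)
    (T g c : R) : Prop := RoughDriver {
  rd_ge0 : forall x, 0 <= N x;
  rd_0 : N 0 = 0;
  rd_opp : forall x, N (- x) = N x;
  rd_add : forall x y, N (x + y) <= N x + N y;
  rd_XD : forall t s x y z, 0 <= s -> s <= t -> t <= T ->
    X t s (x + y) z = X t s x z + X t s y z;
  rd_XC : forall t s x y, 0 <= s -> s <= t -> t <= T -> X t s x y = X t s y x;
  rd_X2D1 : forall t s x y z w, 0 <= s -> s <= t -> t <= T ->
    X2 t s (x + y) z w = X2 t s x z w + X2 t s y z w;
  rd_X2D2 : forall t s x y z w, 0 <= s -> s <= t -> t <= T ->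
    X2 t s z (x + y) w = X2 t s z x w + X2 t s z y w;
  rd_X2D3 : forall t s x y z w, 0 <= s -> s <= t -> t <= T ->
    X2 t s z w (x + y) = X2 t s z w x + X2 t s z w y;
  rd_chen1 : forall t u s x y, 0 <= s -> s <= u -> u <= t -> t <= T ->
    X t s x y = X t u x y + X u s x y;
  rd_chen2 : forall t u s x y z, 0 <= s -> s <= u -> u <= t -> t <= T ->
    X2 t s x y z = X2 t u x y z + X2 u s x y z + X t u x (X u s y z) *+ 2;
  rd_Xle : forall t s x y, 0 <= s -> s <= t -> t <= T ->
    N (X t s x y) <= c * (t - s) `^ g * N x * N y;
  rd_X2le : forall t s x y z, 0 <= s -> s <= t -> t <= T ->
    N (X2 t s x y z) <= c * ((t - s) `^ g) ^+ 2 * N x * N y * N z }.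

Definition rstep (R : realType) (V : zmodType)
    (X : R -> R -> V -> V -> V) (X2 : R -> R -> V -> V -> V -> V)
    (t s : R) (x : V) : V := x + X t s x x + X2 t s x x x.

(** * Increment, Lipschitz and defect estimates for one step *)

Section OneStep.
Variables (R : realType) (V : zmodType) (N : V -> R).
Variables (X : R -> R -> V -> V -> V) (X2 : R -> R -> V -> V -> V -> V).
Variables (T g c : R).
Hypothesis H : rough_driver N X X2 T g c.
Hypothesis c0 : 0 <= c.
Local Notation Psi := (rstep X X2).

Lemma rd_sub x y : N (x - y) <= N x + N y.
Proof. by rewrite (le_trans (rd_add H _ _))// (rd_opp H). Qed.

Lemma rd_subC x y : N (x - y) = N (y - x).
Proof. by rewrite -opprB (rd_opp H). Qed.

Lemma rd_XD2 t s x y z : 0 <= s -> s <= t -> t <= T ->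
  X t s z (x + y) = X t s z x + X t s z y.
Proof. by move=> *; rewrite (rd_XC H)// (rd_XD H)// !(rd_XC H z). Qed.

Lemma rd_Xle' t s x y a A B : 0 <= s -> s <= t -> t <= T ->
  (t - s) `^ g <= a -> N x <= A -> N y <= B -> N (X t s x y) <= c * a * A * B.
Proof.
move=> s0 st tT ha hA hB; apply: le_trans (rd_Xle H x y s0 st tT) _.
by rewrite !ler_pM// ?mulr_ge0 ?powR_ge0 ?(rd_ge0 H).
Qed.

Lemma rd_X2le' t s x y z a A B C : 0 <= s -> s <= t -> t <= T ->
  (t - s) `^ g <= a -> N x <= A -> N y <= B -> N z <= C ->
  N (X2 t s x y z) <= c * a ^+ 2 * A * B * C.
Proof.
move=> s0 st tT ha hA hB hC; apply: le_trans (rd_X2le H x y z s0 st tT) _.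
have h2 : ((t - s) `^ g) ^+ 2 <= a ^+ 2.
  by rewrite ler_pXn2r// nnegrE ?powR_ge0// (le_trans _ ha)// powR_ge0.
by rewrite !ler_pM// ?mulr_ge0 ?exprn_ge0 ?powR_ge0 ?(rd_ge0 H).
Qed.

Definition incr_cst (M : R) := c * M ^+ 2 + c * M ^+ 3.

Lemma rstep_incr t s x a M : 0 <= s -> s <= t -> t <= T ->
  (t - s) `^ g <= a -> a <= 1 -> N x <= M ->
  N (X t s x x + X2 t s x x x) <= a * incr_cst M.
Proof.
move=> s0 st tT ha a1 xM.
have a0 : 0 <= a by rewrite (le_trans _ ha)// powR_ge0.
have M0 : 0 <= M by rewrite (le_trans _ xM)// (rd_ge0 H).
apply: le_trans (rd_add H _ _) _.
apply: le_trans (lerD (rd_Xle' s0 st tT ha xM xM)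
  (rd_X2le' s0 st tT ha xM xM xM)) _.
have : c * a ^+ 2 * M * M * M <= c * a * M * M * M.
  by rewrite !ler_wpM2r// ler_wpM2l// expr2 ler_piMr.
by rewrite /incr_cst => h; rewrite (le_trans (lerD (lexx _) h))// le_eqVlt; apply/orP; left; apply/eqP; ring.
Qed.

Definition lip_cst (M : R) := 2 * c * M + 3 * c * M ^+ 2.

Lemma rstep_lip t s x y a M : 0 <= s -> s <= t -> t <= T ->
  (t - s) `^ g <= a -> a <= 1 -> N x <= M -> N y <= M ->
  N (Psi t s x - Psi t s y) <= (1 + a * lip_cst M) * N (x - y).
Proof.
move=> s0 st tT ha a1 xM yM.
have a0 : 0 <= a by rewrite (le_trans _ ha)// powR_ge0.
have M0 : 0 <= M by rewrite (le_trans _ xM)// (rd_ge0 H).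
have -> : Psi t s x - Psi t s y = (x - y) + (X t s (x - y) x + X t s y (x - y))
   + (X2 t s (x - y) x x + X2 t s y (x - y) x + X2 t s y y (x - y)).
  set d := x - y.
  have xE : x = d + y by rewrite subrK.
  have e1 : X t s x x = X t s d x + X t s y d + X t s y y.
    by rewrite {1}xE (rd_XD H)// {2}xE rd_XD2// addrA.
  have e2 : X2 t s x x x = X2 t s d x x + X2 t s y d x + X2 t s y y d + X2 t s y y y.
    by rewrite {1}xE (rd_X2D1 H)// {3}xE (rd_X2D2 H)// {4}xE (rd_X2D3 H)// !addrA.
  apply/eqP; rewrite subr_eq /rstep e1 e2 {1}xE; apply/eqP.
  by rewrite !addrA [LHS](ACl (1*3*4*6*7*8*2*5*9))/= ?addrA.
have hX1 := rd_Xle' s0 st tT ha (lexx (N (x - y))) xM.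
have hX2 := rd_Xle' s0 st tT ha yM (lexx (N (x - y))).
have hY1 := rd_X2le' s0 st tT ha (lexx (N (x - y))) xM xM.
have hY2 := rd_X2le' s0 st tT ha yM (lexx (N (x - y))) xM.
have hY3 := rd_X2le' s0 st tT ha yM yM (lexx (N (x - y))).
have n0 := rd_ge0 H (x - y).
apply: le_trans (rd_add H _ _) _.
apply: le_trans (lerD (rd_add H _ _) (rd_add H _ _)) _.
apply: le_trans (lerD (lerD (lexx _) (rd_add H _ _)) (lerD (rd_add H _ _) (lexx _))) _.
have aa : c * a ^+ 2 * M * M * N (x - y) <= c * a * M * M * N (x - y).
  by rewrite !ler_wpM2r// ler_wpM2l// expr2 ler_piMr.
rewrite /lip_cst; move: hX1 hX2 hY1 hY2 hY3 aa.
move: (N (X _ _ _ _)) (N (X _ _ _ _)) (N (X2 _ _ _ _ _)) (N (X2 _ _ _ _ _)) (N (X2 _ _ _ _ _)) => *.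
lra.
Qed.

Definition defect_cst (M : R) :=
  let D := incr_cst M in
  2 * c ^+ 2 * M ^+ 4 + c * D ^+ 2 + c * D * (M + D) ^+ 2
  + c * M * D * (M + D) + c * M ^+ 2 * D.

(** Expanding around [x], Chen's relations cancel all terms of order one and two in [a]. The
    summands of [defect_cst] bound, in this order, the five kinds of terms that survive, each of
    order three. *)
Lemma rstep_defect t u s x a M : 0 <= s -> s <= u -> u <= t -> t <= T ->
  0 <= g -> (t - s) `^ g <= a -> a <= 1 -> N x <= M ->
  N (Psi t u (Psi u s x) - Psi t s x) <= a ^+ 3 * defect_cst M.
Proof.
move=> s0 su ut tT g0 ha a1 xM.
have u0 : 0 <= u by exact: le_trans su.
have uT : u <= T by exact: le_trans tT.
have st : s <= t by exact: le_trans ut.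
have hau : (u - s) `^ g <= a.
  by rewrite (le_trans _ ha)// ge0_ler_powR ?nnegrE ?subr_ge0// lerB.
have hat : (t - u) `^ g <= a.
  by rewrite (le_trans _ ha)// ge0_ler_powR ?nnegrE ?subr_ge0// lerB.
have a0 : 0 <= a by rewrite (le_trans _ ha)// powR_ge0.
have M0 : 0 <= M by rewrite (le_trans _ xM)// (rd_ge0 H).
have hd := rstep_incr s0 su uT hau a1 xM.
set D := incr_cst M in hd *.
have D0 : 0 <= D by rewrite /D /incr_cst addr_ge0// mulr_ge0// exprn_ge0.
have -> : Psi u s x = x + (X u s x x + X2 u s x x x) by rewrite /rstep addrA.
set d := X u s x x + _ in hd *.
have hxd : N (x + d) <= M + D.
  by rewrite (le_trans (rd_add H _ _))// lerD// (le_trans hd)// ler_piMl.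
set B := X2 u s x x x in d hd hxd *.
set A := X u s x x in d hd hxd *.
(* The term [X t u x A *+ 2], of order two only, is absent: it is exactly the correction in
   [rd_chen2]. *)
have -> : Psi t u (x + d) - Psi t s x = (X t u x B *+ 2 + X t u d d)
   + (X2 t u d (x + d) (x + d) + X2 t u x d (x + d) + X2 t u x x d).
  have e1 : X t u (x + d) (x + d) = X t u x B *+ 2 + X t u d d + (X t u x A *+ 2 + X t u x x).
    rewrite (rd_XD H)// !rd_XD2// (rd_XC H d x)// /d !rd_XD2//.
    rewrite !mulr2n !addrA.
    by rewrite [LHS](ACl (3*5*6*7*2*4*1))/= ?addrA.
  have e2 : X2 t u (x + d) (x + d) (x + d) = X2 t u d (x + d) (x + d) + X2 t u x d (x + d) + X2 t u x x d + X2 t u x x x.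
    rewrite {1}addrC (rd_X2D1 H)// -!addrA; congr (_ + _).
    rewrite {1}addrC (rd_X2D2 H)//; congr (_ + _).
    by rewrite {1}addrC (rd_X2D3 H)//.
  apply/eqP; rewrite subr_eq /rstep e1 e2 (rd_chen1 H x x s0 su ut tT).
  rewrite (rd_chen2 H x x x s0 su ut tT) -/A -/B; apply/eqP.
  have dE : d = A + B by [].
  clearbody d; rewrite {1}dE !mulr2n !addrA.
  by rewrite [LHS](ACl (4*5*6*10*11*12*1*9*2*13*3*7*8))/= ?addrA.
have hB : N B <= c * a ^+ 2 * M * M * M by exact: rd_X2le'.
have hX1 := rd_Xle' u0 ut tT hat xM hB.
have hX2 := rd_Xle' u0 ut tT hat hd hd.
have hY1 := rd_X2le' u0 ut tT hat hd hxd hxd.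
have hY2 := rd_X2le' u0 ut tT hat xM hd hxd.
have hY3 := rd_X2le' u0 ut tT hat xM xM hd.
apply: le_trans (rd_add H _ _) _.
apply: le_trans (lerD (rd_add H _ _) (rd_add H _ _)) _.
apply: le_trans (lerD (lerD (rd_add H _ _) (lexx _)) (lerD (rd_add H _ _) (lexx _))) _.
rewrite /defect_cst -/D; move: hX1 hX2 hY1 hY2 hY3.
move: (N (X _ _ _ _)) (N (X _ _ _ _)) (N (X2 _ _ _ _ _)) (N (X2 _ _ _ _ _)) (N (X2 _ _ _ _ _)) => z1 z2 z3 z4 z5 *.
have -> : a ^+ 3 * (2 * c ^+ 2 * M ^+ 4 + c * D ^+ 2 + c * D * (M + D) ^+ 2
  + c * M * D * (M + D) + c * M ^+ 2 * D) = 
  (c * a * M * (c * a ^+ 2 * M * M * M) + c * a * M * (c * a ^+ 2 * M * M * M)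
  + c * a * (a * D) * (a * D)) + (c * a ^+ 2 * (a * D) * (M + D) * (M + D)
  + c * a ^+ 2 * M * (a * D) * (M + D) + c * a ^+ 2 * M * M * (a * D)) by ring.
lra.
Qed.
End OneStep.

Lemma powR_small (R : realType) (g e : R) : 0 < g -> 0 < e ->
  exists h, [/\ 0 < h, h <= 1 & h `^ g <= e].
Proof.
move=> g0 e0; exists (Num.min 1 (e `^ g^-1)).
rewrite lt_min ltr01 powR_gt0//= ge_min lexx/=; split => //.
have h0 : 0 <= Num.min 1 (e `^ g^-1) by rewrite le_min ler01 powR_ge0.
apply: (@le_trans _ _ ((e `^ g^-1) `^ g)).
  by rewrite ge0_ler_powR ?nnegrE ?powR_ge0 ?(ltW g0)// ge_min lexx orbT.
by rewrite -powRrM mulVf ?gt_eqF// powRr1// ltW.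
Qed.

Lemma powR_cube (R : realType) (x g : R) : (x `^ g) ^+ 3 = x `^ (3 * g).
Proof. by rewrite -powR_mulrn ?powR_ge0// -powRrM mulrC. Qed.

(** Write z^(3g) = z z^(3g-1) for z = x and z = y and bound the second factor at 2/3 (x + y). The
    first factors add up to x + y, so the exponent above one leaves a gain. *)
Lemma powR_split (R : realType) (g x y : R) : 1 < 3 * g -> 0 <= x -> 0 <= y ->
  x <= 2 / 3 * (x + y) -> y <= 2 / 3 * (x + y) ->
  (x `^ g) ^+ 3 + (y `^ g) ^+ 3 <= (2 / 3) `^ (3 * g - 1) * ((x + y) `^ g) ^+ 3.
Proof.
move=> g1 x0 y0 hx hy; rewrite !powR_cube.
have g3 : 0 < 3 * g by lra.
have xy0 : 0 <= x + y by rewrite addr_ge0.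
have key z : 0 <= z -> z <= 2 / 3 * (x + y) ->
    z `^ (3 * g) <= z * ((2 / 3) `^ (3 * g - 1) * (x + y) `^ (3 * g - 1)).
  move=> z0 hz; rewrite -(@mulr_powRB1 _ z)// ler_wpM2l// -powRM//.
  by rewrite ge0_ler_powR ?nnegrE ?mulr_ge0// subr_ge0 ltW.
rewrite (le_trans (lerD (key _ x0 hx) (key _ y0 hy)))//.
by rewrite -mulrDl mulrCA mulr_powRB1.
Qed.

(** * Trajectories on a uniform grid stay close to a single long step *)

Section Grid.
Variables (R : realType) (tt : nat -> R) (th : R).
Hypothesis th0 : 0 <= th.
Hypothesis Htt : forall i, tt i.+1 = tt i + th.

Lemma grid_shift i n : tt (i + n)%N = tt i + n%:R * th.
Proof.
elim: n => [|n IH]; first by rewrite addn0 mul0r addr0.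
by rewrite addnS Htt IH -addrA -natr1 mulrDl mul1r.
Qed.

Lemma grid_le i j : (i <= j)%N -> tt i <= tt j.
Proof. by move=> ij; rewrite -(subnKC ij) grid_shift lerDl mulr_ge0. Qed.
End Grid.

(* [2/3] is the largest share of a part when [n >= 2] steps are cut in the middle. *)
Definition split_rate (R : realType) (g : R) : R := (2 / 3) `^ (3 * g - 1).

Lemma split_rate_lt1 (R : realType) (g : R) : 1 < 3 * g -> split_rate g < 1.
Proof.
move=> g1; rewrite /split_rate /powR ifF; last by apply/negbTE; rewrite gt_eqF//; lra.
rewrite -[ltRHS]expR0 ltr_expR pmulr_rlt0 ?subr_gt0// ln_lt0//; lra.
Qed.

Section Trajectory.
Variables (R : realType) (g c M : R).
Hypotheses (g1 : 1 < 3 * g) (c0 : 0 <= c) (M0 : 0 <= M).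

(** A discrete sewing argument. The two conclusions support each other: closeness to a single step
    from index 0 keeps the trajectory within distance one of its start, and this a priori bound
    fixes the constants in the closeness estimate at later indices. *)
Lemma trajectory_close : exists L h : R, [/\ 0 <= L, 0 < h, h <= 1 &
  forall (V : zmodType) (N : V -> R) X X2 (T : R),
  rough_driver N X X2 T g c ->
  forall (tt : nat -> R) (th : R) (y : nat -> V) (m : nat),
  0 <= th -> (forall i, tt i.+1 = tt i + th) -> 0 <= tt 0%N -> tt m <= T ->
  m%:R * th <= h ->
  (forall i, (i < m)%N -> y i.+1 = rstep X X2 (tt i.+1) (tt i) (y i)) ->
  N (y 0%N) <= M ->
  forall k, (k <= m)%N -> N (y k - y 0%N) <= 1 /\
    forall i, (i < k)%N ->
      N (y k - rstep X X2 (tt k) (tt i) (y i)) <= L * ((k - i)%:R * th) `^ (3 * g)].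
Proof.
have lam1 := split_rate_lt1 g1; set lam := split_rate g in lam1.
have g1x := g1; have M0x := M0; have g0 : 0 < g by lra.
(* Trajectory points have norm at most [M + 1]; one long step from such a point adds at most one,
   hence [M + 2] in the Lipschitz constant. *)
pose D := incr_cst c (M + 1); pose K := lip_cst c (M + 2).
pose Dd := defect_cst c (M + 1).
have M1 : 0 <= M + 1 by lra.
have M2 : 0 <= M + 2 by lra.
have D0 : 0 <= D by rewrite /D /incr_cst addr_ge0// mulr_ge0// exprn_ge0.
have K0 : 0 <= K by rewrite /K /lip_cst addr_ge0// !mulr_ge0// exprn_ge0.
have Dd0 : 0 <= Dd.
  by rewrite /Dd /defect_cst -/D; do ?[apply: addr_ge0 | apply: mulr_ge0 | apply: exprn_ge0 | exact: c0 | done].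
(* Chosen so that [L * lam] from the two halves, [L * (1 - lam) / 2] from the Lipschitz factor and
   the defect [Dd = L * (1 - lam) / 2] add up to [L]. *)
pose L := 2 * Dd / (1 - lam).
have lam1' : 0 < 1 - lam by rewrite subr_gt0.
have L0 : 0 <= L by rewrite /L !mulr_ge0// invr_ge0 ltW.
(* The first entry gives [a * K <= (1 - lam) / 2]; the second gives [a * (D + L) <= 1], which
   confines the trajectory to the unit ball around its start. *)
pose e := Num.min ((1 - lam) / 2 / (K + 1)) (D + L + 1)^-1.
have DL1 : 0 < D + L + 1 by rewrite ltr_wpDl// addr_ge0.
have K1 : 0 < K + 1 by rewrite ltr_wpDl.
have e0 : 0 < e by rewrite /e lt_min !divr_gt0//= invr_gt0.
have [h [h0 h1 he]] := powR_small g0 e0.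
exists L, h; split => // V N X X2 T H tt th y m th0 Htt tt0 ttT mh Hy y0M.
have heK a : 0 <= a -> a <= e -> a * K <= (1 - lam) / 2.
  move=> a0 ae; apply: (@le_trans _ _ (e * (K + 1))); first by apply: ler_pM => //; lra.
  by rewrite -ler_pdivlMr// /e ge_min lexx.
have heD a : 0 <= a -> a <= e -> a * (D + L) <= 1.
  move=> a0 ae; apply: (@le_trans _ _ (e * (D + L + 1))).
    by apply: ler_pM => //; [rewrite addr_ge0|lra].
  by rewrite -ler_pdivlMr// div1r /e ge_min lexx orbT.
have ga n : (n <= m)%N -> (n%:R * th) `^ g <= e /\ (n%:R * th) `^ g <= 1.
  move=> nm; have nh : n%:R * th <= h.
    by apply: le_trans mh; rewrite ler_wpM2r// ler_nat.
  have hg : (n%:R * th) `^ g <= h `^ g.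
    by rewrite ge0_ler_powR ?nnegrE ?mulr_ge0// ltW.
  split; first exact: le_trans hg he.
  apply: le_trans hg _; have -> : 1 = 1 `^ g :> R by rewrite powR1.
  by rewrite ge0_ler_powR ?nnegrE ?(ltW g0) ?(ltW h0).
have sub i k : (i <= k)%N -> tt k - tt i = (k - i)%:R * th.
  by move=> ik; rewrite -{1}(subnKC ik) (grid_shift Htt) addrC addKr.
have tpos i : 0 <= tt i by apply: le_trans tt0 _; exact: (grid_le th0 Htt).
have tleT i : (i <= m)%N -> tt i <= T by move=> im; apply: le_trans ttT; exact: (grid_le th0 Htt).
elim/ltn_ind => k IHk km.
have IHb i : (i < k)%N -> N (y i) <= M + 1.
  move=> ik; have [+ _] := IHk i ik (leq_trans (ltnW ik) km).
  move=> hb; rewrite -(subrK (y 0%N) (y i)) (le_trans (rd_add H _ _))// addrC.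
  by rewrite lerD.
have close : forall i, (i < k)%N ->
  N (y k - rstep X X2 (tt k) (tt i) (y i)) <= L * (((k - i)%:R * th) `^ g) ^+ 3.
  (* The right half, from [j] to [k], is covered by this inner induction on the number of steps; the
     left half, which ends at [j < k], by the outer one. *)
  move=> i; move En : (k - i)%N => n; elim/ltn_ind: n i En => n IHn i En ik.
  have [n1|n1] := leqP n 1.
    have nE : n = 1%N by apply/eqP; rewrite eqn_leq n1 -En subn_gt0 ik.
    have kE : k = i.+1 by clear -En nE ik; lia.
    rewrite kE Hy ?subrr ?(rd_0 H); last by rewrite -kE.
    by rewrite mulr_ge0// exprn_ge0// powR_ge0.
  pose p1 := n./2; pose j := (i + p1)%N.
  have [p1E p10 ij jk kj] : [/\ (p1 + (n - p1))%N = n, (0 < p1)%N, (i < j)%N,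
      (j < k)%N & (k - j = n - p1)%N].
    by rewrite /j /p1; clear -En n1 ik; split; lia.
  have [ji nm nn1 p13 p23] : [/\ (j - i = p1)%N, (n <= m)%N, (n - p1 < n)%N,
      (p1 * 3 <= 2 * n)%N & ((n - p1) * 3 <= 2 * n)%N].
    by rewrite /j /p1; clear -En n1 ik km; split; lia.
  set a := (n%:R * th) `^ g.
  have [ae a1] := ga n nm; rewrite -/a in ae a1.
  have a0 : 0 <= a by exact: powR_ge0.
  have h1' := IHn (n - p1)%N nn1 j kj jk.
  have [_ h2'] := IHk j jk (leq_trans (ltnW jk) km).
  have {h2'} := h2' i ij; rewrite ji -powR_cube => h2'.
  have akj : (tt k - tt j) `^ g <= a.
    rewrite sub ?kj; last exact: ltnW.
    rewrite ge0_ler_powR ?nnegrE ?mulr_ge0// ?(ltW g0)// ler_wpM2r// ler_nat.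
    exact: leq_subr.
  have aji : (tt j - tt i) `^ g <= a.
    rewrite sub ?ji; last exact: ltnW.
    rewrite ge0_ler_powR ?nnegrE ?mulr_ge0// ?(ltW g0)// ler_wpM2r// ler_nat.
    by rewrite -p1E leq_addr.
  have aki : (tt k - tt i) `^ g <= a by rewrite sub ?En// ltnW.
  have tij : tt i <= tt j by apply: (grid_le th0 Htt); exact: ltnW.
  have tjk : tt j <= tt k by apply: (grid_le th0 Htt); exact: ltnW.
  have tkT := tleT k km.
  have yjM := IHb j jk.
  have yiM := IHb i ik.
  set z := rstep X X2 (tt j) (tt i) (y i) in h2'.
  have zM : N z <= M + 2.
    rewrite /z /rstep -addrA (le_trans (rd_add H _ _))//.
    have := rstep_incr H c0 (tpos i) tij (le_trans tjk tkT) aji a1 yiM.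
    have : a * incr_cst c (M + 1) <= 1.
      by rewrite (le_trans _ (heD a a0 ae))// ler_wpM2l// lerDl.
    lra.
  have yjM2 : N (y j) <= M + 2 by lra.
  have h3 := rstep_lip H c0 (tpos j) tjk tkT akj a1 yjM2 zM.
  have h4 := rstep_defect H c0 (tpos i) tij tjk tkT (ltW g0) aki a1 yiM.
  (* Error of the right half, error of the left half carried over by one Lipschitz step, and defect
     of the one-step map at [tt j]. *)
  have tri : N (y k - rstep X X2 (tt k) (tt i) (y i)) <=
     N (y k - rstep X X2 (tt k) (tt j) (y j))
   + N (rstep X X2 (tt k) (tt j) (y j) - rstep X X2 (tt k) (tt j) z)
   + N (rstep X X2 (tt k) (tt j) z - rstep X X2 (tt k) (tt i) (y i)).
    rewrite -(subrKA (rstep X X2 (tt k) (tt j) z) (y k)) (le_trans (rd_add H _ _))//.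
    rewrite lerD2r -(subrKA (rstep X X2 (tt k) (tt j) (y j)) (y k)).
    by rewrite (le_trans (rd_add H _ _)).
  apply: le_trans tri _.
  have aK := heK a a0 ae.
  have sp : ((p1%:R * th) `^ g) ^+ 3 + (((n - p1)%:R * th) `^ g) ^+ 3 <= lam * a ^+ 3.
    have -> : a = (p1%:R * th + (n - p1)%:R * th) `^ g.
      by rewrite -mulrDl -natrD p1E.
    apply: powR_split => //; rewrite ?mulr_ge0// -mulrDl -natrD p1E mulrA ler_wpM2r//.
      by rewrite mulrAC ler_pdivlMr// -!natrM ler_nat.
    by rewrite mulrAC ler_pdivlMr// -!natrM ler_nat.
  have Dd_L : Dd = L * ((1 - lam) / 2) by rewrite /L; field; lra.
  have s1 : ((p1%:R * th) `^ g) ^+ 3 <= a ^+ 3.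
    by rewrite ler_pXn2r// ?nnegrE ?powR_ge0//; move: aji; rewrite sub ?ji// ltnW.
  set b1 := ((p1%:R * th) `^ g) ^+ 3 in h2' sp s1.
  set b2 := (((n - p1)%:R * th) `^ g) ^+ 3 in h1' sp.
  have h3' : (1 + a * lip_cst c (M + 2)) * N (y j - z) <= L * b1 + (1 - lam) / 2 * (L * a ^+ 3).
    rewrite mulrDl mul1r lerD// ler_pM// ?mulr_ge0// ?(rd_ge0 H)//.
    by rewrite (le_trans h2')// ler_wpM2l.
  move: h4; rewrite -/Dd Dd_L => h4.
  have Lsp : L * (b1 + b2) <= L * (lam * a ^+ 3) by rewrite ler_wpM2l.
  lra.
split; last by move=> i ik; rewrite -powR_cube; exact: close.
have [k0|k0] := posnP k; first by rewrite k0 subrr (rd_0 H).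
have := close 0%N k0; rewrite subn0.
have [ae a1] := ga k km.
set a := (k%:R * th) `^ g in ae a1 * => hc.
have a0 : 0 <= a by exact: powR_ge0.
have ak0 : (tt k - tt 0%N) `^ g <= a by rewrite sub// subn0.
have y0M1 : N (y 0%N) <= M + 1 by lra.
have := rstep_incr H c0 tt0 (grid_le th0 Htt (leq0n k)) (tleT k km) ak0 a1 y0M1.
rewrite -/D => hd.
rewrite -(subrKA (rstep X X2 (tt k) (tt 0%N) (y 0%N)) (y k)) (le_trans (rd_add H _ _))//.
have -> : rstep X X2 (tt k) (tt 0%N) (y 0%N) - y 0%N =
   X (tt k) (tt 0%N) (y 0%N) (y 0%N) + X2 (tt k) (tt 0%N) (y 0%N) (y 0%N) (y 0%N).
  by apply/eqP; rewrite subr_eq [eqbRHS]addrC /rstep addrA.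
have : L * a ^+ 3 <= L * a.
  by rewrite ler_wpM2l// exprS ler_piMr// exprn_ile1.
have := heD a a0 ae; lra.
Qed.
End Trajectory.

(* Working in [V * V] with the third component [N (x - y) / lam] turns a bound on trajectories into a Lipschitz estimate for the flow. *)
Section Pair.
Variables (R : realType) (V : zmodType) (N : V -> R).
Variables (X : R -> R -> V -> V -> V) (X2 : R -> R -> V -> V -> V -> V).

Definition pair_norm (lam : R) (w : V * V) : R :=
  Num.max (Num.max (N w.1) (N w.2)) (N (w.1 - w.2) / lam).

Definition pair_X t s (w z : V * V) : V * V := (X t s w.1 z.1, X t s w.2 z.2).

Definition pair_X2 t s (w z u : V * V) : V * V :=
  (X2 t s w.1 z.1 u.1, X2 t s w.2 z.2 u.2).

Lemma pair_norm_le lam w a : 0 < lam ->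
  (pair_norm lam w <= a) = [&& N w.1 <= a, N w.2 <= a & N (w.1 - w.2) <= a * lam].
Proof. by move=> l0; rewrite /pair_norm !ge_max ler_pdivrMr// andbA. Qed.

(** A difference of products telescopes into at most three terms with one difference factor each.
    That factor is at most [lam] times the pair norm, so [lam] cancels in the third component and
    the constant [3 * c] does not depend on it. *)
Lemma pair_rough_driver (T g c lam : R) : 0 <= c -> 0 < lam ->
  rough_driver N X X2 T g c ->
  rough_driver (pair_norm lam) pair_X pair_X2 T g (3 * c).
Proof.
move=> c0 l0 H.
have n1 w : N w.1 <= pair_norm lam w by rewrite /pair_norm !le_max lexx.
have n2 w : N w.2 <= pair_norm lam w by rewrite /pair_norm !le_max lexx !orbT.
have n3 w : N (w.1 - w.2) <= pair_norm lam w * lam.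
  by rewrite -ler_pdivrMr// /pair_norm !le_max lexx !orbT.
have n0 w : 0 <= pair_norm lam w by rewrite (le_trans _ (n1 w))// (rd_ge0 H).
constructor.
- exact: n0.
- by rewrite /pair_norm /= subr0 (rd_0 H) mul0r !maxxx.
- by move=> x; rewrite /pair_norm /= -opprD !(rd_opp H).
- move=> x y; rewrite pair_norm_le//=; apply/and3P; split.
  + by rewrite (le_trans (rd_add H _ _))// lerD.
  + by rewrite (le_trans (rd_add H _ _))// lerD.
  + by rewrite opprD addrACA (le_trans (rd_add H _ _))// mulrDl lerD.
- by move=> t s x y z s0 st tT; rewrite /pair_X /= !(rd_XD H).
- by move=> t s x y s0 st tT; rewrite /pair_X !(rd_XC H x.1) // (rd_XC H x.2).
- by move=> t s x y z w s0 st tT; rewrite /pair_X2 /= !(rd_X2D1 H).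
- by move=> t s x y z w s0 st tT; rewrite /pair_X2 /= !(rd_X2D2 H).
- by move=> t s x y z w s0 st tT; rewrite /pair_X2 /= !(rd_X2D3 H).
- move=> t u s x y s0 su ut tT; rewrite /pair_X /=.
  by rewrite !(rd_chen1 H _ _ s0 su ut tT).
- move=> t u s x y z s0 su ut tT; rewrite /pair_X /pair_X2 /=.
  by rewrite !(rd_chen2 H _ _ _ s0 su ut tT) mulr2n.
- move=> t s x y s0 st tT; rewrite /pair_X pair_norm_le//=.
  set a := (t - s) `^ g.
  have aa : (t - s) `^ g <= a by [].
  have a0 : 0 <= a by exact: powR_ge0.
  set A := pair_norm lam x; set B := pair_norm lam y.
  have AB : 0 <= c * a * A * B by rewrite !mulr_ge0// n0.
  have -> : 3 * c * a * A * B = 3 * (c * a * A * B) by ring.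
  apply/and3P; split.
  + have := rd_Xle' H c0 s0 st tT aa (n1 x) (n1 y); rewrite -/A -/B; lra.
  + have := rd_Xle' H c0 s0 st tT aa (n2 x) (n2 y); rewrite -/A -/B; lra.
  + have -> : X t s x.1 y.1 - X t s x.2 y.2 = X t s (x.1 - x.2) y.1 + X t s x.2 (y.1 - y.2).
      apply/eqP; rewrite subr_eq -addrA -(rd_XD2 H)// subrK -(rd_XD H)// subrK//.
    have h1 := rd_Xle' H c0 s0 st tT aa (n3 x) (n1 y).
    have h2 := rd_Xle' H c0 s0 st tT aa (n2 x) (n3 y).
    rewrite (le_trans (rd_add H _ _))// (le_trans (lerD h1 h2))// -/A -/B.
    have -> : c * a * (A * lam) * B = c * a * A * B * lam by ring.
    have -> : c * a * A * (B * lam) = c * a * A * B * lam by ring.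
    rewrite -mulrDl ler_wpM2r ?(ltW l0)//; lra.
- move=> t s x y z s0 st tT; rewrite /pair_X2 pair_norm_le//=.
  set a := (t - s) `^ g.
  have aa : (t - s) `^ g <= a by [].
  have a0 : 0 <= a by exact: powR_ge0.
  set A := pair_norm lam x; set B := pair_norm lam y; set C := pair_norm lam z.
  have AB : 0 <= c * a ^+ 2 * A * B * C by rewrite !mulr_ge0 ?exprn_ge0// n0.
  have -> : 3 * c * a ^+ 2 * A * B * C = 3 * (c * a ^+ 2 * A * B * C) by ring.
  apply/and3P; split.
  + have := rd_X2le' H c0 s0 st tT aa (n1 x) (n1 y) (n1 z); rewrite -/A -/B -/C; lra.
  + have := rd_X2le' H c0 s0 st tT aa (n2 x) (n2 y) (n2 z); rewrite -/A -/B -/C; lra.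
  + have -> : X2 t s x.1 y.1 z.1 - X2 t s x.2 y.2 z.2 = X2 t s (x.1 - x.2) y.1 z.1
       + X2 t s x.2 (y.1 - y.2) z.1 + X2 t s x.2 y.2 (z.1 - z.2).
      apply/eqP; rewrite subr_eq -[in eqbRHS]addrA -(rd_X2D3 H)// subrK.
      by rewrite -[in eqbRHS]addrA -(rd_X2D2 H)// subrK -(rd_X2D1 H)// subrK.
    have h1 := rd_X2le' H c0 s0 st tT aa (n3 x) (n1 y) (n1 z).
    have h2 := rd_X2le' H c0 s0 st tT aa (n2 x) (n3 y) (n1 z).
    have h3 := rd_X2le' H c0 s0 st tT aa (n2 x) (n2 y) (n3 z).
    rewrite (le_trans (rd_add H _ _))// (le_trans (lerD (rd_add H _ _) (lexx _)))//.
    rewrite (le_trans (lerD (lerD h1 h2) h3))// -/A -/B -/C le_eqVlt.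
    by apply/orP; left; apply/eqP; ring.
Qed.
End Pair.

(** * The discrete flow and the propagation of local errors *)

Fixpoint rflow (R : realType) (V : zmodType)
    (X : R -> R -> V -> V -> V) (X2 : R -> R -> V -> V -> V -> V)
    (tt : nat -> R) (x : V) (n : nat) : V :=
  if n is n'.+1 then rstep X X2 (tt n'.+1) (tt n') (rflow X X2 tt x n') else x.

Lemma rflow_pair (R : realType) (V : zmodType)
    (X : R -> R -> V -> V -> V) (X2 : R -> R -> V -> V -> V -> V) tt x y n :
  rflow (pair_X X) (pair_X2 X2) tt (x, y) n = (rflow X X2 tt x n, rflow X X2 tt y n).
Proof. by elim: n => //= n ->. Qed.

Lemma rflow_shift (R : realType) (V : zmodType)
    (X : R -> R -> V -> V -> V) (X2 : R -> R -> V -> V -> V -> V) tt x n :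
  rflow X X2 tt x n.+1 = rflow X X2 (fun i => tt i.+1) (rstep X X2 (tt 1%N) (tt 0%N) x) n.
Proof. by elim: n => //= n ->. Qed.

(** The pair trajectory moves by at most one in [pair_norm lam], so the difference of the two flows
    moves by at most [lam]. The bound is stated with a positive [lam] above the initial distance
    because the pair norm divides by it and the distance itself may vanish. *)
Lemma rflow_lip (R : realType) (g c M : R) : 1 < 3 * g -> 0 <= c -> 0 <= M ->
  exists h : R, [/\ 0 < h, h <= 1 & forall (V : zmodType) (N : V -> R) X X2 (T : R),
  rough_driver N X X2 T g c ->
  forall (tt : nat -> R) (th : R) (m : nat),
  0 <= th -> (forall i, tt i.+1 = tt i + th) -> 0 <= tt 0%N -> tt m <= T ->
  m%:R * th <= h -> forall x y lam, N x <= M -> N y <= M -> 0 < lam ->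
  N (x - y) <= lam -> N (rflow X X2 tt x m - rflow X X2 tt y m) <= 2 * lam].
Proof.
move=> g1 c0 M0.
have c30 : 0 <= 3 * c by rewrite mulr_ge0.
have M10 : 0 <= M + 1 by lra.
have [L [h [L0 h0 h1 Hh]]] := trajectory_close g1 c30 M10.
exists h; split => // V N X X2 T H tt th m th0 Htt tt0 ttT mh x y lam xM yM l0 xy.
have HP := pair_rough_driver c0 l0 H.
have := Hh _ _ _ _ _ HP tt th (rflow (pair_X X) (pair_X2 X2) tt (x, y)) m th0 Htt tt0 ttT mh
  (fun _ _ => erefl) _ m (leqnn m).
case.
  rewrite /= pair_norm_le//=; apply/and3P; split; [lra|lra|].
  by rewrite (le_trans xy)// ler_peMl ?(ltW l0)//; lra.
move=> + _; rewrite rflow_pair pair_norm_le//= => /and3P[_ _].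
rewrite mul1r => h2.
have -> : rflow X X2 tt x m - rflow X X2 tt y m =
   (rflow X X2 tt x m - rflow X X2 tt y m - (x - y)) + (x - y) by rewrite subrK.
rewrite (le_trans (rd_add H _ _))//.
suff : N (rflow X X2 tt x m - rflow X X2 tt y m - (x - y)) <= lam by lra.
by move: h2; rewrite !opprD !opprK !addrA [X in N X](ACl (1*3*2*4)).
Qed.

Section Chain.
Variables (R : realType) (V : zmodType) (N : V -> R).
Variables (X : R -> R -> V -> V -> V) (X2 : R -> R -> V -> V -> V -> V).
Variables (T g c M h : R).
Hypothesis H : rough_driver N X X2 T g c.
Hypothesis Hlip : forall (tt : nat -> R) (th : R) (m : nat),
  0 <= th -> (forall i, tt i.+1 = tt i + th) -> 0 <= tt 0%N -> tt m <= T ->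
  m%:R * th <= h -> forall x y lam, N x <= M + 1 -> N y <= M + 1 -> 0 < lam ->
  N (x - y) <= lam -> N (rflow X X2 tt x m - rflow X X2 tt y m) <= 2 * lam.

(** Telescoping over the flows restarted at each [x i]: every local error [r] reaches the end
    multiplied by at most 2. A restarted point is within [r <= 1] of some [x i], which is why [Hlip]
    is assumed on the ball of radius [M + 1]. *)
Lemma rflow_chain r m (tt : nat -> R) th (x : nat -> V) : 0 < r -> r <= 1 ->
  0 <= th -> (forall i, tt i.+1 = tt i + th) -> 0 <= tt 0%N -> tt m <= T ->
  m%:R * th <= h ->
  (forall i, (i <= m)%N -> N (x i) <= M) ->
  (forall i, (i < m)%N -> N (x i.+1 - rstep X X2 (tt i.+1) (tt i) (x i)) <= r) ->
  N (x m - rflow X X2 tt (x 0%N) m) <= 2 * m%:R * r.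
Proof.
move=> r0 r1; elim: m tt x => [|m IH] tt x th0 Htt tt0 ttT mh xM xr.
  by rewrite /= subrr (rd_0 H) mulr0 mul0r.
have mm : m%:R * th <= h by rewrite (le_trans _ mh)// ler_wpM2r// ler_nat.
have tt1 : 0 <= tt 1%N by rewrite Htt addr_ge0.
have := IH (fun i => tt i.+1) (fun i => x i.+1) th0 (fun i => Htt i.+1) tt1 ttT mm
  (fun i => xM i.+1) (fun i => xr i.+1).
rewrite rflow_shift.
set p := rstep _ _ _ _ _.
set f := rflow _ _ _ => h1.
have xp : N (x 1%N - p) <= r by exact: xr.
have x1 : N (x 1%N) <= M by exact: xM.
have pM : N p <= M + 1.
  have -> : p = x 1%N - (x 1%N - p) by rewrite opprB addrC subrK.
  rewrite (le_trans (rd_sub H _ _))//; lra.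
have x1M : N (x 1%N) <= M + 1 by lra.
have := Hlip th0 (fun i => Htt i.+1) tt1 ttT mm x1M pM r0 xp.
rewrite -/f => h2.
rewrite -(subrKA (f (x 1%N) m)) (le_trans (rd_add H _ _))//.
apply: le_trans (lerD h1 h2) _; rewrite -[m.+1%:R]natr1; lra.
Qed.
End Chain.

(** Compare [v] with the flow started at [v s] on a fine grid of [[s, t]]. The local errors o(th)
    add up to an arbitrarily small amount, while the distance of the flow to a single step is
    bounded independently of the grid. *)
Lemma rough_remainder (R : realType) (g c M : R) : 1 < 3 * g -> 0 <= c -> 0 <= M ->
  exists L h : R, [/\ 0 <= L, 0 < h, h <= 1 &
  forall (V : zmodType) (N : V -> R) X X2 (T : R),
  rough_driver N X X2 T g c ->
  forall v : R -> V, (forall t, 0 <= t -> t <= T -> N (v t) <= M) ->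
  (forall eps, 0 < eps -> exists delta : R, 0 < delta /\
     forall k, 0 < k -> k < delta -> forall s t, 0 <= s -> s <= t -> t <= T ->
     t - s <= k -> N (v t - rstep X X2 t s (v s)) <= eps * k) ->
  forall s t, 0 <= s -> s <= t -> t <= T -> t - s <= h ->
  N (v t - rstep X X2 t s (v s)) <= L * (t - s) `^ (3 * g)].
Proof.
move=> g1 c0 M0.
have M10 : 0 <= M + 1 by lra.
have [L [h1 [L0 h10 h11 HL]]] := trajectory_close g1 c0 M0.
have [h2 [h20 h21 Hlip]] := rflow_lip g1 c0 M10.
exists L, (Num.min h1 h2); split => //.
- by rewrite lt_min h10 h20.
- by rewrite ge_min h11.
move=> V N X X2 T H v vM Hv s t s0 st tT; rewrite le_min => /andP[ts1 ts2].
(* For [s = t] the right-hand side vanishes, and the hypothesis on remainders, applied with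
   arbitrarily small [e], forces the left-hand side to vanish. *)
have [<-|/negPf st'] := eqVneq s t.
  rewrite subrr powR0 ?gt_eqF//; last by lra.
  rewrite mulr0; apply/ler_addgt0Pl => e e0; rewrite addr0.
  have [d [d0 Hd]] := Hv e e0.
  have := Hd (Num.min (d / 2) 1) _ _ s s s0 (lexx s) (le_trans st tT).
  rewrite subrr; move=> /(_ _ _ _)/le_trans; apply.
  - by rewrite lt_min ltr01 divr_gt0.
  - by rewrite gt_min ltr_pdivrMr// ltr_pMr// ltr1n.
  - by rewrite le_min ler01 divr_ge0// ltW.
  - by rewrite ler_piMr ?(ltW e0)// ge_min lexx orbT.
have ts0 : 0 < t - s by rewrite subr_gt0 lt_neqAle st' st.
apply/ler_addgt0Pr => e e0.
(* The first entry makes the accumulated error [2 * eps * (t - s)] at most [e]; the second makes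
   each local error at most one, as [rflow_chain] requires. *)
pose eps := Num.min (e / (2 * (t - s))) (t - s)^-1.
have eps0 : 0 < eps by rewrite lt_min invr_gt0 ts0 divr_gt0// mulr_gt0.
have [d [d0 Hd]] := Hv eps eps0.
pose m := (Num.trunc ((t - s) / d)).+1.
have m0 : 0 < m%:R :> R by rewrite ltr0n.
pose th := (t - s) / m%:R.
have th0 : 0 < th by rewrite divr_gt0.
have mth : m%:R * th = t - s by rewrite /th mulrC divfK ?gt_eqF.
have thd : th < d.
  rewrite /th ltr_pdivrMr// mulrC -ltr_pdivrMr// /m.
  exact: truncnS_gt.
pose tt i := s + i%:R * th.
have Htt i : tt i.+1 = tt i + th by rewrite /tt -natr1 mulrDl mul1r addrA.
have ttm : tt m = t by rewrite /tt mth addrC subrK.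
have tt0E : tt 0%N = s by rewrite /tt mul0r addr0.
have tt0 : 0 <= tt 0%N by rewrite tt0E.
have ttT : tt m <= T by rewrite ttm.
have tpos i : 0 <= tt i by rewrite (le_trans tt0)// (grid_le (ltW th0) Htt).
have ttiT i : (i <= m)%N -> tt i <= T.
  by move=> im; rewrite (le_trans _ ttT)// (grid_le (ltW th0) Htt).
have mh1 : m%:R * th <= h1 by rewrite mth.
have mh2 : m%:R * th <= h2 by rewrite mth.
have eth0 : 0 < eps * th by rewrite mulr_gt0.
have eth1 : eps * th <= 1.
  apply: (@le_trans _ _ ((t - s)^-1 * (t - s))).
    apply: ler_pM; [exact: ltW|exact: ltW|by rewrite /eps ge_min lexx orbT|].
    by rewrite /th ler_pdivrMr// ler_peMr ?ler1n ?(ltW ts0).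
  by rewrite mulVf// gt_eqF.
have ch := rflow_chain H (Hlip _ _ _ _ _ H) eth0 eth1 (ltW th0) Htt tt0 ttT mh2
  (x := v \o tt) (fun i im => vM _ (tpos i) (ttiT i im)).
have {ch} := ch _; rewrite /= => ch.
have {ch} h3 : N (v (tt m) - rflow X X2 tt (v (tt 0%N)) m) <= 2 * m%:R * (eps * th).
  apply: ch => i im; apply: (Hd th th0 thd); rewrite ?ttiT//.
    by rewrite Htt lerDl ltW.
  by rewrite Htt addrC addKr.
have vs : N (v (tt 0%N)) <= M by rewrite tt0E vM// (le_trans st).
have [_ h4] := HL _ _ _ _ _ H tt th (rflow X X2 tt (v (tt 0%N))) m (ltW th0) Htt tt0 ttT mh1
  (fun _ _ => erefl) vs m (leqnn m).
have {h4} := h4 0%N isT; rewrite subn0 mth ttm tt0E /= => h4.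
rewrite ttm tt0E in h3.
rewrite -(subrKA (rflow X X2 tt (v s) m)) (le_trans (rd_add H _ _))//.
have : 2 * m%:R * (eps * th) <= e.
  have -> : 2 * m%:R * (eps * th) = 2 * eps * (t - s) by rewrite -mth; ring.
  apply: (@le_trans _ _ (2 * (e / (2 * (t - s))) * (t - s))).
    by rewrite ler_wpM2r ?(ltW ts0)// ler_wpM2l// /eps ge_min lexx.
  by rewrite le_eqVlt; apply/orP; left; apply/eqP; field; lra.
lra.
Qed.

Lemma powR_decay (R : realType) (e Z : R) : 0 < e -> 0 < Z ->
  exists N : nat, (0 < N)%N /\ forall n, (N <= n)%N -> Z * n%:R `^ (- e) <= 1.
Proof.
move=> e0 Z0; exists (Num.trunc (Z `^ e^-1)).+1; split => // n hn.
have n0 : 0 < n%:R :> R by rewrite ltr0n (leq_trans _ hn).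
rewrite powRN ler_pdivrMr ?powR_gt0// mul1r.
apply: (@le_trans _ _ ((Z `^ e^-1) `^ e)).
  by rewrite -powRrM mulVf ?gt_eqF// powRr1// ltW.
rewrite ge0_ler_powR ?nnegrE ?powR_ge0 ?(ltW e0)//.
by rewrite ltW// (lt_le_trans (truncnS_gt _))// ler_nat.
Qed.

(** The time interval is cut into at most [B] blocks of length at most [h]. On a block the flow at
    most doubles the error present at its start, and the at most n local errors, each at most [r]
    with n r = L n^(1 - 3g), add a term of the order claimed. *)
Theorem rough_scheme_error (R : realType) (V : zmodType) (N : V -> R)
    (X : R -> R -> V -> V -> V) (X2 : R -> R -> V -> V -> V -> V)
    (T g c M : R) (v : R -> V) (y : nat -> nat -> V) :
  1 < 3 * g -> 0 <= c -> 0 <= M -> 0 < T -> rough_driver N X X2 T g c ->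
  (forall t, 0 <= t -> t <= T -> N (v t) <= M) ->
  (forall eps, 0 < eps -> exists delta : R, 0 < delta /\
     forall k, 0 < k -> k < delta -> forall s t, 0 <= s -> s <= t -> t <= T ->
     t - s <= k -> N (v t - rstep X X2 t s (v s)) <= eps * k) ->
  (forall n, y n 0%N = v 0) ->
  (forall n i, (0 < n)%N -> i.+1%:R <= n%:R * T ->
     y n i.+1 = rstep X X2 (i.+1%:R / n%:R) (i%:R / n%:R) (y n i)) ->
  exists (C : R) (N0 : nat), [/\ 0 <= C, (0 < N0)%N & forall n, (N0 <= n)%N ->
    forall i, i%:R <= n%:R * T ->
    N (y n i - v (i%:R / n%:R)) <= C * n%:R `^ (1 - 3 * g)].
Proof.
move=> g1 c0 M0 T0 H vM Hv y0 yS.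
have M10 : 0 <= M + 1 by clear -M0; lra.
have [L' [h1 [L'0 h10 h11 Hrem]]] := rough_remainder g1 c0 M0.
have [h2 [h20 h21 Hlip]] := rflow_lip g1 c0 M10.
have {Hrem} Hrem := Hrem _ _ _ _ _ H v vM Hv.
have {Hlip} Hlip := Hlip _ _ _ _ _ H.
(* The added one makes the local error [r] positive, as [rflow_chain] requires. *)
pose L := L' + 1.
have L0 : 0 < L by rewrite /L; clear -L'0; lra.
pose h := Num.min h1 h2.
have h0 : 0 < h by rewrite lt_min h10 h20.
have hh1 : h <= h1 by rewrite ge_min lexx.
have hh2 : h <= h2 by rewrite ge_min lexx orbT.
have h1' : h <= 1 by rewrite (le_trans hh1).
(* The solution of the error recursion [DS] with [D 0 = 1]. It starts at one although the initial
   error is zero, because [rflow_lip] needs a positive bound [lam]. *)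
pose D b : R := 2 ^+ b * (1 + 2 * L) - 2 * L.
have DS b : D b.+1 = 2 * D b + 2 * L by rewrite /D exprS; ring.
have D1 b : 1 <= D b.
  have : 1 <= 2 ^+ b :> R by rewrite exprn_ege1// ler1n.
  by rewrite /D; clear -L0; nra.
(* A block has [k] steps, the integer part of [h * n]. Once [h * n >= 2], which [n2] ensures,
   rounding loses at most half, so [2 * T / h] blocks suffice. *)
pose B := (Num.trunc (2 * T / h)).+1.
have BT : 2 * T / h < B%:R by exact: truncnS_gt.
have Dmono b : D b <= D b.+1 by rewrite DS; have := D1 b; clear -L0; lra.
have DB b : (b <= B)%N -> D b <= D B.
  move=> bB; rewrite -(subnKC bB); elim: (B - b)%N => [|j IH]; first by rewrite addn0.
  by rewrite addnS (le_trans IH).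
have Z0 : 0 < D B + L by have := D1 B; clear -L0; lra.
have e0 : 0 < 3 * g - 1 by clear -g1; lra.
(* Beyond [n1] the total error stays below one, so the scheme remains in the ball of radius [M + 1]
   on which the flow is Lipschitz. *)
have [n1 [n10 Hn1]] := powR_decay e0 Z0.
pose n2 := (Num.trunc (2 / h)).+1.
exists (D B), (maxn n1 n2); split.
- by have := D1 B; lra.
- by rewrite leq_max n10.
move=> n; rewrite geq_max => /andP[nn1 nn2] i iT.
have n0 : 0 < n%:R :> R by rewrite ltr0n (leq_trans _ nn1).
have n1' : 1 <= n%:R :> R by rewrite ler1n -(ltr0n R).
have nh : 2 <= h * n%:R.
  rewrite mulrC -ler_pdivrMr// ltW// (lt_le_trans (truncnS_gt _))//.
  by rewrite ler_nat.
have := Hn1 n nn1; rewrite opprB; set E := n%:R `^ (1 - 3 * g) => DE.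
have E0 : 0 <= E by exact: powR_ge0.
pose r := L * n%:R `^ (- (3 * g)).
have nr : n%:R * r = L * E.
  rewrite /r mulrCA /E; congr (_ * _).
  rewrite powRD; last by apply/implyP => _; rewrite gt_eqF.
  by rewrite powRr1// ltW.
have r0 : 0 < r by rewrite mulr_gt0// powR_gt0.
have rLE : r <= L * E by rewrite -nr ler_peMl// ltW.
have LE1 : L * E <= 1.
  by rewrite (le_trans _ DE)// ler_wpM2r//; have := D1 B; clear; lra.
have r1 : r <= 1 by exact: le_trans LE1.
have DE1 b : (b <= B)%N -> D b * E <= 1.
  move=> bB; rewrite (le_trans _ DE)// ler_wpM2r//; have := DB b bB; clear -L0; lra.
pose k := Num.trunc (h * n%:R).
have hn0 : 0 <= h * n%:R by rewrite mulr_ge0 ?ltW.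
have kle : k%:R <= h * n%:R by rewrite /k truncn_le.
have klt : h * n%:R < k%:R + 1 by rewrite natr1; exact: truncnS_gt.
have claim : forall b, (b <= B)%N -> forall i, (i <= b * k)%N -> i%:R <= n%:R * T ->
    N (y n i - v (i%:R / n%:R)) <= D b * E.
  elim => [|b IH] bB {iT}i ib iT.
    move: ib; rewrite mul0n leqn0 => /eqP ->.
    by rewrite y0 mul0r subrr (rd_0 H) mulr_ge0// (le_trans _ (D1 0%N)).
  have [ibk|ibk] := leqP i (b * k)%N.
    by rewrite (le_trans (IH (ltnW bB) _ ibk iT))// ler_wpM2r.
  pose a := (b * k)%N; pose l := (i - a)%N.
  have al : (a + l = i)%N by rewrite subnKC// ltnW.
  have lk : (l <= k)%N by rewrite leq_subLR -mulSnr.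
  have aT : a%:R <= n%:R * T by rewrite (le_trans _ iT)// ler_nat ltnW.
  have IHa := IH (ltnW bB) a (leqnn _) aT.
  pose tt j : R := (a + j)%:R / n%:R.
  have Htt j : tt j.+1 = tt j + n%:R^-1.
    by rewrite /tt addnS -natr1 mulrDl mul1r.
  have tt0 : 0 <= tt 0%N by rewrite divr_ge0.
  have tpos j : 0 <= tt j by rewrite divr_ge0.
  have ttl : tt l = i%:R / n%:R by rewrite /tt al.
  have ttle j : (j <= l)%N -> tt j <= T.
    move=> jl; rewrite ler_pdivrMr// mulrC (le_trans _ iT)// ler_nat -al leq_add2l//.
  have th0 : 0 <= n%:R^-1 :> R by rewrite invr_ge0 ltW.
  have lh : l%:R / n%:R <= h.
    by rewrite ler_pdivrMr// (le_trans _ kle)// ler_nat.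
  have yfl j : (j <= l)%N -> rflow X X2 tt (y n a) j = y n (a + j)%N.
    elim: j => [|j IHj] jl; first by rewrite addn0.
    rewrite /= (IHj (ltnW jl)) addnS yS ?(leq_trans _ nn1)//.
      by rewrite /tt addnS.
    by rewrite (le_trans _ iT)// ler_nat -al -addnS leq_add2l.
  have vaM : N (v (tt 0%N)) <= M by rewrite vM// ttle.
  have ch : N (v (tt l) - rflow X X2 tt (v (tt 0%N)) l) <= 2 * l%:R * r.
    apply: (rflow_chain H Hlip r0 r1 th0 Htt tt0 (ttle l (leqnn l)) (le_trans lh hh2)
      (x := v \o tt)) => j jl /=; first by rewrite vM// ttle.
    have jj : tt j <= tt j.+1 by rewrite Htt lerDl.
    have jd : tt j.+1 - tt j = n%:R^-1 by rewrite Htt addrC addKr.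
    apply: le_trans (Hrem _ _ (tpos j) jj (ttle _ jl) _) _.
      by rewrite jd (le_trans _ hh1)// -div1r ler_pdivrMr//; lra.
    rewrite jd /r powRN -[n%:R^-1]powR_inv1 ?(ltW n0)// -powRrM mulN1r powRN.
    by rewrite ler_wpM2r ?invr_ge0 ?powR_ge0// /L lerDl.
  have tt0E : tt 0%N = a%:R / n%:R by rewrite /tt addn0.
  have DbE0 : 0 < D b * E.
    by rewrite mulr_gt0 ?powR_gt0//; have := D1 b; clear; lra.
  have yaM : N (y n a) <= M + 1.
    rewrite -(subrK (v (tt 0%N)) (y n a)) (le_trans (rd_add H _ _))// addrC lerD//.
    by rewrite tt0E (le_trans IHa)// DE1// ltnW.
  have vaM1 : N (v (tt 0%N)) <= M + 1 by clear -vaM; lra.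
  have lip := Hlip tt n%:R^-1 l th0 Htt tt0 (ttle l (leqnn l)) (le_trans lh hh2)
    (y n a) (v (tt 0%N)) (D b * E) yaM vaM1 DbE0 _.
  have {}lip := lip _; rewrite tt0E in lip.
  have {lip} lip := lip IHa.
  rewrite yfl// al -tt0E in lip.
  rewrite -(subrKA (rflow X X2 tt (v (tt 0%N)) l)) (le_trans (rd_add H _ _))//.
  rewrite -ttl (rd_subC H _ (v (tt l))) (le_trans (lerD lip ch))// DS.
  have : l%:R * r <= L * E.
    apply: (@le_trans _ _ (n%:R * r)); last by rewrite nr.
    rewrite ler_wpM2r ?(ltW r0)// -[leRHS]mul1r; move: lh; rewrite ler_pdivrMr// => lh.
    by rewrite (le_trans lh)// ler_wpM2r// ltW.
  clear; lra.
apply: (claim B (leqnn B) i _ iT).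
rewrite -(ler_nat R) (le_trans iT)// natrM.
have kh : h * n%:R / 2 <= k%:R by move: klt nh; clear; lra.
apply: (@le_trans _ _ (2 * T / h * (h * n%:R / 2))).
  by rewrite le_eqVlt; apply/orP; left; apply/eqP; field; rewrite gt_eqF.
apply: ler_pM (ltW BT) kh; first by rewrite divr_ge0 ?(ltW h0)// mulr_ge0 ?(ltW T0).
by rewrite divr_ge0.
Qed.

(** * Sums over the integers and weighted sequence spaces *)

Notation "'\sumZ_' k F" := (\esum_(k in [set: int]%classic) F%E)
  (at level 41, k name, F at level 41) : ereal_scope.

Local Open Scope ereal_scope.

Section SumZ.
Variable R : realType.
Implicit Types f g : int -> \bar R.

Lemma sumZ_ge0 f : (forall k, 0 <= f k) -> 0 <= \sumZ_ k f k.
Proof. by move=> f0; apply: esum_ge0. Qed.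

Lemma le_sumZ f g : (forall k, f k <= g k) -> \sumZ_ k f k <= \sumZ_ k g k.
Proof. by move=> fg; apply: le_esum. Qed.

Lemma sumZZ f (c : R) : (0 <= c)%R -> (forall k, 0 <= f k) ->
  \sumZ_ k (c%:E * f k) = c%:E * \sumZ_ k f k.
Proof.
move=> c0 f0; rewrite /esum -ereal_supZl//; last first.
  by apply/set0P; exists 0; exists set0; [exact: fsets_set0|rewrite fsbig_set0].
congr ereal_sup; apply/seteqP; split => [_ [F FT <-]|_ [_ [F FT <-] <-]].
  by exists (\sum_(x \in F) f x); [exists F|rewrite ge0_mule_fsumr].
by exists F => //; rewrite ge0_mule_fsumr.
Qed.

Lemma sumZ_swap (F : int -> int -> \bar R) : (forall k j, 0 <= F k j) ->
  \sumZ_ k (\sumZ_ j F k j) = \sumZ_ j (\sumZ_ k F k j).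
Proof.
move=> F0; rewrite !esum_esum//.
have sT : forall A B : choiceType, (@setT A `*`` (fun=> @setT B))%classic = setT.
  by move=> A B; apply/seteqP; split.
rewrite !sT (@reindex_esum _ _ _ [set: int * int]%classic _ (fun x => (x.2, x.1)))//.
split => //; first by move=> [a b] [c d] _ _ /= [-> ->].
by move=> [a b] _; exists (b, a).
Qed.

Lemma sumZ_reindex (e : int -> int) f : bijective e ->
  \sumZ_ k f (e k) = \sumZ_ k f k.
Proof.
move=> [e' ee' e'e]; rewrite [RHS](@reindex_esum _ _ _ [set: int]%classic _ e)//.
split => //; first by move=> x y _ _ /(can_inj ee').
by move=> y _; exists (e' y).
Qed.

Lemma sumZ_point f k : (forall j, 0 <= f j) -> f k <= \sumZ_ j f j.
Proof.
move=> f0; apply: esum_ge; exists [set k]%classic; first by split.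
by rewrite fsbig_set1.
Qed.

Lemma sumZ_nat f : (forall k, 0 <= f k) ->
  \sumZ_ k f k = \sum_(n <oo) f n%:Z + \sum_(n <oo) f (Negz n).
Proof.
move=> f0; rewrite (esumID (range Posz))// !setTI !nneseries_esumT//; congr (_ + _).
  rewrite (@reindex_esum _ _ _ [set: nat]%classic _ Posz)//; split => //.
  by move=> x y _ _ [].
rewrite (@reindex_esum _ _ _ [set: nat]%classic _ Negz)//; split => //.
- by move=> n _ [].
- by move=> x y _ _ [].
- by move=> [n|n] /=; [move=> /(_ _)[]; exists n|exists n].
Qed.

Lemma sumZ_le_fin f (M : R) : (forall k, 0 <= f k) ->
  (forall n : nat, (\sum_(0 <= i < n) f i%:Z <= M%:E)%E) ->
  (forall n : nat, (\sum_(0 <= i < n) f (Negz i) <= M%:E)%E) ->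
  \sumZ_ k f k <= (2 * M)%:E.
Proof.
move=> f0 h1 h2; rewrite sumZ_nat// mulrDl mul1r EFinD.
by apply: leeD; (apply: lime_le; [exact: is_cvg_nneseries|exact: nearW]).
Qed.
End SumZ.

Local Close Scope ereal_scope.

(** Replaces the Japanese bracket, to which it is equivalent up to a factor 2. It is multiplicative
    on nonzero integers, and comparisons of its values reduce to integer arithmetic. *)
Definition qz (R : realType) (k : int) : R := (maxn 1 `|k|%N)%:R.

Section Qz.
Variable R : realType.
Local Notation q := (@qz R).

Lemma qz_ge1 k : 1 <= q k.
Proof. by rewrite /qz ler1n leq_max leqnn. Qed.

Lemma qz_gt0 k : 0 < q k.
Proof. exact: lt_le_trans (qz_ge1 k). Qed.

Lemma qz_ge0 k : 0 <= q k.
Proof. exact: ltW (qz_gt0 k). Qed.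

Lemma qz_neq0 k : k != 0 -> q k = `|k%:~R|.
Proof.
move=> k0; rewrite /qz (maxn_idPr _) ?absz_gt0//.
by rewrite natr_absz intr_norm.
Qed.

Lemma qzN k : q (- k) = q k.
Proof. by rewrite /qz abszN. Qed.

Lemma qzD k j : q (k + j) <= q k + q j.
Proof. by rewrite /qz -natrD ler_nat; lia. Qed.

(** Bernoulli's inequality (1 - 1/x)^(-e) >= 1 + e/x at x = n + 1, obtained from the exponential and
    the logarithm. It makes the zeta sums telescope. *)
Lemma powR_telescope (e : R) (n : nat) : 0 < e -> (0 < n)%N ->
  e * n.+1%:R `^ (- (1 + e)) <= n%:R `^ (- e) - n.+1%:R `^ (- e).
Proof.
move=> e0 n0; have n0' : 0 < n%:R :> R by rewrite ltr0n.
have x0 : 0 < n.+1%:R :> R by rewrite ltr0n.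
set x : R := n.+1%:R in x0 *.
have xn : n%:R = x * (1 - x^-1) by rewrite mulrBr mulr1 divff ?gt_eqF// /x -natr1 addrK.
have x1 : 0 < 1 - x^-1 by move: n0'; rewrite xn pmulr_rgt0.
have e1 : x `^ (- (1 + e)) = x^-1 * x `^ (- e).
  rewrite opprD powRD ?powR_inv1 ?(ltW x0)//.
  by apply/implyP => _; rewrite gt_eqF.
rewrite xn powRM ?(ltW x0) ?(ltW x1)// e1; set y := x `^ (- e).
have -> : e * (x^-1 * y) = y * (e * x^-1) by ring.
have -> : y * (1 - x^-1) `^ (- e) - y = y * ((1 - x^-1) `^ (- e) - 1) by ring.
rewrite ler_wpM2l ?powR_ge0//.
rewrite {1}/powR gt_eqF// lerBrDl.
apply: le_trans (expR_ge1Dx _); rewrite lerD2l mulNr -mulrN ler_wpM2l ?(ltW e0)//.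
rewrite lerNr (le_trans (le_ln1Dx _))//.
by rewrite ltrNl opprK invf_lt1// /x ltr1n.
Qed.

Lemma zeta_partial (e : R) (n : nat) : 0 < e ->
  \sum_(0 <= i < n) i.+1%:R `^ (- (1 + e)) <= 1 + e^-1.
Proof.
move=> e0; case: n => [|n]; first by rewrite big_nil addr_ge0// invr_ge0 ltW.
rewrite big_nat_recl// powR1 lerD2l.
suff : \sum_(0 <= i < n) i.+2%:R `^ (- (1 + e)) <= e^-1 * (1 - n.+1%:R `^ (- e)).
  by move=> h; rewrite (le_trans h)// ler_piMr ?invr_ge0 ?(ltW e0)//.
elim: n => [|n IH]; first by rewrite big_nil powR1 subrr mulr0.
rewrite big_nat_recr//= (le_trans (lerD IH (lexx _)))//.
have := powR_telescope e0 (ltn0Sn n); rewrite mulrC -ler_pdivlMr// => h.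
rewrite (le_trans (lerD (lexx _) h))// (mulrC _ e^-1) -mulrDr ler_wpM2l ?invr_ge0 ?(ltW e0)//.
by rewrite addrA subrK.
Qed.

Lemma zeta_fin (s : R) : 1 < s -> exists2 S : R, 0 <= S &
  (\sumZ_ k (q k `^ (- s))%:E <= S%:E)%E.
Proof.
move=> s1; have e0 : 0 < s - 1 by rewrite subr_gt0.
have sE : s = 1 + (s - 1) by rewrite addrC subrK.
have M0 : 0 <= 2 + (s - 1)^-1 by rewrite addr_ge0// invr_ge0 ltW.
exists (2 * (2 + (s - 1)^-1)); first by rewrite mulr_ge0.
apply: sumZ_le_fin => [k|n|n]; rewrite ?lee_fin ?powR_ge0// sumEFin lee_fin.
  case: n => [|n]; first by rewrite big_nil.
  have -> : 2 + (s - 1)^-1 = 1 + (1 + (s - 1)^-1) by rewrite addrA.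
  have q0 : q 0 = 1 by [].
  rewrite big_nat_recl// q0 powR1 lerD2l.
  apply: le_trans (zeta_partial n e0); rewrite -sE le_eqVlt; apply/orP; left; apply/eqP.
  by apply: eq_bigr => i _; rewrite /qz maxnE /= add1n subn1.
apply: (@le_trans _ _ (1 + (s - 1)^-1)); last by rewrite lerD2r ler1n.
apply: le_trans (zeta_partial n e0); rewrite -sE le_eqVlt; apply/orP; left; apply/eqP.
by apply: eq_bigr => i _; rewrite /qz maxnE /= add1n subn1.
Qed.
End Qz.

(** * Norms of l^p type on sequences with extended real values *)

Local Open Scope ereal_scope.

Definition lpn (R : realType) (p : \bar R) (f : int -> \bar R) : \bar R :=
  match p with
  | EFin r => (\sumZ_ k (f k `^ r)) `^ r^-1
  | _ => ereal_sup (range f)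
  end.

Section Lpn.
Variable R : realType.
Implicit Types (p : \bar R) (f g : int -> \bar R).

Lemma powe_le (x y : \bar R) (r : R) : (0 <= r)%R -> 0 <= x -> x <= y -> x `^ r <= y `^ r.
Proof.
move=> r0 x0 xy; apply: gt0_ler_poweR; rewrite // in_itv /= ?x0 ?leey ?andbT//.
by rewrite (le_trans x0 xy) ?leey.
Qed.

Lemma lpn_ge0 p f : (forall k, 0 <= f k) -> 0 <= lpn p f.
Proof.
move=> f0; case: p => [r| |] /=; first exact: poweR_ge0.
  by apply: (le_trans (f0 0%R)); apply: ereal_sup_ubound; exists 0%R.
by apply: (le_trans (f0 0%R)); apply: ereal_sup_ubound; exists 0%R.
Qed.

Lemma lpn_powK (r : R) f : (0 < r)%R -> (forall k, 0 <= f k) ->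
  lpn r%:E f `^ r = \sumZ_ k (f k `^ r).
Proof.
move=> r0 f0; rewrite /= -poweRrM mulVf ?gt_eqF// poweRe1//.
by apply: sumZ_ge0 => k; exact: poweR_ge0.
Qed.

Lemma lpn_le_fin (r A : R) f : (0 < r)%R -> (0 <= A)%R -> (forall k, 0 <= f k) ->
  (lpn r%:E f <= A%:E) = (\sumZ_ k (f k `^ r) <= (A `^ r)%:E).
Proof.
move=> r0 A0 f0; apply/idP/idP => h.
  by rewrite -lpn_powK// -poweR_EFin powe_le ?(ltW r0) ?lpn_ge0.
have -> : A%:E = (A `^ r)%:E `^ r^-1.
  by rewrite poweR_EFin -powRrM mulfV ?gt_eqF// powRr1.
by rewrite powe_le ?invr_ge0 ?(ltW r0)// sumZ_ge0// => k; exact: poweR_ge0.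
Qed.

Lemma lpn_le_oo (A : \bar R) f : (lpn +oo f <= A) <-> (forall k, f k <= A).
Proof.
split => [h k|h]; first by apply: le_trans h; apply: ereal_sup_ubound; exists k.
by apply: ge_ereal_sup => _ [k _ <-].
Qed.

Lemma lpn_point p f k : 1 <= p -> (forall j, 0 <= f j) -> f k <= lpn p f.
Proof.
case: p => [r| |] //= p1 f0; last by apply: ereal_sup_ubound; exists k.
have r0 : (0 < r)%R by rewrite (lt_le_trans ltr01).
have -> : f k = (f k `^ r) `^ r^-1 by rewrite -poweRrM mulfV ?gt_eqF// poweRe1.
rewrite powe_le ?invr_ge0 ?(ltW r0) ?poweR_ge0//.
by apply: (sumZ_point (f := fun k => f k `^ r)) => j; exact: poweR_ge0.
Qed.

Lemma le_lpn p f g : 1 <= p -> (forall k, 0 <= f k) -> (forall k, f k <= g k) ->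
  lpn p f <= lpn p g.
Proof.
case: p => [r| |] //= p1 f0 fg; last first.
  apply: ge_ereal_sup => _ [k _ <-]; apply: le_trans (fg k) _.
  by apply: ereal_sup_ubound; exists k.
have r0 : (0 <= r)%R by rewrite (le_trans ler01).
rewrite powe_le ?invr_ge0//; first by apply: sumZ_ge0 => k; exact: poweR_ge0.
by apply: le_sumZ => k; rewrite powe_le.
Qed.

Lemma lpnZ p f (c : R) : 1 <= p -> (0 <= c)%R -> (forall k, 0 <= f k) ->
  lpn p (fun k => c%:E * f k) = c%:E * lpn p f.
Proof.
move=> p1 c0 f0; case: p p1 => [r| |] //= p1; last first.
  rewrite -ereal_supZl//; last by apply/set0P; exists (f 0%R); exists 0%R.
  by congr ereal_sup; rewrite -image_comp.
have r0 : (0 < r)%R by rewrite (lt_le_trans ltr01).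
under eq_esum do rewrite poweRM//.
rewrite (sumZZ (f := fun k => f k `^ r)) ?powR_ge0//; last first.
  by move=> k; exact: poweR_ge0.
rewrite poweRM ?lee_fin ?powR_ge0//; last by apply: sumZ_ge0 => k; exact: poweR_ge0.
by rewrite poweR_EFin -powRrM mulfV ?gt_eqF// powRr1.
Qed.

Lemma lpn_reindex p f (e : int -> int) : bijective e ->
  lpn p (fun k => f (e k)) = lpn p f.
Proof.
move=> be; have rg : range (fun k => f (e k)) = range f.
  apply/seteqP; split => _ [k _ <-]; first by exists (e k).
  by have [e' _ e'K] := be; exists (e' k); rewrite // e'K.
case: p => [r| |] /=; [|by rewrite rg|by rewrite rg].
by rewrite (sumZ_reindex (fun k => f k `^ r) be).
Qed.

Lemma eq_lpn p f g : (forall k, f k = g k) -> lpn p f = lpn p g.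
Proof. by move=> /funext ->. Qed.

Lemma lpn_fin_seq p f : 1 <= p -> (forall k, 0 <= f k) -> lpn p f < +oo ->
  exists2 f' : int -> R, (forall k, (0 <= f' k)%R) & f = (fun k => (f' k)%:E).
Proof.
move=> p1 f0 fy; exists (fun k => fine (f k)); first by move=> k; rewrite fine_ge0.
apply/funext => k; rewrite fineK// ge0_fin_numE// (le_lt_trans _ fy)//.
exact: lpn_point.
Qed.

Lemma ge0_lpn_EFin p f : (forall k, 0 <= f k) -> lpn p f < +oo ->
  exists2 A : R, (0 <= A)%R & lpn p f = A%:E.
Proof.
move=> f0 fy; exists (fine (lpn p f)); first by rewrite fine_ge0// lpn_ge0.
by rewrite fineK// ge0_fin_numE// lpn_ge0.
Qed.

(** (x + y)/(A + B) is the convex combination of x/A and y/B with weights A/(A + B) and B/(A + B).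
    Summed over sequences with norms at most A and B, this is Minkowski's inequality. *)
Lemma powR_convex_le (r x y A B : R) : (1 <= r)%R -> (0 <= x)%R -> (0 <= y)%R ->
  (0 < A)%R -> (0 < B)%R ->
  ((x + y) `^ r <= (A + B) `^ r * (A / (A + B) * (A `^ r)^-1 * x `^ r
     + B / (A + B) * (B `^ r)^-1 * y `^ r))%R.
Proof.
move=> r1 x0 y0 A0 B0.
have AB0 : (0 < A + B)%R by rewrite addr_gt0.
have t0 : (0 <= A / (A + B))%R by rewrite divr_ge0// ltW.
have t1 : (A / (A + B) <= 1)%R by rewrite ler_pdivrMr// mul1r lerDl ltW.
have xA : (0 <= x / A)%R by rewrite divr_ge0// ltW.
have yB : (0 <= y / B)%R by rewrite divr_ge0// ltW.
have xyE : (x + y = (A + B) * (A / (A + B) * (x / A) + B / (A + B) * (y / B)))%R.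
  by field; lra.
rewrite [in leLHS]xyE powRM ?(ltW AB0)//; last first.
  by rewrite addr_ge0// mulr_ge0// divr_ge0// ltW.
rewrite ler_wpM2l ?powR_ge0//.
have tB : (1 - A / (A + B) = B / (A + B))%R by field; lra.
have h : ((A / (A + B) * (x / A) + (1 - A / (A + B)) * (y / B)) `^ r <=
    A / (A + B) * (x / A) `^ r + (1 - A / (A + B)) * (y / B) `^ r)%R.
  by apply: (@convex_powR R r r1 (Itv01 t0 t1) (x / A)%R (y / B)%R);
    rewrite inE /= in_itv /= andbT.
rewrite tB in h; apply: le_trans h _.
rewrite !powRM ?invr_ge0 ?(ltW A0) ?(ltW B0)//.
have pV (z : R) : (0 < z)%R -> (z^-1 `^ r = (z `^ r)^-1)%R.
  by move=> z0; rewrite -powR_inv1 ?(ltW z0)// -powRrM mulN1r powRN.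
rewrite !pV// le_eqVlt; apply/orP; left; apply/eqP; ring.
Qed.

Lemma lpnD p f g : 1 <= p -> (forall k, 0 <= f k) -> (forall k, 0 <= g k) ->
  lpn p (fun k => f k + g k) <= lpn p f + lpn p g.
Proof.
move=> p1 f0 g0.
have [fy|] := boolP (lpn p f < +oo); last first.
  rewrite -leNgt leye_eq => /eqP ->; rewrite addye ?leey//.
  by rewrite -ltNye (lt_le_trans _ (lpn_ge0 p g0)).
have [gy|] := boolP (lpn p g < +oo); last first.
  rewrite -leNgt leye_eq => /eqP ->; rewrite addey ?leey//.
  by rewrite -ltNye (lt_le_trans _ (lpn_ge0 p f0)).
have [f' f'0 fE] := lpn_fin_seq p1 f0 fy.
have [g' g'0 gE] := lpn_fin_seq p1 g0 gy.
have [A A0 AE] := ge0_lpn_EFin f0 fy.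
have [B B0 BE] := ge0_lpn_EFin g0 gy.
rewrite AE BE; apply/lee_addgt0Pr => e e0.
(* Enlarging the norms makes them positive, as the convexity bound divides by them. *)
pose A' := (A + e / 2)%R; pose B' := (B + e / 2)%R.
have A'0 : (0 < A')%R by rewrite ltr_wpDl// divr_gt0.
have B'0 : (0 < B')%R by rewrite ltr_wpDl// divr_gt0.
have fA : lpn p f <= A'%:E by rewrite AE lee_fin lerDl divr_ge0// ltW.
have gB : lpn p g <= B'%:E by rewrite BE lee_fin lerDl divr_ge0// ltW.
have -> : A%:E + B%:E + e%:E = (A' + B')%:E.
  by rewrite -!EFinD /A' /B'; congr EFin; field.
have AB0 : (0 < A' + B')%R by rewrite addr_gt0.
have fg0 k : 0 <= f k + g k by rewrite adde_ge0.
case: p p1 {fy gy AE BE} fA gB => [r| |] // p1 fA gB; last first.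
  by apply/lpn_le_oo => k; rewrite EFinD leeD//; apply: (lpn_le_oo _ _).1.
have r0 : (0 < r)%R by rewrite (lt_le_trans ltr01).
move: fA gB; rewrite !lpn_le_fin ?(ltW A'0) ?(ltW B'0) ?(ltW AB0)// => fA gB.
set cA := ((A' + B') `^ r * (A' / (A' + B') * (A' `^ r)^-1))%R.
set cB := ((A' + B') `^ r * (B' / (A' + B') * (B' `^ r)^-1))%R.
have cA0 : (0 <= cA)%R.
  by rewrite !mulr_ge0 ?powR_ge0 ?invr_ge0 ?powR_ge0 ?(ltW AB0) ?(ltW A'0).
have cB0 : (0 <= cB)%R.
  by rewrite !mulr_ge0 ?powR_ge0 ?invr_ge0 ?powR_ge0 ?(ltW AB0) ?(ltW B'0).
apply: (@le_trans _ _ (\sumZ_ k (cA%:E * f k `^ r + cB%:E * g k `^ r))).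
  apply: le_sumZ => k; rewrite fE gE -EFinD !poweR_EFin -!EFinM -EFinD lee_fin.
  have := powR_convex_le p1 (f'0 k) (g'0 k) A'0 B'0; rewrite mulrDr.
  by rewrite /cA /cB !mulrA.
rewrite esumD; last 2 first.
- by move=> k _; rewrite mule_ge0 ?poweR_ge0.
- by move=> k _; rewrite mule_ge0 ?poweR_ge0.
rewrite !sumZZ//; try by move=> k; exact: poweR_ge0.
have := leeD (lee_wpmul2l (x := cA%:E) cA0 fA) (lee_wpmul2l (x := cB%:E) cB0 gB).
move=> /le_trans; apply; rewrite -!EFinM -EFinD lee_fin /cA /cB.
have pA : (A' `^ r != 0)%R by rewrite gt_eqF// powR_gt0.
have pB : (B' `^ r != 0)%R by rewrite gt_eqF// powR_gt0.
rewrite le_eqVlt; apply/orP; left; apply/eqP; field.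
by rewrite pA pB gt_eqF.
Qed.

(** The inner expression is an l^p norm in [j], not a sum, so for finite p this is an exchange of
    two sums. The passage from the sum of a convolution to this norm is what Hölder's inequality
    pays for elsewhere. *)
Lemma lpn_conv p (a b : int -> R) (A B : R) : 1 <= p ->
  (forall k, (0 <= a k)%R) -> (forall k, (0 <= b k)%R) -> (0 <= A)%R -> (0 <= B)%R ->
  lpn p (fun k => (a k)%:E) <= A%:E -> lpn p (fun k => (b k)%:E) <= B%:E ->
  lpn p (fun k => lpn p (fun j => (a j * b (k - j))%:E)) <= (A * B)%:E.
Proof.
move=> p1 a0 b0 A0 B0.
have ab0 k j : 0 <= (a j * b (k - j))%:E by rewrite lee_fin mulr_ge0.
case: p p1 => [r| |] // p1; last first.
  move=> /lpn_le_oo hA /lpn_le_oo hB; apply/lpn_le_oo => k; apply/lpn_le_oo => j.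
  by rewrite lee_fin ler_pM// -lee_fin.
have r0 : (0 < r)%R by rewrite (lt_le_trans ltr01).
rewrite !lpn_le_fin ?mulr_ge0//; last by move=> k; apply: lpn_ge0 => j; exact: ab0.
move=> hA hB.
under eq_esum do rewrite lpn_powK//.
under eq_esum do under eq_esum do rewrite poweR_EFin powRM// EFinM.
rewrite sumZ_swap; last first.
  by move=> k j; rewrite mule_ge0// lee_fin powR_ge0.
apply: (@le_trans _ _ (\sumZ_ j ((B `^ r)%:E * (a j `^ r)%:E))).
  apply: le_sumZ => j; rewrite muleC.
  rewrite (sumZZ (f := fun k => (b (k - j) `^ r)%:E)) ?powR_ge0//; last first.
    by move=> k; rewrite lee_fin powR_ge0.
  rewrite muleC [leRHS]muleC.
  rewrite [leLHS]muleC [leRHS]muleC lee_wpmul2l ?lee_fin ?powR_ge0//.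
  rewrite (sumZ_reindex (fun k => (b k `^ r)%:E) (e := fun k => (k - j)%R)); last first.
    by exists (fun k => (k + j)%R) => k; rewrite ?subrK ?addrK.
  by move: hB; under eq_esum do rewrite poweR_EFin.
rewrite sumZZ ?powR_ge0//; last by move=> k; rewrite lee_fin powR_ge0.
rewrite powRM// mulrC EFinM lee_wpmul2l ?lee_fin ?powR_ge0//.
Qed.

Lemma young_le (r r' x y : R) : (1 < r)%R -> (r^-1 + r'^-1 = 1)%R -> (0 < r')%R ->
  (0 <= x)%R -> (0 <= y)%R -> (x * y <= x `^ r' + y `^ r)%R.
Proof.
move=> r1 rr r'0 x0 y0; have r0 : (0 < r)%R by rewrite (lt_trans ltr01).
have r'1 : (1 <= r')%R.
  by rewrite -(invf_le1 r'0) -[leRHS]rr lerDr invr_ge0 ltW.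
apply: le_trans (conjugate_powR x0 y0 r'0 r0 _) _; first by rewrite addrC.
by rewrite lerD// ler_piMr ?powR_ge0// invf_le1// ltW.
Qed.
End Lpn.

Local Close Scope ereal_scope.

(** * Hölder's inequality against power weights *)

Local Open Scope ereal_scope.

Section Hoelder.
Variable R : realType.
Implicit Types (p : \bar R).
Local Notation q := (@qz R).

Lemma le_mul_lpn (x : \bar R) p f (C : R) : (0 < C)%R -> (forall k, 0 <= f k) ->
  (forall A, (0 <= A)%R -> lpn p f = A%:E -> x <= (C * A)%:E) ->
  x <= C%:E * lpn p f.
Proof.
move=> C0 f0 h; have [fy|] := boolP (lpn p f < +oo).
  by have [A A0 AE] := ge0_lpn_EFin f0 fy; rewrite AE -EFinM h.
by rewrite -leNgt leye_eq => /eqP ->; rewrite gt0_muley ?leey// lte_fin.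
Qed.

(** Young's inequality termwise after dividing [f] by its norm; the constant [W + 1] collects the
    two sums, each at most [W] or one. *)
Lemma holder_weight (r W : R) (w : int -> R) (f : int -> \bar R) : (1 < r)%R ->
  (forall k, (0 <= w k)%R) -> (forall k, 0 <= f k) ->
  \sumZ_ k (w k `^ (r / (r - 1)))%:E <= W%:E ->
  \sumZ_ k ((w k)%:E * f k) <= (W + 1)%:E * lpn r%:E f.
Proof.
move=> r1 w0 f0 hW; have r0 : (0 < r)%R by rewrite (lt_trans ltr01).
have W0 : (0 <= W)%R.
  rewrite -lee_fin (le_trans _ hW)//; apply: sumZ_ge0 => k.
  by rewrite lee_fin powR_ge0.
have p1 : 1 <= r%:E by rewrite lee_fin ltW.
apply: le_mul_lpn => // [|A A0 AE]; first by rewrite ltr_wpDl.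
have fy : lpn r%:E f < +oo by rewrite AE ltry.
have [f' f'0 fE] := lpn_fin_seq p1 f0 fy.
rewrite EFinM; have [A00|A0'] := eqVneq A 0%R.
  rewrite A00 mule0 esum1// => k _.
  have : f k <= 0 by have := lpn_point k p1 f0; rewrite AE A00.
  by move=> h; rewrite (_ : f k = 0) ?mule0//; apply/eqP; rewrite eq_le h f0.
have {A0 A0'} A0 : (0 < A)%R by rewrite lt_neqAle eq_sym A0'.
pose r' := (r / (r - 1))%R.
have r10 : (0 < r - 1)%R by rewrite subr_gt0.
have r'0 : (0 < r')%R by rewrite divr_gt0.
have rr : (r^-1 + r'^-1 = 1)%R by rewrite /r'; field; rewrite !gt_eqF.
have Af : \sumZ_ k (f k `^ r) <= (A `^ r)%:E.
  by rewrite -lpn_le_fin ?AE ?(ltW A0).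
apply: (@le_trans _ _ (\sumZ_ k (A%:E * ((w k `^ r')%:E + ((A^-1) `^ r)%:E * f k `^ r)))).
  apply: le_sumZ => k; rewrite (_ : f k = (f' k)%:E) ?fE// poweR_EFin -!EFinM lee_fin.
  have -> : (w k * f' k = A * (w k * (A^-1 * f' k)))%R by field; rewrite gt_eqF.
  rewrite ler_wpM2l ?(ltW A0)// -powRM ?invr_ge0 ?(ltW A0)//.
  by apply: young_le => //; rewrite mulr_ge0// invr_ge0 ltW.
rewrite sumZZ ?(ltW A0)//; last first.
  by move=> k; rewrite adde_ge0// ?mule_ge0 ?lee_fin ?powR_ge0// poweR_ge0.
rewrite esumD; last 2 first.
- by move=> k _; rewrite lee_fin powR_ge0.
- by move=> k _; rewrite mule_ge0 ?lee_fin ?powR_ge0// poweR_ge0.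
rewrite (sumZZ (f := fun k => f k `^ r)) ?powR_ge0//; last by move=> k; exact: poweR_ge0.
rewrite muleC lee_wpmul2r ?lee_fin ?(ltW A0)// EFinD leeD//.
apply: le_trans (lee_wpmul2l _ Af) _; first by rewrite lee_fin powR_ge0.
rewrite -EFinM lee_fin -powRM ?invr_ge0 ?(ltW A0)//.
by rewrite mulVf ?gt_eqF// powR1.
Qed.

Lemma holder_pow p (s : R) : 1 <= p -> (1 - recp p < s)%R ->
  exists2 C : R, (0 < C)%R & forall f, (forall k, 0 <= f k) ->
    \sumZ_ k ((q k `^ (- s))%:E * f k) <= C%:E * lpn p f.
Proof.
case: p => [r| |] // p1 hs; last first.
  have /zeta_fin[S S0 hS] : (1 < s)%R by move: hs; rewrite /= subr0.
  have S10 : (0 < S + 1)%R by rewrite ltr_wpDl.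
  exists (S + 1)%R => // f f0; apply: le_mul_lpn => // A A0 AE.
  apply: (@le_trans _ _ (\sumZ_ k (A%:E * (q k `^ (- s))%:E))).
    apply: le_sumZ => k; rewrite muleC lee_wpmul2r ?lee_fin ?powR_ge0//.
    by rewrite -AE lpn_point.
  rewrite sumZZ//; last by move=> k; rewrite lee_fin powR_ge0.
  by rewrite EFinM muleC lee_wpmul2r ?lee_fin// (le_trans hS)// lee_fin lerDl.
have [r1|r1] := leP r 1%R.
  have rE : r = 1%R by apply/eqP; rewrite eq_le r1 -lee_fin.
  rewrite rE /= invr1 subrr in hs *; exists 1%R => // f f0.
  rewrite mul1e poweRe1; last by apply: sumZ_ge0 => k; exact: poweR_ge0.
  apply: le_sumZ => k; rewrite poweRe1// -[leRHS]mul1e lee_wpmul2r// lee_fin.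
  by rewrite powRN invf_le1 ?powR_gt0 ?qz_gt0// -(powRr0 (q k)) ler_powR ?qz_ge1// ltW.
have r10 : (0 < r - 1)%R by rewrite subr_gt0.
have r0 : (0 < r)%R by rewrite (lt_trans ltr01).
have /zeta_fin[S S0 hS] : (1 < s * (r / (r - 1)))%R.
  rewrite mulrA ltr_pdivlMr// mul1r.
  have -> : (r - 1 = (1 - r^-1) * r)%R by rewrite mulrBl mul1r mulVf ?gt_eqF.
  by rewrite ltr_pM2r.
exists (S + 1)%R; first by rewrite ltr_wpDl.
move=> f f0; apply: holder_weight => //; first by move=> k; exact: powR_ge0.
by under eq_esum do rewrite -powRrM mulNr.
Qed.

(** The constant is uniform in [e], so the weight may sit at a frequency that depends on the output,
    such as k - j. *)
Lemma holder_pow_bij p (s : R) : 1 <= p -> (1 - recp p < s)%R ->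
  exists2 C : R, (0 < C)%R & forall (e : int -> int) f, bijective e ->
    (forall k, 0 <= f k) ->
    \sumZ_ k ((q (e k) `^ (- s))%:E * f k) <= C%:E * lpn p f.
Proof.
move=> p1 /(holder_pow p1)[C C0 HC]; exists C => // e f be f0.
have [e' ee' e'e] := be.
rewrite -(@lpn_reindex _ p f e'); last by exists e.
apply: le_trans (HC _ (fun k => f0 (e' k))).
rewrite -(sumZ_reindex (fun k => (q k `^ (- s))%:E * f (e' k)) be).
by apply: le_sumZ => k; rewrite ee'.
Qed.

Lemma lpn_qz p (s : R) : 1 <= p -> (recp p < s)%R ->
  exists2 C : R, (0 <= C)%R & lpn p (fun k => (q k `^ (- s))%:E) <= C%:E.
Proof.
case: p => [r| |] // p1 hs; last first.
  exists 1%R => //; apply/lpn_le_oo => k; rewrite lee_fin.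
  by rewrite powRN invf_le1 ?powR_gt0 ?qz_gt0// -(powRr0 (q k)) ler_powR ?qz_ge1// ltW.
have r0 : (0 < r)%R by rewrite (lt_le_trans ltr01).
have /zeta_fin[S S0 hS] : (1 < s * r)%R.
  by rewrite -ltr_pdivrMr// div1r; exact: hs.
exists (S `^ r^-1)%R; first exact: powR_ge0.
rewrite lpn_le_fin ?powR_ge0//; last by move=> k; rewrite lee_fin powR_ge0.
rewrite -powRrM mulVf ?gt_eqF// powRr1//.
by under eq_esum do rewrite poweR_EFin -powRrM mulNr.
Qed.

Lemma powR_mixed (x y t : R) : (0 <= x)%R -> (0 <= y)%R -> (0 < t)%R -> (t < 1)%R ->
  (x `^ t * y `^ (1 - t) <= x + y)%R.
Proof.
move=> x0 y0 t0 t1; have [xy0|] := eqVneq (x + y)%R 0%R.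
  have /eqP -> : (x == 0)%R by move: xy0 => /eqP; rewrite paddr_eq0// => /andP[].
  by rewrite powR0 ?gt_eqF// mul0r add0r.
move=> xy; have -> : (x + y = (x + y) `^ t * (x + y) `^ (1 - t))%R.
  by rewrite -powRD ?xy ?implybT// subrKC powRr1// addr_ge0.
have xl : (x <= x + y)%R by rewrite lerDl.
have yl : (y <= x + y)%R by rewrite lerDr.
have t1' : (0 <= 1 - t)%R by rewrite subr_ge0 ltW.
have xy0 : (0 <= x + y)%R by rewrite addr_ge0.
apply: ler_pM; [exact: powR_ge0|exact: powR_ge0| |].
  by apply: ge0_ler_powR; rewrite ?nnegrE// ltW.
by apply: ge0_ler_powR; rewrite ?nnegrE.
Qed.

(** For p <= 2 the space l^p is contained in l^2 and the weight is merely bounded by one. For finite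
    p > 2 Hölder's inequality with exponent p/2 on the squares needs the weight in the conjugate
    space, that is mu > 1 - 2/p; for p infinite the weight itself is summable. *)
Lemma sq_sum p (mu : R) : 1 <= p -> (0 <= mu)%R ->
  (1 - 2 * recp p < mu \/ 1 / 2 <= recp p)%R ->
  exists2 C : R, (0 <= C)%R & forall a : int -> R, (forall k, (0 <= a k)%R) ->
    lpn p (fun k => (a k)%:E) <= 1 ->
    \sumZ_ k (q k `^ (- mu) * a k ^+ 2)%:E <= C%:E.
Proof.
have qmu k : (0 <= mu)%R -> (q k `^ (- mu) <= 1)%R.
  by move=> mu0; rewrite powRN invf_le1 ?powR_gt0 ?qz_gt0// -(powRr0 (q k)) ler_powR ?qz_ge1.
case: p => [r| |] // p1 mu0 hmu; last first.
  have /zeta_fin[S S0 hS] : (1 < mu)%R by case: hmu => /=; lra.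
  exists S => // a a0 /lpn_le_oo ha; apply: le_trans hS; apply: le_sumZ => k.
  by rewrite lee_fin ler_piMr ?powR_ge0// exprn_ile1// -lee_fin.
have r0 : (0 < r)%R by rewrite (lt_le_trans ltr01).
have [r2|r2] := leP r 2%R.
  exists 1%R => // a a0 ha.
  have a1 k : (a k <= 1)%R.
    by rewrite -lee_fin (le_trans _ ha)//; apply: (lpn_point (f := fun k => (a k)%:E)).
  move: ha; rewrite lpn_le_fin// powR1; apply: le_trans; apply: le_sumZ => k.
  rewrite poweR_EFin lee_fin -[leRHS]mul1r ler_pM ?powR_ge0 ?exprn_ge0 ?qmu//.
  rewrite -powR_mulrn//; have [->|ak0] := eqVneq (a k) 0%R.
    by rewrite powR0 ?powR_ge0//; apply/eqP; lra.
  by apply: ger_powR => //; rewrite lt_neqAle eq_sym ak0 a0 a1.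
have hmu1 : (1 - 2 / r < mu)%R.
  case: hmu => //= h; exfalso.
  have : (1 / 2 * r <= r^-1 * r)%R by rewrite ler_pM2r.
  by rewrite mulVf ?gt_eqF//; lra.
pose t := (r / 2)%R; pose t' := (t / (t - 1))%R.
have t1 : (1 < t)%R by rewrite /t ltr_pdivlMr// mul1r.
have t0 : (0 < t)%R by rewrite (lt_trans ltr01).
have t10 : (0 < t - 1)%R by rewrite subr_gt0.
have t'0 : (0 < t')%R by rewrite divr_gt0.
have tt : (t^-1 + t'^-1 = 1)%R by rewrite /t'; field; rewrite !gt_eqF.
have /zeta_fin[S S0 hS] : (1 < mu * t')%R.
  rewrite /t' mulrA ltr_pdivlMr// mul1r.
  have -> : (t - 1 = (1 - 2 / r) * t)%R by rewrite /t; field; rewrite gt_eqF.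
  by rewrite ltr_pM2r.
exists (S + 1)%R; first by rewrite addr_ge0.
move=> a a0; rewrite lpn_le_fin// powR1 => ha.
apply: (@le_trans _ _ (\sumZ_ k ((q k `^ (- (mu * t')))%:E + (a k)%:E `^ r))).
  apply: le_sumZ => k; rewrite poweR_EFin -EFinD lee_fin.
  have := young_le t1 tt t'0 (powR_ge0 (q k) (- mu)) (exprn_ge0 2 (a0 k)).
  rewrite -powRrM mulNr => h; apply: le_trans h _; rewrite lerD2l.
  by rewrite -powR_mulrn// -powRrM /t mulrCA mulfV ?mulr1.
rewrite esumD; last 2 first.
- by move=> k _; rewrite lee_fin powR_ge0.
- by move=> k _; rewrite poweR_ge0.
by rewrite EFinD leeD.
Qed.

Lemma pair_sum p (mu : R) : 1 <= p -> (0 <= mu)%R ->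
  (1 - 2 * recp p < mu \/ 1 / 2 <= recp p)%R ->
  exists2 C : R, (0 <= C)%R & forall (a b : int -> R) (A B : R),
    (forall k, (0 <= a k)%R) -> (forall k, (0 <= b k)%R) -> (0 <= A)%R -> (0 <= B)%R ->
    lpn p (fun k => (a k)%:E) <= A%:E -> lpn p (fun k => (b k)%:E) <= B%:E ->
    \sumZ_ k (q k `^ (- mu) * (a k * b k))%:E <= (C * A * B)%:E.
Proof.
move=> p1 mu0 /(sq_sum p1 mu0)[C C0 HC]; exists (C + C)%R; first by rewrite addr_ge0.
move=> a b A B a0 b0 A0 B0 hA hB.
have zero c : lpn p (fun k => (c k)%:E) <= 0 -> (forall k, (0 <= c k)%R) ->
    forall k, c k = 0%R.
  move=> hc c0 k; apply/eqP; rewrite eq_le c0 andbT -lee_fin (le_trans _ hc)//.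
  exact: (lpn_point (f := fun k => (c k)%:E)).
have [A00|A00] := eqVneq A 0%R.
  rewrite esum1 ?A00 ?mulr0 ?mul0r// => k _; rewrite A00 in hA.
  by rewrite (zero _ hA a0) mul0r mulr0.
have [B00|B00] := eqVneq B 0%R.
  rewrite esum1 ?B00 ?mulr0 ?mul0r// => k _; rewrite B00 in hB.
  by rewrite (zero _ hB b0) !mulr0.
have {A00} A0' : (0 < A)%R by rewrite lt_neqAle eq_sym A00.
have {B00} B0' : (0 < B)%R by rewrite lt_neqAle eq_sym B00.
have nrm c D : (0 < D)%R -> (forall k, (0 <= c k)%R) -> lpn p (fun k => (c k)%:E) <= D%:E ->
    lpn p (fun k => (D^-1 * c k)%:E) <= 1.
  move=> D0 c0 hc; have Di : (0 <= D^-1)%R by rewrite invr_ge0 ltW.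
  rewrite (lpnZ (f := fun k => (c k)%:E))//.
  apply: le_trans (lee_wpmul2l _ hc) _; first by rewrite lee_fin.
  by rewrite -EFinM mulVf// gt_eqF.
have ha := HC (fun k => A^-1 * a k)%R _ (nrm _ _ A0' a0 hA).
have hb := HC (fun k => B^-1 * b k)%R _ (nrm _ _ B0' b0 hB).
have Ai k : (0 <= A^-1 * a k)%R by rewrite mulr_ge0// invr_ge0.
have Bi k : (0 <= B^-1 * b k)%R by rewrite mulr_ge0// invr_ge0.
have {ha hb} := leeD (ha Ai) (hb Bi); rewrite -esumD; last 2 first.
- by move=> k _; rewrite lee_fin mulr_ge0 ?powR_ge0 ?exprn_ge0.
- by move=> k _; rewrite lee_fin mulr_ge0 ?powR_ge0 ?exprn_ge0.
move=> h; have AB0 : (0 <= A * B)%R by rewrite mulr_ge0.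
have -> : ((C + C) * A * B)%:E = (A * B)%:E * (C%:E + C%:E).
  by rewrite -EFinD -EFinM; congr EFin; ring.
apply: le_trans (lee_wpmul2l _ h); last by rewrite lee_fin.
rewrite -sumZZ//; last first.
  by move=> k; rewrite adde_ge0// lee_fin mulr_ge0 ?powR_ge0 ?exprn_ge0.
apply: le_sumZ => k; rewrite -EFinD -EFinM lee_fin -mulrDr.
have -> : (a k * b k = (A * B) * ((A^-1 * a k) * (B^-1 * b k)))%R.
  by field; rewrite !gt_eqF.
rewrite mulrCA ler_wpM2l// ler_wpM2l ?powR_ge0//.
by move: (A^-1 * a k)%R (B^-1 * b k)%R (Ai k) (Bi k); clear => x y x0 y0; nra.
Qed.
End Hoelder.

Local Close Scope ereal_scope.

(** * Bilinear operators given by a kernel *)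

Local Open Scope ereal_scope.

Section Bilinear.
Variable R : realType.
Implicit Types (p : \bar R).
Local Notation q := (@qz R).

Lemma subl_bij (k : int) : bijective (fun j => k - j)%R.
Proof. by exists (fun j => k - j)%R => j; rewrite subKr. Qed.

Lemma subr_bij (k : int) : bijective (fun j => j - k)%R.
Proof. by exists (fun j => j + k)%R => j; rewrite ?subrK ?addrK. Qed.

Definition bilinear_op (W : int -> int -> R) (a b : int -> R) (k : int) : \bar R :=
  \sumZ_ j (W k j * (a j * b (k - j)))%:E.

Definition bilinear_bounded p (W : int -> int -> R) := exists2 C : R, (0 <= C)%R &
  forall (a b : int -> R) (A B : R),
    (forall k, (0 <= a k)%R) -> (forall k, (0 <= b k)%R) -> (0 <= A)%R -> (0 <= B)%R ->
    lpn p (fun k => (a k)%:E) <= A%:E -> lpn p (fun k => (b k)%:E) <= B%:E ->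
    lpn p (bilinear_op W a b) <= (C * A * B)%:E.

Lemma bilinear_op_ge0 W (a b : int -> R) k : (forall k j, (0 <= W k j)%R) ->
  (forall k, (0 <= a k)%R) -> (forall k, (0 <= b k)%R) -> 0 <= bilinear_op W a b k.
Proof. by move=> W0 a0 b0; apply: sumZ_ge0 => j; rewrite lee_fin !mulr_ge0. Qed.

(** Hölder's inequality in [j] against the weight leaves the l^p norm of the products, which
    [lpn_conv] handles. Since [e k] must be a bijection in [j], a weight at the output frequency
    needs another argument. *)
Lemma bilinear_bounded_weight p (kap : R) (e : int -> int -> int) : 1 <= p ->
  (1 - recp p < kap)%R -> (forall k, bijective (e k)) ->
  bilinear_bounded p (fun k j => q (e k j) `^ (- kap))%R.
Proof.
move=> p1 /(holder_pow_bij p1)[C C0 HC] be; exists C; first exact: ltW.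
move=> a b A B a0 b0 A0 B0 hA hB.
have ab0 k j : 0 <= (a j * b (k - j))%:E by rewrite lee_fin mulr_ge0.
apply: (@le_trans _ _ (lpn p (fun k => C%:E * lpn p (fun j => (a j * b (k - j))%:E)))).
  apply: le_lpn => // k.
    by apply: bilinear_op_ge0 => // ? ?; exact: powR_ge0.
  by apply: le_trans (HC (e k) _ (be k) (ab0 k)); apply: le_sumZ => j; rewrite EFinM.
rewrite (lpnZ (f := fun k => lpn p (fun j => (a j * b (k - j))%:E)))//; last 2 first.
- exact: ltW.
- by move=> k; apply: lpn_ge0.
rewrite -mulrA EFinM lee_wpmul2l ?lee_fin ?(ltW C0)//.
exact: lpn_conv.
Qed.

Lemma bilinear_bounded_le p (W W' : int -> int -> R) (c : R) : 1 <= p -> (0 <= c)%R ->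
  (forall k j, (0 <= W k j)%R) -> (forall k j, (W k j <= c * W' k j)%R) ->
  bilinear_bounded p W' -> bilinear_bounded p W.
Proof.
move=> p1 c0 W0 WW' [C C0 HC]; exists (c * C)%R; first by rewrite mulr_ge0.
move=> a b A B a0 b0 A0 B0 hA hB.
have [cE|c0'] := eqVneq c 0%R.
  rewrite cE !mul0r; apply: (@le_trans _ _ (lpn p (fun k => 0%:E * 0%:E))).
    apply: le_lpn => // k; first exact: bilinear_op_ge0.
    rewrite mul0e /bilinear_op esum1// => j _.
    have := WW' k j; rewrite cE mul0r => h.
    by rewrite (_ : W k j = 0%R) ?mul0r//; apply/eqP; rewrite eq_le h W0.
  by rewrite (lpnZ (f := fun=> 0%:E))// mul0e.
have {c0'} c0' : (0 < c)%R by rewrite lt_neqAle eq_sym c0'.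
have W'0 k j : (0 <= W' k j)%R.
  by rewrite -(pmulr_rge0 _ c0') (le_trans (W0 k j)).
rewrite -!mulrA EFinM.
apply: (@le_trans _ _ (lpn p (fun k => c%:E * bilinear_op W' a b k))).
  apply: le_lpn => // k; first exact: bilinear_op_ge0.
  rewrite /bilinear_op -sumZZ//; last by move=> j; rewrite lee_fin !mulr_ge0.
  by apply: le_sumZ => j; rewrite -EFinM lee_fin [leRHS]mulrA ler_wpM2r// mulr_ge0.
rewrite lpnZ//; last by move=> k; exact: bilinear_op_ge0.
by rewrite lee_wpmul2l// mulrA HC.
Qed.

Lemma bilinear_boundedD p (W W' : int -> int -> R) : 1 <= p ->
  (forall k j, (0 <= W k j)%R) -> (forall k j, (0 <= W' k j)%R) ->
  bilinear_bounded p W -> bilinear_bounded p W' ->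
  bilinear_bounded p (fun k j => W k j + W' k j)%R.
Proof.
move=> p1 W0 W'0 [C C0 HC] [C' C'0 HC']; exists (C + C')%R; first by rewrite addr_ge0.
move=> a b A B a0 b0 A0 B0 hA hB.
apply: (@le_trans _ _ (lpn p (fun k => bilinear_op W a b k + bilinear_op W' a b k))).
  rewrite le_eqVlt; apply/orP; left; apply/eqP; apply: eq_lpn => k.
  rewrite /bilinear_op -esumD; last 2 first.
  - by move=> j _; rewrite lee_fin !mulr_ge0.
  - by move=> j _; rewrite lee_fin !mulr_ge0.
  by apply: eq_esum => j _; rewrite -EFinD mulrDl.
apply: le_trans (lpnD p1 _ _) _; try by move=> k; exact: bilinear_op_ge0.
rewrite !mulrDl EFinD leeD//; [exact: HC|exact: HC'].
Qed.

(** The sum over [j] is bounded uniformly in [k] by [pair_sum], and the weight in [k] belongs to l^p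
    because s > 1/p. *)
Lemma bilinear_bounded_high p (s mu : R) : 1 <= p -> (0 <= mu)%R ->
  (1 - 2 * recp p < mu)%R -> (recp p < s)%R ->
  bilinear_bounded p (fun k j => q k `^ (- s) * q j `^ (- mu))%R.
Proof.
move=> p1 mu0 hmu hs; have [C C0 HC] := pair_sum p1 mu0 (or_introl hmu).
have [S S0 HS] := lpn_qz p1 hs.
exists (C * S)%R; first by rewrite mulr_ge0.
move=> a b A B a0 b0 A0 B0 hA hB.
have CAB : (0 <= C * A * B)%R by rewrite !mulr_ge0.
apply: (@le_trans _ _ (lpn p (fun k => (C * A * B)%:E * (q k `^ (- s))%:E))).
  apply: le_lpn => // k.
    by apply: bilinear_op_ge0 => // ? ?; rewrite mulr_ge0 ?powR_ge0.
  rewrite /bilinear_op muleC.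
  under eq_esum do rewrite -mulrA EFinM.
  rewrite (sumZZ (f := fun j => (q j `^ (- mu) * (a j * b (k - j)))%:E)) ?powR_ge0//; last first.
    by move=> j; rewrite lee_fin !mulr_ge0 ?powR_ge0.
  rewrite lee_wpmul2l ?lee_fin ?powR_ge0//.
  apply: HC => //.
  by rewrite (lpn_reindex p (fun k => (b k)%:E) (subl_bij k)).
rewrite (lpnZ (f := fun k => (q k `^ (- s))%:E))//; last first.
  by move=> k; rewrite lee_fin powR_ge0.
have -> : (C * S * A * B)%:E = (C * A * B)%:E * S%:E by rewrite -EFinM; congr EFin; ring.
by rewrite lee_wpmul2l.
Qed.

(** For r > 1 let r' be conjugate to r, and split b = b^(r-1) b^(2-r) after normalising b. As (r-1)
    r' = r, Hölder's inequality in [j] uses up the first factor. After exchanging the sums, q^(-kap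
    r) b^((2-r) r) is the product of the powers r - 1 of q^(-kap r') and 2 - r of b^r, hence at most
    their sum, and both are summable. For r = 1 the weight is simply at most one. *)
Lemma bilinear_bounded_young (r kap : R) : (1 <= r)%R -> (r < 2)%R -> (1 - r^-1 < kap)%R ->
  bilinear_bounded r%:E (fun k j => q k `^ (- kap))%R.
Proof.
move=> r1 r2 hk; have p1 : 1 <= r%:E by rewrite lee_fin.
have r0 : (0 < r)%R by rewrite (lt_le_trans ltr01).
have [r1'|r1'] := leP r 1%R.
  have rE : r = 1%R by apply/eqP; rewrite eq_le r1' r1.
  have k0 : (0 <= kap)%R by move: hk; rewrite rE invr1 subrr => /ltW.
  exists 1%R => // a b A B a0 b0 A0 B0 hA hB; rewrite mul1r.
  have ab0 k j : 0 <= (a j * b (k - j))%:E by rewrite lee_fin mulr_ge0.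
  apply: le_trans (lpn_conv p1 a0 b0 A0 B0 hA hB).
  apply: le_lpn => // k; first by apply: bilinear_op_ge0 => // ? ?; exact: powR_ge0.
  rewrite rE /lpn invr1 poweRe1; last by apply: sumZ_ge0 => j; exact: poweR_ge0.
  apply: le_sumZ => j; rewrite poweRe1// lee_fin ler_piMl ?mulr_ge0//.
  by rewrite powRN invf_le1 ?powR_gt0 ?qz_gt0// -(powRr0 (q k)) ler_powR ?qz_ge1.
have r10 : (0 < r - 1)%R by rewrite subr_gt0.
pose r' := (r / (r - 1))%R.
have /zeta_fin[S S0 hS] : (1 < kap * r')%R.
  rewrite /r' mulrA ltr_pdivlMr// mul1r.
  have -> : (r - 1 = (1 - r^-1) * r)%R by rewrite mulrBl mul1r mulVf ?gt_eqF.
  by rewrite ltr_pM2r.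
exists (2 * (S + 1) `^ r^-1)%R; first by rewrite mulr_ge0 ?powR_ge0.
move=> a b A B a0 b0 A0 B0 hA hB.
have [B00|B00] := eqVneq B 0%R.
  rewrite B00 mulr0; apply: (@le_trans _ _ (lpn r%:E (fun k => 0%:E * 0%:E))).
    apply: le_lpn => // k; first by apply: bilinear_op_ge0 => // ? ?; exact: powR_ge0.
    rewrite mul0e /bilinear_op esum1// => j _; rewrite (_ : b (k - j)%R = 0%R) ?mulr0//.
    apply/eqP; rewrite eq_le b0 andbT -lee_fin; rewrite B00 in hB; apply: le_trans hB.
    exact: (lpn_point (f := fun k => (b k)%:E)).
  by rewrite (lpnZ (f := fun=> 0%:E))// mul0e.
have {B00} B0' : (0 < B)%R by rewrite lt_neqAle eq_sym B00.
pose b' k := (B^-1 * b k)%R.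
have b'0 k : (0 <= b' k)%R by rewrite mulr_ge0// invr_ge0.
have hb' : \sumZ_ k (b' k `^ r)%:E <= 1.
  have : lpn r%:E (fun k => (b' k)%:E) <= 1%:E.
    rewrite (lpnZ (f := fun k => (b k)%:E))// ?invr_ge0//.
    apply: le_trans (lee_wpmul2l _ hB) _; first by rewrite lee_fin invr_ge0.
    by rewrite -EFinM mulVf// gt_eqF.
  by rewrite lpn_le_fin// powR1.
have hb'k k : \sumZ_ j (b' (k - j) `^ r)%:E <= 1.
  by rewrite (sumZ_reindex (fun j => (b' j `^ r)%:E) (subl_bij k)).
have f0 k j : 0 <= (a j * b' (k - j) `^ (2 - r))%:E by rewrite lee_fin mulr_ge0 ?powR_ge0.
have inner k : bilinear_op (fun k j => q k `^ (- kap))%R a b k <=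
    (2 * B)%:E * ((q k `^ (- kap))%:E * lpn r%:E (fun j => (a j * b' (k - j) `^ (2 - r))%:E)).
  have := @holder_weight _ r 1 (fun j => b' (k - j) `^ (r - 1))%R
    (fun j => (a j * b' (k - j) `^ (2 - r))%:E) r1' (fun j => powR_ge0 _ _) (f0 k).
  rewrite -[(1 + 1)%R]/(2%R) => h.
  have {}h := h _.
  have -> : bilinear_op (fun k j => q k `^ (- kap))%R a b k =
     (B * q k `^ (- kap))%:E * \sumZ_ j ((b' (k - j) `^ (r - 1))%:E * (a j * b' (k - j) `^ (2 - r))%:E).
    rewrite /bilinear_op -sumZZ ?mulr_ge0 ?powR_ge0//; last first.
      by move=> j; rewrite mule_ge0// lee_fin powR_ge0.
    apply: eq_esum => j _; rewrite -!EFinM; congr EFin.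
    have -> : (b (k - j) = B * (b' (k - j)%R `^ (r - 1) * b' (k - j)%R `^ (2 - r)))%R.
      rewrite -powRD; last by apply/implyP => /eqP; lra.
      have -> : (r - 1 + (2 - r) = 1)%R by lra.
      by rewrite powRr1// /b' mulrA mulfV ?mul1r// gt_eqF.
    ring.
  have -> : (2 * B)%:E * ((q k `^ (- kap))%:E * lpn r%:E (fun j => (a j * b' (k - j) `^ (2 - r))%:E))
    = (B * q k `^ (- kap))%:E * (2%:E * lpn r%:E (fun j => (a j * b' (k - j) `^ (2 - r))%:E)).
    by rewrite !muleA -!EFinM; congr (_%:E * _); ring.
  rewrite lee_wpmul2l ?lee_fin ?mulr_ge0 ?powR_ge0//; apply: h.
  under eq_esum do rewrite -powRrM mulrC divfK ?gt_eqF//.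
  exact: hb'k.
have -> : (2 * (S + 1) `^ r^-1 * A * B)%:E = (2 * B)%:E * ((S + 1) `^ r^-1 * A)%:E.
  by rewrite -EFinM; congr EFin; ring.
have g0 k : 0 <= (q k `^ (- kap))%:E * lpn r%:E (fun j => (a j * b' (k - j) `^ (2 - r))%:E).
  by rewrite mule_ge0 ?lee_fin ?powR_ge0// lpn_ge0.
apply: (@le_trans _ _ (lpn r%:E (fun k => (2 * B)%:E *
    ((q k `^ (- kap))%:E * lpn r%:E (fun j => (a j * b' (k - j) `^ (2 - r))%:E))))).
  apply: le_lpn => // k; first by apply: bilinear_op_ge0 => // ? ?; exact: powR_ge0.
rewrite lpnZ ?mulr_ge0// lee_wpmul2l ?lee_fin ?mulr_ge0//.
rewrite lpn_le_fin// ?mulr_ge0 ?powR_ge0//.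
rewrite powRM ?powR_ge0// -powRrM mulVf ?gt_eqF// powRr1 ?addr_ge0//.
have eq1 k : ((q k `^ (- kap))%:E * lpn r%:E (fun j => (a j * b' (k - j) `^ (2 - r))%:E)) `^ r
   = \sumZ_ j ((a j `^ r)%:E * (q k `^ (- kap * r) * b' (k - j) `^ ((2 - r) * r))%:E).
  rewrite poweRM ?lpn_ge0 ?lee_fin ?powR_ge0// lpn_powK// -sumZZ ?powR_ge0//; last first.
    by move=> j; exact: poweR_ge0.
  apply: eq_esum => j _; rewrite poweR_EFin powRM ?powR_ge0// -!powRrM -!EFinM; congr EFin.
  ring.
under eq_esum do rewrite eq1.
rewrite sumZ_swap; last by move=> k j; rewrite mule_ge0// lee_fin ?mulr_ge0 ?powR_ge0.
apply: (@le_trans _ _ (\sumZ_ j ((S + 1)%:E * (a j `^ r)%:E))).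
  apply: le_sumZ => j; rewrite sumZZ ?powR_ge0//; last first.
    by move=> k; rewrite lee_fin mulr_ge0 ?powR_ge0.
  rewrite muleC lee_wpmul2r ?lee_fin ?powR_ge0//.
  apply: (@le_trans _ _ (\sumZ_ k ((q k `^ (- (kap * r')))%:E + (b' (k - j) `^ r)%:E))).
    apply: le_sumZ => k; rewrite -EFinD lee_fin.
    have := @powR_mixed R (q k `^ (- (kap * r')))%R (b' (k - j)%R `^ r)%R (r - 1)%R
      (powR_ge0 _ _) (powR_ge0 _ _) r10 _.
    have -> : (1 - (r - 1) = 2 - r)%R by ring.
    rewrite -!powRrM => h.
    have -> : (- kap * r = - (kap * r') * (r - 1))%R by rewrite /r'; field; rewrite gt_eqF.
    by rewrite [((2 - r) * r)%R]mulrC; apply: h; lra.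
  rewrite esumD; last 2 first.
  - by move=> k _; rewrite lee_fin powR_ge0.
  - by move=> k _; rewrite lee_fin powR_ge0.
  rewrite EFinD leeD//.
  by rewrite (sumZ_reindex (fun k => (b' k `^ r)%:E) (subr_bij j)).
rewrite sumZZ ?addr_ge0//; last by move=> k; rewrite lee_fin powR_ge0.
rewrite EFinM lee_wpmul2l ?lee_fin ?addr_ge0//.
by move: hA; rewrite lpn_le_fin.
Qed.
End Bilinear.

Local Close Scope ereal_scope.

(** * Boundedness of the kernel of X *)

Lemma powR_anti (R : realType) (x y s : R) : 0 < x -> x <= y -> 0 <= s ->
  y `^ (- s) <= x `^ (- s).
Proof.
move=> x0 xy s0; have y0 : 0 < y by exact: lt_le_trans xy.
by rewrite !powRN lef_pV2 ?posrE ?powR_gt0// ge0_ler_powR ?nnegrE// ltW.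
Qed.

Lemma powR_add (R : realType) (x s t : R) : 0 < x -> x `^ (s + t) = x `^ s * x `^ t.
Proof. by move=> x0; rewrite powRD//; apply/implyP => _; rewrite gt_eqF. Qed.

Lemma recp_ge0 (R : realType) (p : \bar R) : (1 <= p)%E -> 0 <= recp p.
Proof. by case: p => [r| |] //= p1; rewrite invr_ge0 (le_trans ler01). Qed.

Lemma recp_le1 (R : realType) (p : \bar R) : (1 <= p)%E -> recp p <= 1.
Proof.
by case: p => [r| |] //= p1; rewrite invf_le1// (lt_le_trans ltr01).
Qed.

Section KernelBounds.
Variable R : realType.
Implicit Types x y z al g mu : R.
Local Notation rho al g := (1 + al - g).
Local Notation kap al g := (2 + al - 3 * g).

(* With x, y, z = <k>, <k1>, <k - k1>: the weight [x^al y^-al z^-al] times the size [x^g (y z)^(g - 1)] of the coefficients of X. *)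
Definition bker x y z al g : R := x `^ (g + al) * y `^ (- rho al g) * z `^ (- rho al g).

Lemma bkerC x y z al g : bker x y z al g = bker x z y al g.
Proof. by rewrite /bker mulrAC. Qed.

Lemma bker_deg x al g : 0 < x ->
  x `^ (- kap al g) = x `^ (g + al) * x `^ (- rho al g) * x `^ (- rho al g).
Proof. by move=> x0; rewrite -!powR_add//; congr (_ `^ _); ring. Qed.

(** [bker] is homogeneous of degree -kap. Here all the decay is moved to the smaller input frequency
    z: a nonnegative power of x is absorbed by y, and a negative one is compared with z <= x. *)
Lemma bker_min x y z al g : 1 <= x -> 1 <= y -> 1 <= z -> x <= 2 * y -> z <= y ->
  0 <= rho al g -> g <= 1 / 2 -> (0 <= g + al) || (z <= x) ->
  bker x y z al g <= 2 `^ `|g + al| * z `^ (- kap al g).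
Proof.
move=> x1 y1 z1 xy zy r0 g2 hc.
have x0 : 0 < x by lra.
have y0 : 0 < y by lra.
have z0 : 0 < z by lra.
have c1 : 1 <= 2 `^ `|g + al|.
  by rewrite -[leLHS](powRr0 (2 : R)) ler_powR ?ler1n.
have [ga|ga] := leP 0 (g + al).
  rewrite ger0_norm//.
  apply: (@le_trans _ _ ((2 * y) `^ (g + al) * y `^ (- rho al g) * z `^ (- rho al g))).
    by rewrite /bker !ler_wpM2r ?powR_ge0// ge0_ler_powR ?nnegrE ?(ltW x0)// mulr_ge0// ltW.
  rewrite powRM ?(ltW y0)// -!mulrA ler_wpM2l ?powR_ge0// mulrA -powR_add//.
  have -> : g + al - rho al g = - (1 - 2 * g) by ring.
  have -> : - kap al g = - (1 - 2 * g) + - rho al g by ring.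
  rewrite powR_add// ler_wpM2r ?powR_ge0// powR_anti//; lra.
have zx : z <= x by move: hc; rewrite leNgt ga.
apply: (@le_trans _ _ (1 * z `^ (- kap al g))); last by rewrite ler_wpM2r ?powR_ge0.
rewrite mul1r /bker.
rewrite bker_deg// ler_wpM2r ?powR_ge0// ler_pM ?powR_ge0//; last exact: powR_anti.
by rewrite -[g + al]opprK powR_anti// oppr_ge0 ltW.
Qed.

Lemma bker_low x y z al g : 1 <= x -> x <= y -> x <= z -> 0 <= rho al g ->
  bker x y z al g <= x `^ (- kap al g).
Proof.
move=> x1 xy xz r0; have x0 : 0 < x by lra.
by rewrite bker_deg// /bker !ler_pM ?mulr_ge0 ?powR_ge0// powR_anti.
Qed.

(** With the output frequency smallest and the inputs comparable, part [mu] of the decay stays on an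
    input, in the form that [bilinear_bounded_high] accepts. *)
Lemma bker_low_mixed x y z al g mu : 1 <= x -> x <= y -> x <= z -> y <= 2 * z ->
  0 <= rho al g -> mu <= 2 * rho al g ->
  bker x y z al g <= 2 `^ rho al g * (x `^ (- (kap al g - mu)) * y `^ (- mu)).
Proof.
move=> x1 xy xz yz r0 hmu; have x0 : 0 < x by lra.
have y0 : 0 < y by lra.
have z0 : 0 < z by lra.
have zz : z `^ (- rho al g) <= 2 `^ rho al g * y `^ (- rho al g).
  apply: (@le_trans _ _ ((y / 2) `^ (- rho al g))).
    by rewrite powR_anti ?divr_gt0// ler_pdivrMr// mulrC.
  rewrite powRM ?invr_ge0 ?(ltW y0)// mulrC ler_wpM2r ?powR_ge0//.
  by rewrite -powR_inv1// -powRrM mulN1r opprK.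
rewrite /bker; apply: le_trans (ler_wpM2l _ zz) _; first by rewrite mulr_ge0 ?powR_ge0.
rewrite mulrCA ler_wpM2l ?powR_ge0// -mulrA -powR_add//.
have -> : x `^ (- (kap al g - mu)) = x `^ (g + al) * x `^ (- (2 * rho al g - mu)).
  by rewrite -powR_add//; congr (_ `^ _); ring.
have -> : - rho al g - rho al g = - (2 * rho al g - mu) - mu by ring.
rewrite (powR_add _ _ y0) -mulrA ler_wpM2l ?powR_ge0// ler_wpM2r ?powR_ge0//.
by rewrite powR_anti// subr_ge0.
Qed.

Local Notation q := (@qz R).

Lemma bilinear_bounded_bker (p : \bar R) al g : (1 <= p)%E -> 1 / 3 < g -> g <= 1 / 2 ->
  - (1 / 2) < al -> 3 * g - 1 - recp p < al ->
  bilinear_bounded p (fun k j => bker (q k) (q j) (q (k - j)) al g).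
Proof.
move=> p1 g3 g2 al2 alp.
have r0 := recp_ge0 p1.
have rho0 : 0 <= rho al g by lra.
have kap1 : 1 - recp p < kap al g by lra.
have W1 := bilinear_bounded_weight p1 kap1 (e := fun=> id) (fun=> inv_bij (fun=> erefl)).
have W2 := bilinear_bounded_weight p1 kap1 (e := fun k j => k - j) subl_bij.
(* [W] serves the case in which the output frequency is the smallest of the three and carries a
   negative power. Its decay in [k] is no help in Hölder's inequality over [j], so p < 2 and p >= 2
   are treated differently. *)
have [W [c [c0 W0 HW WB]]] : exists (W : int -> int -> R) (c : R), [/\ 0 <= c,
    forall k j, 0 <= W k j,
    forall k j, q k <= q j -> q k <= q (k - j) ->
      bker (q k) (q j) (q (k - j)) al g <= c * W k j &
    bilinear_bounded p W].
  have [p2|p2] := leP (recp p) (1 / 2); last first.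
    exists (fun k j => q k `^ (- kap al g)), 1; split.
    - exact: ler01.
    - by move=> k j; exact: powR_ge0.
    - by move=> k j kj kj'; rewrite mul1r bker_low// qz_ge1.
    - case: p p1 r0 p2 alp kap1 {W1 W2} => [r| |] //= p1 r0 p2 alp kap1; last by lra.
      apply: bilinear_bounded_young; [exact: p1| |exact: kap1].
      have r00 : 0 < r by rewrite (lt_le_trans ltr01).
      have : 1 / 2 * r < r^-1 * r by rewrite ltr_pM2r.
      by rewrite mulVf ?gt_eqF//; clear; lra.
  (* The second entry is the midpoint between 1 - 2/p and kap - 1/p, an interval that is nonempty
     because kap > 1 - 1/p; the first is the cap in [bker_low_mixed]. *)
  pose mu := Num.min (2 * rho al g) ((1 - 2 * recp p + kap al g - recp p) / 2).
  have mu1 : 1 - 2 * recp p < mu by rewrite lt_min; apply/andP; split; lra.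
  have mu2 : mu <= 2 * rho al g by rewrite ge_min lexx.
  have mu3 : recp p < kap al g - mu.
    have : mu <= (1 - 2 * recp p + kap al g - recp p) / 2 by rewrite ge_min lexx orbT.
    by move: kap1; clear; lra.
  have mu0 : 0 <= mu by clear -mu1 p2; lra.
  exists (fun k j => q k `^ (- (kap al g - mu)) * q j `^ (- mu)), (2 `^ rho al g); split.
  - exact: powR_ge0.
  - by move=> k j; rewrite mulr_ge0 ?powR_ge0.
  - move=> k j kj kj'; apply: (bker_low_mixed (qz_ge1 R k) kj kj' _ rho0 mu2).
    have := qzD R k (- (k - j)); rewrite qzN (_ : k - (k - j) = j); last by rewrite subKr.
    by move: kj'; clear; lra.
  - exact: (bilinear_bounded_high p1 mu0 mu1 mu3).
have W12 := bilinear_boundedD p1 (fun _ _ => powR_ge0 _ _) (fun _ _ => powR_ge0 _ _) W1 W2.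
have W3 := bilinear_boundedD p1 (fun _ _ => addr_ge0 (powR_ge0 _ _) (powR_ge0 _ _)) W0 W12 WB.
pose c' := c + 2 `^ `|g + al|.
have c'0 : 0 <= c' by rewrite addr_ge0 ?powR_ge0.
apply: (bilinear_bounded_le p1 c'0 _ _ W3).
  by move=> k j; rewrite /bker !mulr_ge0 ?powR_ge0.
move=> k j /=.
have [x1 y1 z1] : [/\ 1 <= q k, 1 <= q j & 1 <= q (k - j)] by split; exact: qz_ge1.
have xyz : q k <= q j + q (k - j) by rewrite -[k in leLHS](subrKC j) qzD.
have HWkj := HW k j.
have W0kj := W0 k j.
set x := q k in x1 xyz HWkj *; set y := q j in y1 xyz HWkj *.
set z := q (k - j) in z1 xyz HWkj *.
set w := W k j in HWkj W0kj *.
have cl : 2 `^ `|g + al| <= c' by rewrite lerDr.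
have cl2 : c <= c' by rewrite lerDl powR_ge0.
have [yk zk] : 0 <= y `^ (- kap al g) /\ 0 <= z `^ (- kap al g) by split; exact: powR_ge0.
have [zy|yz] := leP z y.
  have [|] := boolP ((0 <= g + al) || (z <= x)) => [h|].
    apply: le_trans (bker_min x1 y1 z1 _ zy rho0 g2 h) _; first by move: zy xyz; clear; lra.
    apply: ler_pM; [exact: powR_ge0|exact: powR_ge0|exact: cl|].
    by move: yk W0kj; clear; lra.
  rewrite negb_or -!ltNge => /andP[_ xz].
  apply: le_trans (HWkj _ _) _; [by move: xz zy; clear; lra|exact: ltW|].
  apply: ler_pM; [exact: c0|exact: W0kj|exact: cl2|].
  by move: yk zk; clear; lra.
rewrite bkerC; have [|] := boolP ((0 <= g + al) || (y <= x)) => [h|].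
  apply: le_trans (bker_min x1 z1 y1 _ (ltW yz) rho0 g2 h) _; first by move: yz xyz; clear; lra.
  apply: ler_pM; [exact: powR_ge0|exact: powR_ge0|exact: cl|].
  by move: zk W0kj; clear; lra.
rewrite negb_or -!ltNge bkerC => /andP[_ xy].
apply: le_trans (HWkj _ _) _; [exact: ltW|by move: xy yz; clear; lra|].
apply: ler_pM; [exact: c0|exact: W0kj|exact: cl2|].
by move: yk zk; clear; lra.
Qed.
End KernelBounds.

(** * Trilinear operators given by a kernel *)

Local Open Scope ereal_scope.

Section Trilinear.
Variable R : realType.
Implicit Types (p : \bar R) (W : int -> int -> int -> R).
Local Notation q := (@qz R).

Definition trilinear_op W (a b c : int -> R) (k : int) : \bar R :=
  \sumZ_ i (\sumZ_ j (W k i j * (a i * (b j * c (k - i - j))))%:E).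

Definition trilinear_bounded p W := exists2 C : R, (0 <= C)%R &
  forall (a b c : int -> R) (A B D : R),
    (forall k, (0 <= a k)%R) -> (forall k, (0 <= b k)%R) -> (forall k, (0 <= c k)%R) ->
    (0 <= A)%R -> (0 <= B)%R -> (0 <= D)%R ->
    lpn p (fun k => (a k)%:E) <= A%:E -> lpn p (fun k => (b k)%:E) <= B%:E ->
    lpn p (fun k => (c k)%:E) <= D%:E ->
    lpn p (trilinear_op W a b c) <= (C * A * B * D)%:E.

Lemma trilinear_op_ge0 W (a b c : int -> R) k : (forall k i j, (0 <= W k i j)%R) ->
  (forall k, (0 <= a k)%R) -> (forall k, (0 <= b k)%R) -> (forall k, (0 <= c k)%R) ->
  0 <= trilinear_op W a b c k.
Proof.
move=> W0 a0 b0 c0; apply: sumZ_ge0 => i; apply: sumZ_ge0 => j.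
by rewrite lee_fin !mulr_ge0.
Qed.

Lemma lpn_conv3 p (a b c : int -> R) (A B D : R) : 1 <= p ->
  (forall k, (0 <= a k)%R) -> (forall k, (0 <= b k)%R) -> (forall k, (0 <= c k)%R) ->
  (0 <= A)%R -> (0 <= B)%R -> (0 <= D)%R ->
  lpn p (fun k => (a k)%:E) <= A%:E -> lpn p (fun k => (b k)%:E) <= B%:E ->
  lpn p (fun k => (c k)%:E) <= D%:E ->
  lpn p (fun k => lpn p (fun i => lpn p (fun j => (a i * (b j * c (k - i - j)))%:E)))
    <= (A * B * D)%:E.
Proof.
move=> p1 a0 b0 c0 A0 B0 D0 hA hB hD.
pose G k := lpn p (fun j => (b j * c (k - j))%:E).
have bc0 k j : 0 <= (b j * c (k - j))%:E by rewrite lee_fin mulr_ge0.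
have G0 k : 0 <= G k by exact: lpn_ge0.
have hG : lpn p G <= (B * D)%:E by exact: lpn_conv.
have Gy : lpn p G < +oo by rewrite (le_lt_trans hG)// ltry.
have [g g0 gE] := lpn_fin_seq p1 G0 Gy.
have hg : lpn p (fun k => (g k)%:E) <= (B * D)%:E by rewrite -gE.
have := lpn_conv p1 a0 g0 A0 (mulr_ge0 B0 D0) hA hg; rewrite mulrA.
apply: le_trans; rewrite le_eqVlt; apply/orP; left; apply/eqP.
apply: eq_lpn => k; apply: eq_lpn => i.
have gE' : (g (k - i))%:E = G (k - i)%R by rewrite gE.
rewrite EFinM gE' -(lpnZ p1 (a0 i) (bc0 _)).
by apply: eq_lpn => j; rewrite EFinM.
Qed.

(** Two nested Hölder inequalities: in [j] for fixed [k], [i] against the second weight, then in [i]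
    against the first. *)
Lemma trilinear_bounded_weight p (kap : R) (e1 : int -> int -> int)
    (e2 : int -> int -> int -> int) : 1 <= p -> (1 - recp p < kap)%R ->
  (forall k, bijective (e1 k)) -> (forall k i, bijective (e2 k i)) ->
  trilinear_bounded p (fun k i j => q (e1 k i) `^ (- kap) * q (e2 k i j) `^ (- kap))%R.
Proof.
move=> p1 /(holder_pow_bij p1)[C C0 HC] be1 be2; exists (C * C)%R; first by rewrite mulr_ge0// ltW.
move=> a b c A B D a0 b0 c0 A0 B0 D0 hA hB hD.
have f0 k i j : 0 <= (a i * (b j * c (k - i - j)))%:E by rewrite lee_fin !mulr_ge0.
pose F k i := lpn p (fun j => (a i * (b j * c (k - i - j)))%:E).
have F0 k i : 0 <= F k i by exact: lpn_ge0.
apply: (@le_trans _ _ (lpn p (fun k => (C * C)%:E * lpn p (F k)))).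
  apply: le_lpn => // k.
    by apply: trilinear_op_ge0 => // ? ? ?; rewrite mulr_ge0 ?powR_ge0.
  rewrite EFinM -muleA.
  apply: le_trans (lee_wpmul2l _ (HC (e1 k) (F k) (be1 k) (F0 k))); last first.
    by rewrite lee_fin ltW.
  rewrite -sumZZ ?(ltW C0)//; last by move=> i; rewrite mule_ge0 ?lee_fin ?powR_ge0.
  apply: le_sumZ => i; rewrite muleCA.
  apply: le_trans (lee_wpmul2l _ (HC (e2 k i) _ (be2 k i) (f0 k i))); last first.
    by rewrite lee_fin powR_ge0.
  rewrite -sumZZ ?powR_ge0//; last by move=> j; rewrite mule_ge0 ?f0// lee_fin powR_ge0.
  by apply: le_sumZ => j; rewrite -[(_ * _ * (a i * _))%R]mulrA -!EFinM.
rewrite lpnZ//; last 2 first.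
- by rewrite mulr_ge0// ltW.
- by move=> k; exact: lpn_ge0.
have -> : (C * C * A * B * D)%:E = (C * C)%:E * (A * B * D)%:E.
  by rewrite -EFinM; congr EFin; ring.
rewrite lee_wpmul2l ?lee_fin ?mulr_ge0 ?(ltW C0)//.
exact: lpn_conv3.
Qed.

Lemma trilinear_bounded_swap12 p W : (forall k i j, (0 <= W k i j)%R) ->
  trilinear_bounded p W -> trilinear_bounded p (fun k i j => W k j i).
Proof.
move=> W0 [C C0 HC]; exists C => // a b c A B D a0 b0 c0 A0 B0 D0 hA hB hD.
have -> : (C * A * B * D = C * B * A * D)%R by ring.
apply: le_trans (HC b a c B A D b0 a0 c0 B0 A0 D0 hB hA hD).
rewrite le_eqVlt; apply/orP; left; apply/eqP; apply: eq_lpn => k.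
rewrite /trilinear_op sumZ_swap; last by move=> i j; rewrite lee_fin !mulr_ge0.
apply: eq_esum => i _; apply: eq_esum => j _; congr EFin.
by rewrite (addrAC k); congr (_ * _)%R; rewrite mulrCA.
Qed.

Lemma trilinear_bounded_swap23 p W : (forall k i j, (0 <= W k i j)%R) ->
  trilinear_bounded p W -> trilinear_bounded p (fun k i j => W k i (k - i - j)%R).
Proof.
move=> W0 [C C0 HC]; exists C => // a b c A B D a0 b0 c0 A0 B0 D0 hA hB hD.
have -> : (C * A * B * D = C * A * D * B)%R by ring.
apply: le_trans (HC a c b A D B a0 c0 b0 A0 D0 B0 hA hD hB).
rewrite le_eqVlt; apply/orP; left; apply/eqP; apply: eq_lpn => k.
apply: eq_esum => i _.
rewrite -[RHS](sumZ_reindex _ (subl_bij (k - i)))/=.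
apply: eq_esum => j _; congr EFin; rewrite subKr; congr (_ * (_ * _))%R.
by rewrite mulrC.
Qed.

Lemma trilinear_bounded_le p W W' (t : R) : 1 <= p -> (0 <= t)%R ->
  (forall k i j, (0 <= W k i j)%R) -> (forall k i j, (0 <= W' k i j)%R) ->
  (forall k i j, (W k i j <= t * W' k i j)%R) ->
  trilinear_bounded p W' -> trilinear_bounded p W.
Proof.
move=> p1 t0 W0 W'0 WW' [C C0 HC]; exists (t * C)%R; first by rewrite mulr_ge0.
move=> a b c A B D a0 b0 c0 A0 B0 D0 hA hB hD.
rewrite -!mulrA EFinM.
apply: (@le_trans _ _ (lpn p (fun k => t%:E * trilinear_op W' a b c k))).
  apply: le_lpn => // k; first exact: trilinear_op_ge0.
  rewrite /trilinear_op -sumZZ//; last first.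
    by move=> i; apply: sumZ_ge0 => j; rewrite lee_fin !mulr_ge0.
  apply: le_sumZ => i; rewrite -sumZZ//; last by move=> j; rewrite lee_fin !mulr_ge0.
  by apply: le_sumZ => j; rewrite -EFinM lee_fin [leRHS]mulrA ler_wpM2r// !mulr_ge0.
rewrite lpnZ//; last by move=> k; exact: trilinear_op_ge0.
by rewrite lee_wpmul2l// !mulrA HC.
Qed.

Lemma trilinear_boundedD p W W' : 1 <= p ->
  (forall k i j, (0 <= W k i j)%R) -> (forall k i j, (0 <= W' k i j)%R) ->
  trilinear_bounded p W -> trilinear_bounded p W' ->
  trilinear_bounded p (fun k i j => W k i j + W' k i j)%R.
Proof.
move=> p1 W0 W'0 [C C0 HC] [C' C'0 HC']; exists (C + C')%R; first by rewrite addr_ge0.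
move=> a b c A B D a0 b0 c0 A0 B0 D0 hA hB hD.
apply: (@le_trans _ _ (lpn p (fun k => trilinear_op W a b c k + trilinear_op W' a b c k))).
  rewrite le_eqVlt; apply/orP; left; apply/eqP; apply: eq_lpn => k.
  rewrite /trilinear_op -esumD; last 2 first.
  - by move=> i _; apply: sumZ_ge0 => j; rewrite lee_fin !mulr_ge0.
  - by move=> i _; apply: sumZ_ge0 => j; rewrite lee_fin !mulr_ge0.
  apply: eq_esum => i _; rewrite -esumD; last 2 first.
  - by move=> j _; rewrite lee_fin !mulr_ge0.
  - by move=> j _; rewrite lee_fin !mulr_ge0.
  by apply: eq_esum => j _; rewrite -EFinD mulrDl.
apply: le_trans (lpnD p1 _ _) _; try by move=> k; exact: trilinear_op_ge0.
by rewrite !mulrDl EFinD leeD//; [exact: HC|exact: HC'].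
Qed.

(** On the diagonal j = -i the third argument is evaluated at [k], so the operator multiplies [c] by
    one number, which [pair_sum] bounds. *)
Lemma trilinear_bounded_diag p (mu : R) : 1 <= p -> (0 <= mu)%R ->
  (1 - 2 * recp p < mu \/ 1 / 2 <= recp p)%R ->
  trilinear_bounded p (fun k i j => (i + j == 0)%:R * q i `^ (- mu))%R.
Proof.
move=> p1 mu0 hmu; have [C C0 HC] := pair_sum p1 mu0 hmu; exists C => //.
move=> a b c A B D a0 b0 c0 A0 B0 D0 hA hB hD.
have CAB : (0 <= C * A * B)%R by rewrite !mulr_ge0.
have W0 i j : (0 <= (i + j == 0)%:R * q i `^ (- mu))%R by rewrite mulr_ge0 ?powR_ge0.
apply: (@le_trans _ _ (lpn p (fun k => (C * A * B)%:E * (c k)%:E))).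
  apply: le_lpn => // k; first exact: trilinear_op_ge0.
  have hb' : lpn p (fun j => (b (- j))%:E) <= B%:E.
    by rewrite (lpn_reindex p (fun k => (b k)%:E))//; exists (@GRing.opp int); exact: opprK.
  have := HC a (fun j => b (- j)%R) A B a0 (fun j => b0 _) A0 B0 hA hb'.
  move=> /(lee_wpmul2l (x := (c k)%:E)) h; rewrite [leRHS]muleC.
  apply: le_trans (h _); last by rewrite lee_fin.
  rewrite -sumZZ//; last by move=> j; rewrite lee_fin !mulr_ge0 ?powR_ge0.
  apply: le_sumZ => i; rewrite (esumID [set (- i)%R]%classic); last first.
    by move=> j _; rewrite lee_fin !mulr_ge0 ?powR_ge0.
  rewrite setTI esum_set1; last by rewrite lee_fin !mulr_ge0 ?powR_ge0.
  rewrite [X in _ + X]esum1 ?adde0; last first.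
    move=> j [_ /= ij]; rewrite (_ : (i + j == 0)%R = false) ?mul0r//.
    by apply/negbTE; apply: contra_notN ij; rewrite addrC addr_eq0 => /eqP ->.
  rewrite subrr eqxx mul1r opprK subrK -!EFinM lee_fin le_eqVlt.
  by apply/orP; left; apply/eqP; ring.
rewrite (lpnZ (f := fun k => (c k)%:E))// [X in _ <= X]EFinM lee_wpmul2l//.
Qed.
End Trilinear.

Local Close Scope ereal_scope.

(** * The near-resonant part of X2 *)

Section NearResonance.
Variable R : realType.
Local Notation q := (@qz R).
Local Notation kap al g := (2 + al - 3 * g).

(* The total phase [-3 (k - i)(i + j)(k - j)] of X2 is much smaller than its outer phase [-3 k i (k - i)]. *)
Definition nres (k i j : int) : bool :=
  [&& k != 0, i != 0, j != 0, k - i - j != 0, k - i != 0 &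
     (10 * `|((i + j) * (k - j))%R| < `|(k * i)%R|)%N].

(** The Fourier weights times what remains of the coefficient of X2: [q i ^ (-1)] is the factor k (k
    - i) divided by the outer phase, and the last factor is the decay in the total phase. As
    [q 0 = 1], an exactly vanishing total phase is included, without decay. *)
Definition nker (al g : R) (k i j : int) : R :=
  (nres k i j)%:R * (q k `^ al * q i `^ (- al) * q j `^ (- al) * q (k - i - j) `^ (- al)
    * q i `^ (- 1) * q ((k - i) * (i + j) * (k - j)) `^ (- (1 - 2 * g))).

(** Exchanging the last two inputs exchanges i + j with k - j, so it is enough to study |i + j| <=
    |k - j|. *)
Lemma nres_swap k i j : nres k i (k - i - j) = nres k i j.
Proof.
rewrite /nres subKr.
have -> : i + (k - i - j) = k - j by rewrite addrA subrKC.
have -> : k - (k - i - j) = i + j by rewrite !opprD !opprK !addrA subrr add0r.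
by rewrite [(k - j) * _]mulrC; do 2 congr (_ && _); rewrite andbCA.
Qed.

Lemma nker_swap al g k i j : nker al g k i (k - i - j) = nker al g k i j.
Proof.
rewrite /nker nres_swap subKr.
have -> : i + (k - i - j) = k - j by rewrite addrA subrKC.
have -> : k - (k - i - j) = i + j by rewrite !opprD !opprK !addrA subrr add0r.
rewrite (_ : (k - i) * (k - j) * (i + j) = (k - i) * (i + j) * (k - j)); last by rewrite mulrAC.
by congr (_ * (_ * _ * _)); rewrite mulrAC.
Qed.

(** The identity (i + j) + (k - j) = k + i: if |i| <= 2 |i + j|, then |k| <= 4 |k - j| and |k i| <=
    8 |i + j| |k - j|, against the factor 10 in [nres]. The same holds with i and k exchanged. *)
Lemma nres_geometry k i j : nres k i j -> (`|(i + j)%R| <= `|(k - j)%R|)%N ->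
  (2 * `|(i + j)%R| < `|i| /\ 2 * `|(i + j)%R| < `|k|)%N.
Proof.
case/and5P=> k0 i0 j0 l0 /andP[ki0]; rewrite !abszM => hres mn.
split; rewrite ltnNge; apply/negP => h.
  have hk : (`|k| <= 4 * `|(k - j)%R|)%N by clear - h mn; lia.
  have := leq_mul hk h; lia.
have hi : (`|i| <= 4 * `|(k - j)%R|)%N by clear - h mn; lia.
have := leq_mul h hi; lia.
Qed.

Lemma powR_ratio (x y s : R) : 0 < x -> 0 < y -> x <= 2 * y -> y <= 2 * x ->
  x `^ s <= 2 `^ `|s| * y `^ s.
Proof.
move=> x0 y0 xy yx; have [s0|s0] := leP 0 s.
  rewrite ger0_norm// -powRM ?(ltW y0)// ge0_ler_powR ?nnegrE ?(ltW x0)//.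
  by rewrite mulr_ge0// ltW.
rewrite ltr0_norm// -{1}[s]opprK.
apply: (@le_trans _ _ ((y / 2) `^ (- - s))).
  by rewrite powR_anti ?divr_gt0// ?oppr_ge0 ?(ltW s0)// ler_pdivrMr// mulrC.
rewrite opprK powRM ?invr_ge0 ?(ltW y0)// mulrC ler_wpM2r ?powR_ge0//.
by rewrite -powR_inv1// -powRrM mulN1r.
Qed.

Lemma qz_abs_le (i j : int) (c : nat) : (0 < c)%N -> (`|i| <= c * `|j|)%N -> q i <= c%:R * q j.
Proof. by move=> c0 h; rewrite /qz -natrM ler_nat; nia. Qed.

Lemma qzM (i j : int) : i != 0 -> j != 0 -> q (i * j) = q i * q j.
Proof. by move=> i0 j0; rewrite !qz_neq0 ?mulf_neq0// intrM normrM. Qed.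

(** By [nres_geometry] the frequencies k and k - i - j are comparable, and so are i and j; the
    Fourier weights together with [q i ^ (-1)] thus reduce to q(i)^-(1 + 2 al). On i + j = 0 nothing
    more is available; off it, the decay in the total phase produces two weights of exponent kap. *)
Lemma nker_half_le al g : 1 / 3 < g -> g <= 1 / 2 -> - (1 / 2) < al ->
  exists2 C : R, 0 <= C & forall k i j, (`|(i + j)%R| <= `|(k - j)%R|)%N ->
  nker al g k i j <= C * ((i + j == 0)%:R * q i `^ (- (1 + 2 * al))
     + (q i `^ (- kap al g) * q (i + j) `^ (- kap al g)
     + (q (k - i) `^ (- kap al g) * q (i + j) `^ (- kap al g)
     + q (k - j) `^ (- kap al g) * q (j + i) `^ (- kap al g)))).
Proof.
move=> g3 g2 al2.
pose c1 := 2 `^ `|al|; pose c2 := 2 `^ `|- al|; pose c3 : R := 2 `^ (1 - 2 * g).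
have c10 : 0 <= c1 by exact: powR_ge0.
have c20 : 0 <= c2 by exact: powR_ge0.
have c30 : 0 <= c3 by exact: powR_ge0.
have c31 : 1 <= c3 by rewrite -[leLHS](powRr0 (2 : R)) ler_powR ?ler1n//; lra.
exists (c1 * c2 * c3) => [|k i j mn]; first by rewrite !mulr_ge0.
have rhs0 : 0 <= c1 * c2 * c3 * ((i + j == 0)%:R * q i `^ (- (1 + 2 * al))
     + (q i `^ (- kap al g) * q (i + j) `^ (- kap al g)
     + (q (k - i) `^ (- kap al g) * q (i + j) `^ (- kap al g)
     + q (k - j) `^ (- kap al g) * q (j + i) `^ (- kap al g)))).
  apply: mulr_ge0; first by rewrite !mulr_ge0.
  by do 3![apply: addr_ge0; first by rewrite mulr_ge0 ?powR_ge0];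
    rewrite mulr_ge0 ?powR_ge0.
rewrite /nker; have [hr|_] := boolP (nres k i j); last by rewrite mul0r.
rewrite mul1r.
have [h1 h2] := nres_geometry hr mn.
case/and5P: hr => k0 i0 j0 l0 /andP[ki0 hres].
have [Q0 Qi Qj Ql] : [/\ 0 < q k, 0 < q i, 0 < q j & 0 < q (k - i - j)] by split; exact: qz_gt0.
set l := k - i - j in l0 Ql *.
have wk : q k `^ al <= c1 * q l `^ al.
  apply: powR_ratio => //; apply: (@qz_abs_le _ _ 2); rewrite // /l; clear -h2; lia.
have wj : q j `^ (- al) <= c2 * q i `^ (- al).
  apply: powR_ratio => //; apply: (@qz_abs_le _ _ 2); rewrite //; clear -h1; lia.
have wl : q l `^ al * q l `^ (- al) = 1 by rewrite -powR_add// subrr powRr0.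
set G := q (_ * _ * _) `^ _.
have G0 : 0 <= G by exact: powR_ge0.
have step : q k `^ al * q i `^ (- al) * q j `^ (- al) * q l `^ (- al) * q i `^ (- 1) * G
    <= c1 * c2 * (q i `^ (- (1 + 2 * al)) * G).
  have -> : q i `^ (- (1 + 2 * al)) = q i `^ (- al) * q i `^ (- al) * q i `^ (- 1).
    by rewrite -!powR_add//; congr (_ `^ _); ring.
  rewrite [leRHS](_ : _ = (c1 * q l `^ al) * q i `^ (- al) * (c2 * q i `^ (- al))
     * q l `^ (- al) * q i `^ (- 1) * G); last by rewrite -[LHS]mulr1 -wl; ring.
  by do 3![apply: ler_wpM2r; first exact: powR_ge0];
    apply: ler_pM => //; rewrite ?mulr_ge0 ?powR_ge0// ler_wpM2r ?powR_ge0.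
apply: le_trans step _; rewrite -[leRHS]mulrA ler_wpM2l ?mulr_ge0//.
have [ij0|ij0] := eqVneq (i + j) 0.
  rewrite mul1r.
  have -> : G = 1 by rewrite /G ij0 mulr0 mul0r /qz powR1.
  rewrite mulr1; apply: le_trans (ler_peMl (powR_ge0 _ _) c31) _.
  by rewrite ler_wpM2l// lerDl !addr_ge0 ?mulr_ge0 ?powR_ge0.
rewrite mul0r add0r.
have kj0 : k - j != 0 by rewrite -absz_gt0 (leq_trans _ mn)// absz_gt0.
(* A minimum is at hand because k - i and k - j cannot both be small: their difference i - j is
   close to 2 i. Its power is afterwards bounded by the sum of the three powers, one for each weight
   in the statement. *)
pose x := Num.min (q i) (Num.min (q (k - i)) (q (k - j))).
have x1 : 1 <= x by rewrite !le_min !qz_ge1.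
have x0 : 0 < x by rewrite (lt_le_trans ltr01).
have xi : x <= q i by rewrite ge_min lexx.
have xki : x <= q (k - i) by rewrite !ge_min lexx !orbT.
have xkj : x <= q (k - j) by rewrite !ge_min lexx !orbT.
have M1 : 1 <= q (i + j) by exact: qz_ge1.
have M0 : 0 < q (i + j) by exact: qz_gt0.
have Mi : q (i + j) <= q i by have := @qz_abs_le (i + j) i 1 isT; rewrite mul1r; apply; clear -h1; lia.
have prod : q i * x <= 2 * (q (k - i) * q (k - j)).
  have [hh|hh] : (`|i| <= 2 * `|(k - i)%R| \/ `|i| <= 2 * `|(k - j)%R|)%N.
    have [u|u] := leqP `|i| (2 * `|(k - i)%R|); [by left|right].
    by clear -h1 u; lia.
  - rewrite mulrA ler_pM ?(ltW x0) ?(ltW Qi)//; exact: (@qz_abs_le _ _ 2).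
  - rewrite [q (k - i) * _]mulrC mulrA ler_pM ?(ltW x0) ?(ltW Qi)//; exact: (@qz_abs_le _ _ 2).
have dl0 : 0 <= 1 - 2 * g by lra.
have GE : G <= c3 * (q i `^ (- (1 - 2 * g)) * x `^ (- (1 - 2 * g)) * q (i + j) `^ (- (1 - 2 * g))).
  rewrite /G !qzM ?mulf_neq0//.
  have -> : q (k - i) * q (i + j) * q (k - j) = (q (k - i) * q (k - j)) * q (i + j) by ring.
  rewrite powRM ?mulr_ge0 ?qz_ge0// mulrA ler_wpM2r ?powR_ge0//.
  apply: (@le_trans _ _ ((q i * x / 2) `^ (- (1 - 2 * g)))).
    by apply: powR_anti; [rewrite divr_gt0// mulr_gt0|rewrite ler_pdivrMr// [leRHS]mulrC|exact: dl0].
  rewrite !powRM ?mulr_ge0 ?invr_ge0 ?(ltW Qi) ?(ltW x0)// mulrC ler_wpM2r ?mulr_ge0 ?powR_ge0//.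
  by rewrite -powR_inv1// -powRrM mulN1r opprK.
apply: (@le_trans _ _ (c3 * (x `^ (- kap al g) * q (i + j) `^ (- kap al g)))).
  apply: le_trans (ler_wpM2l (powR_ge0 _ _) GE) _.
  rewrite mulrCA ler_wpM2l//.
  have r0 : 0 <= 1 + al - g by lra.
  (* The two equal powers of [q i] are spent on [x] and on [q (i + j)], both at most [q i]; each
     then has total exponent (1 + al - g) + (1 - 2 g) = kap. *)
  have e1 : q i `^ (- (1 + 2 * al)) * q i `^ (- (1 - 2 * g)) =
     q i `^ (- (1 + al - g)) * q i `^ (- (1 + al - g)).
    by rewrite -!powR_add//; congr (_ `^ _); ring.
  have e2 (y : R) : 0 < y -> y `^ (- kap al g) = y `^ (- (1 + al - g)) * y `^ (- (1 - 2 * g)).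
    by move=> y0; rewrite -!powR_add//; congr (_ `^ _); ring.
  rewrite !mulrA e1 !e2//.
  rewrite [leRHS](_ : _ = x `^ (- (1 + al - g)) * q (i + j) `^ (- (1 + al - g))
     * x `^ (- (1 - 2 * g)) * q (i + j) `^ (- (1 - 2 * g))); last by ring.
  rewrite ler_wpM2r ?powR_ge0// ler_wpM2r ?powR_ge0//.
  by apply: ler_pM; rewrite ?powR_ge0// powR_anti.
rewrite ler_wpM2l//.
have xle : x `^ (- kap al g) <= q i `^ (- kap al g) + (q (k - i) `^ (- kap al g) + q (k - j) `^ (- kap al g)).
  have [u1 u2 u3] : [/\ 0 <= q i `^ (- kap al g), 0 <= q (k - i) `^ (- kap al g) &
    0 <= q (k - j) `^ (- kap al g)] by split; exact: powR_ge0.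
  rewrite /x; case: (leP (q (k - i)) (q (k - j))) => _.
    by case: (leP (q i) (q (k - i))) => _; move: u1 u2 u3; clear; lra.
  by case: (leP (q i) (q (k - j))) => _; move: u1 u2 u3; clear; lra.
apply: le_trans (ler_wpM2r (powR_ge0 _ _) xle) _.
by rewrite !mulrDl [j + i]addrC.
Qed.

Lemma nker_ge0 al g k i j : 0 <= nker al g k i j.
Proof. by rewrite /nker !mulr_ge0 ?powR_ge0. Qed.

(** The dominating kernel of [nker_half_le] and its image under the exchange of the last two inputs
    together cover all frequencies. The diagonal part needs 1 + 2 al > 1 - 2/p, that is al > -1/p,
    which follows from 3 g > 1. *)
Lemma trilinear_bounded_nker (p : \bar R) al g : (1 <= p)%E -> 1 / 3 < g -> g <= 1 / 2 ->
  - (1 / 2) < al -> 3 * g - 1 - recp p < al ->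
  trilinear_bounded p (nker al g).
Proof.
move=> p1 g3 g2 al2 alp.
have r0 := recp_ge0 p1.
have kap1 : 1 - recp p < kap al g by lra.
have mu0 : 0 <= 1 + 2 * al by lra.
have mu1 : 1 - 2 * recp p < 1 + 2 * al by lra.
have [C C0 HC] := nker_half_le g3 g2 al2.
have idb : bijective (@id int) by exact: inv_bij.
have addb i : bijective (fun j : int => i + j).
  by exists (fun j => j - i) => j; rewrite ?subrKC// addrAC subrr add0r.
have T1 := trilinear_bounded_diag p1 mu0 (or_introl mu1).
have T2 := trilinear_bounded_weight p1 kap1 (e1 := fun=> id) (e2 := fun k i j => i + j)
  (fun=> idb) (fun _ i => addb i).
have T3 := trilinear_bounded_weight p1 kap1 (e1 := fun k i => k - i) (e2 := fun k i j => i + j)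
  subl_bij (fun _ i => addb i).
have W3 (k i j : int) : 0 <= q (k - i) `^ (- kap al g) * q (i + j) `^ (- kap al g).
  by rewrite mulr_ge0 ?powR_ge0.
have T4 := trilinear_bounded_swap12 W3 T3.
have W2 (k i j : int) : 0 <= q i `^ (- kap al g) * q (i + j) `^ (- kap al g).
  by rewrite mulr_ge0 ?powR_ge0.
have W4 (k i j : int) : 0 <= q (k - j) `^ (- kap al g) * q (j + i) `^ (- kap al g).
  by rewrite mulr_ge0 ?powR_ge0.
have W1 (k i j : int) : 0 <= (i + j == 0)%:R * q i `^ (- (1 + 2 * al)).
  by rewrite mulr_ge0 ?powR_ge0.
have T34 := trilinear_boundedD p1 W3 W4 T3 T4.
have T234 := trilinear_boundedD p1 W2 (fun k i j => addr_ge0 (W3 k i j) (W4 k i j)) T2 T34.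
have W234 (k i j : int) := addr_ge0 (W2 k i j) (addr_ge0 (W3 k i j) (W4 k i j)).
have T := trilinear_boundedD p1 W1 W234 T1 T234.
have W (k i j : int) := addr_ge0 (W1 k i j) (W234 k i j).
have T' := trilinear_bounded_swap23 W T.
have W' (k i j : int) := W k i (k - i - j).
have TT := trilinear_boundedD p1 W W' T T'.
have WW (k i j : int) := addr_ge0 (W k i j) (W' k i j).
apply: (trilinear_bounded_le p1 C0 (nker_ge0 al g) WW _ TT) => k i j.
have [h|h] := leqP `|(i + j)%R|%N `|(k - j)%R|%N.
  apply: le_trans (HC k i j h) _; rewrite ler_wpM2l// lerDl; exact: W'.
rewrite -nker_swap.
apply: le_trans (HC k i (k - i - j) _) _.
  have -> : i + (k - i - j) = k - j by rewrite addrA subrKC.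
  have -> : k - (k - i - j) = i + j by rewrite !opprD !opprK !addrA subrr add0r.
  exact: ltnW.
rewrite ler_wpM2l// lerDr; exact: W.
Qed.
End NearResonance.

(** * Fourier multipliers of the operators *)

Section Cabs.
Variable R : realType.
Implicit Types z w : R[i].

Lemma cabsE z : cabs z = ComplexField.Normc.normc z.
Proof. by case: z. Qed.

Lemma cabs_ge0 z : 0 <= cabs z.
Proof. exact: sqrtr_ge0. Qed.

Lemma cabsM z w : cabs (z * w) = cabs z * cabs w.
Proof. by rewrite !cabsE ComplexField.Normc.normcM. Qed.

Lemma cabsV z : cabs z^-1 = (cabs z)^-1.
Proof. by rewrite !cabsE ComplexField.Normc.normcV. Qed.

Lemma cabsD z w : cabs (z + w) <= cabs z + cabs w.
Proof. by rewrite !cabsE le_normcD. Qed.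

Lemma cabsN z : cabs (- z) = cabs z.
Proof. by rewrite !cabsE normcN. Qed.

Lemma cabs0 : cabs (0 : R[i]) = 0.
Proof. by rewrite cabsE ComplexField.Normc.normc0. Qed.

Lemma cabs_real (x : R) : cabs (x%:C)%C = `|x|.
Proof. by rewrite /cabs /= expr0n /= addr0 sqrtr_sqr. Qed.

Lemma cabs_i : cabs ('i%C : R[i]) = 1.
Proof. by rewrite /cabs /= expr0n /= add0r expr1n sqrtr1. Qed.

Lemma cabs_int (k : int) : cabs (k%:~R : R[i]) = `|k%:~R|.
Proof. by rewrite -(rmorph_int (real_complex R)) cabs_real. Qed.

Lemma cabs_nat (n : nat) : cabs (n%:R : R[i]) = n%:R.
Proof. by rewrite -(rmorph_nat (real_complex R)) cabs_real normr_nat. Qed.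

Lemma creD z w : cre (z + w) = cre z + cre w.
Proof. by case: z w => [a b] []. Qed.

Lemma cimD z w : cim (z + w) = cim z + cim w.
Proof. by case: z w => [a b] []. Qed.

Lemma creM z w : cre (z * w) = cre z * cre w - cim z * cim w.
Proof. by case: z w => [a b] []. Qed.

Lemma cimM z w : cim (z * w) = cre z * cim w + cim z * cre w.
Proof. by case: z w => [a b] []. Qed.

Lemma cre_le z : `|cre z| <= cabs z.
Proof. by rewrite -sqrtr_sqr ler_sqrt ?addr_ge0 ?sqr_ge0// lerDl sqr_ge0. Qed.

Lemma cim_le z : `|cim z| <= cabs z.
Proof. by rewrite -sqrtr_sqr ler_sqrt ?addr_ge0 ?sqr_ge0// lerDr sqr_ge0. Qed.

Lemma cplx_eq z w : cre z = cre w -> cim z = cim w -> z = w.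
Proof. by case: z w => [a b] [c d] /= -> ->. Qed.

Lemma cre_sum (I : Type) (r : seq I) (F : I -> R[i]) :
  cre (\sum_(i <- r) F i) = \sum_(i <- r) cre (F i).
Proof. by elim: r => [|i r IH]; rewrite ?(big_nil, big_cons)// creD IH. Qed.

Lemma cim_sum (I : Type) (r : seq I) (F : I -> R[i]) :
  cim (\sum_(i <- r) F i) = \sum_(i <- r) cim (F i).
Proof. by elim: r => [|i r IH]; rewrite ?(big_nil, big_cons)// cimD IH. Qed.

Lemma cabs_sum (I : Type) (r : seq I) (F : I -> R[i]) :
  cabs (\sum_(i <- r) F i) <= \sum_(i <- r) cabs (F i).
Proof.
elim: r => [|i r IH]; rewrite ?(big_nil, big_cons) ?cabs0//.
by rewrite (le_trans (cabsD _ _))// lerD2l.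
Qed.
End Cabs.

(** * Absolutely convergent sums over the integers *)

Section Zsum.
Local Open Scope classical_set_scope.
Variable R : realType.
Implicit Types (a b : int -> R).

Definition zpart (V : nmodType) (a : int -> V) (N : nat) : V :=
  \sum_(0 <= j < (2 * N).+1) a (j%:Z - N%:Z).

Lemma zpartE (V : nmodType) (a : int -> V) N :
  zpart a N = \sum_(0 <= n < N.+1) a n%:Z + \sum_(0 <= n < N) a (Negz n).
Proof.
rewrite /zpart (@big_cat_nat _ _ _ N)//=; last by lia.
rewrite addrC; congr (_ + _).
  rewrite -{1}[N]add0n big_addn; have -> : ((2 * N).+1 - N = N.+1)%N by lia.
  by apply: eq_bigr => i _; congr a; lia.
rewrite big_nat_rev /= [LHS]big_nat [RHS]big_nat; apply: eq_bigr => i /andP[_ iN].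
by congr a; lia.
Qed.

Lemma ge0_zpart_cvg a S : (forall k, 0 <= a k) ->
  (\sumZ_ k (a k)%:E = S%:E)%E -> zpart a @ \oo --> S.
Proof.
move=> a0 aS.
have a0' k : (0 <= (a k)%:E)%E by rewrite lee_fin.
have := aS; rewrite sumZ_nat// => nS.
have natcvg (u : nat -> R) L : (forall n, 0 <= u n) ->
    (\sum_(n <oo) (u n)%:E = L%:E)%E -> (fun n => \sum_(0 <= i < n) u i) @ \oo --> L.
  move=> u0 uL.
  have c : cvgn (fun n => (\sum_(0 <= i < n) (u i)%:E)%E).
    by apply: is_cvg_nneseries => n _ _; rewrite lee_fin.
  have c' : (fun n => (\sum_(0 <= i < n) (u i)%:E)%E) @ \oo --> L%:E by rewrite -uL.
  rewrite (_ : (fun n => \sum_(0 <= i < n) u i) =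
      fine \o (fun n => (\sum_(0 <= i < n) (u i)%:E)%E)); first exact: fine_cvg.
  by apply/funext => n /=; rewrite sumEFin.
have fin (u : nat -> R) : (forall n, 0 <= u n) -> (\sum_(n <oo) (u n)%:E <= S%:E)%E ->
   (\sum_(n <oo) (u n)%:E = (fine (\sum_(n <oo) (u n)%:E))%:E)%E.
  move=> u0 uS; rewrite fineK// ge0_fin_numE; first by rewrite (le_lt_trans uS)// ltry.
  by apply: nneseries_ge0 => n _ _; rewrite lee_fin.
have p1 : (0 <= \sum_(n <oo) (a n%:Z)%:E)%E.
  by apply: nneseries_ge0 => n _ _; rewrite lee_fin.
have p2 : (0 <= \sum_(n <oo) (a (Negz n))%:E)%E.
  by apply: nneseries_ge0 => n _ _; rewrite lee_fin.
have e1 := fin (fun n => a n%:Z) (fun n => a0 _) _.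
have {}e1 := e1 ltac:(rewrite -nS leeDl//).
have e2 := fin (fun n => a (Negz n)) (fun n => a0 _) _.
have {}e2 := e2 ltac:(rewrite -nS leeDr//).
have c1 := natcvg _ _ (fun n => a0 n%:Z) e1.
have c2 := natcvg _ _ (fun n => a0 (Negz n)) e2.
have -> : S = fine (\sum_(n <oo) (a n%:Z)%:E)%E + fine (\sum_(n <oo) (a (Negz n))%:E)%E.
  by apply: EFin_inj; rewrite EFinD -e1 -e2 nS.
rewrite (_ : zpart a = fun N => \sum_(0 <= n < N.+1) a n%:Z + \sum_(0 <= n < N) a (Negz n)).
  apply: cvgD; last exact: c2.
  by have := c1; rewrite -(cvg_shiftS (fun n => \sum_(0 <= i < n) a i%:Z)).
by apply/funext => N; rewrite zpartE.
Qed.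

(** The value of an absolutely convergent sum expressed through unordered sums of positive and
    negative parts. Unlike the limit of symmetric partial sums, it is visibly invariant under
    bijections of the index. *)
Definition zsum_val a : R :=
  fine (\sumZ_ k (Num.max (a k) 0)%:E)%E - fine (\sumZ_ k (Num.max (- a k) 0)%:E)%E.

Lemma zpart_cvg a : (\sumZ_ k `|a k|%:E < +oo)%E -> zpart a @ \oo --> zsum_val a.
Proof.
move=> afin.
have pos0 b k : 0 <= Num.max (b k) 0 :> R by rewrite le_max lexx orbT.
have fin b : (forall k, Num.max (b k) 0 <= `|a k|) ->
    (\sumZ_ k (Num.max (b k) 0)%:E = (fine (\sumZ_ k (Num.max (b k) 0)%:E))%:E)%E.
  move=> ba; rewrite fineK// ge0_fin_numE; last by apply: sumZ_ge0 => k; rewrite lee_fin.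
  by apply: le_lt_trans afin; apply: le_sumZ => k; rewrite lee_fin.
have f1 := fin a (fun k => _).
have {}f1 := f1 ltac:(move=> k; rewrite ge_max ler_norm normr_ge0//).
have f2 := fin (fun k => - a k) (fun k => _).
have {}f2 := f2 ltac:(move=> k; rewrite ge_max -normrN ler_norm normr_ge0//).
have c1 := ge0_zpart_cvg (pos0 a) f1.
have c2 := ge0_zpart_cvg (pos0 (fun k => - a k)) f2.
rewrite (_ : zpart a = fun N => zpart (fun k => Num.max (a k) 0) N
    - zpart (fun k => Num.max (- a k) 0) N); first exact: cvgB.
apply/funext => N; rewrite /zpart -sumrB; apply: eq_bigr => j _.
by case: (leP 0 (a (j%:Z - N%:Z))) => h; rewrite /Num.max; case: ltP; case: ltP; lra.
Qed.

Lemma zsum_valE a : (\sumZ_ k `|a k|%:E < +oo)%E -> limn (zpart a) = zsum_val a.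
Proof. by move=> /zpart_cvg; apply: cvg_lim. Qed.

Implicit Types f g : int -> R[i].

Definition zsummable f := (\sumZ_ k (cabs (f k))%:E < +oo)%E.

Lemma zsummable_re f : zsummable f -> (\sumZ_ k `|cre (f k)|%:E < +oo)%E.
Proof. by apply: le_lt_trans; apply: le_sumZ => k; rewrite lee_fin cre_le. Qed.

Lemma zsummable_im f : zsummable f -> (\sumZ_ k `|cim (f k)|%:E < +oo)%E.
Proof. by apply: le_lt_trans; apply: le_sumZ => k; rewrite lee_fin cim_le. Qed.

Lemma cre_zsum f : cre (zsum f) = limn (zpart (fun k => cre (f k))).
Proof. by []. Qed.

Lemma cim_zsum f : cim (zsum f) = limn (zpart (fun k => cim (f k))).
Proof. by []. Qed.

Lemma zsumD f g : zsummable f -> zsummable g ->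
  zsum (fun k => f k + g k) = zsum f + zsum g.
Proof.
move=> hf hg; apply: cplx_eq.
  rewrite creD !cre_zsum.
  have cf := zpart_cvg (zsummable_re hf); have cg := zpart_cvg (zsummable_re hg).
  rewrite (cvg_lim _ cf)// (cvg_lim _ cg)//; apply: cvg_lim => //.
  rewrite (_ : zpart _ = fun N => zpart (fun k => cre (f k)) N + zpart (fun k => cre (g k)) N).
    exact: cvgD.
  apply/funext => N; rewrite /zpart -big_split; apply: eq_bigr => j _; exact: creD.
rewrite cimD !cim_zsum.
have cf := zpart_cvg (zsummable_im hf); have cg := zpart_cvg (zsummable_im hg).
rewrite (cvg_lim _ cf)// (cvg_lim _ cg)//; apply: cvg_lim => //.
rewrite (_ : zpart _ = fun N => zpart (fun k => cim (f k)) N + zpart (fun k => cim (g k)) N).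
  exact: cvgD.
apply/funext => N; rewrite /zpart -big_split; apply: eq_bigr => j _; exact: cimD.
Qed.

Lemma zsumZ (c : R[i]) f : zsummable f -> zsum (fun k => c * f k) = c * zsum f.
Proof.
move=> hf; have cf := zpart_cvg (zsummable_re hf); have ci := zpart_cvg (zsummable_im hf).
apply: cplx_eq.
  rewrite creM !cre_zsum cim_zsum (cvg_lim _ cf)// (cvg_lim _ ci)//.
  apply: cvg_lim => //.
  rewrite (_ : zpart _ = fun N => cre c * zpart (fun k => cre (f k)) N
     - cim c * zpart (fun k => cim (f k)) N).
    by apply: cvgB; apply: cvgMr.
  apply/funext => N; rewrite /zpart !mulr_sumr -sumrB; apply: eq_bigr => j _; exact: creM.
rewrite cimM !cim_zsum cre_zsum (cvg_lim _ cf)// (cvg_lim _ ci)//.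
apply: cvg_lim => //.
rewrite (_ : zpart _ = fun N => cre c * zpart (fun k => cim (f k)) N
     + cim c * zpart (fun k => cre (f k)) N).
  by apply: cvgD; apply: cvgMr.
apply/funext => N; rewrite /zpart !mulr_sumr -big_split; apply: eq_bigr => j _; exact: cimM.
Qed.

Lemma zsum_val_reindex a (e : int -> int) : bijective e ->
  zsum_val (fun k => a (e k)) = zsum_val a.
Proof.
move=> be; rewrite /zsum_val.
rewrite (sumZ_reindex (fun k => (Num.max (a k) 0)%:E) be).
by rewrite (sumZ_reindex (fun k => (Num.max (- a k) 0)%:E) be).
Qed.

Lemma zsummable_reindex f (e : int -> int) : bijective e ->
  zsummable f -> zsummable (fun k => f (e k)).
Proof.
by move=> be; rewrite /zsummable (sumZ_reindex (fun k => (cabs (f k))%:E) be).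
Qed.

Lemma zsum_reindex f (e : int -> int) : bijective e -> zsummable f ->
  zsum (fun k => f (e k)) = zsum f.
Proof.
move=> be hf; have he := zsummable_reindex be hf; apply: cplx_eq.
  rewrite !cre_zsum !zsum_valE; [|exact: zsummable_re|exact: (zsummable_re he)].
  exact: (zsum_val_reindex (fun k => cre (f k))).
rewrite !cim_zsum !zsum_valE; [|exact: zsummable_im|exact: (zsummable_im he)].
exact: (zsum_val_reindex (fun k => cim (f k))).
Qed.

(** An infinite right-hand side makes the bound trivial, so no summability has to be known
    beforehand. Otherwise the squared modulus of the partial sums passes to the limit. *)
Lemma cabs_zsum_le f : ((cabs (zsum f))%:E <= \sumZ_ k (cabs (f k))%:E)%E.
Proof.
have c0 k : 0 <= cabs (f k) by exact: cabs_ge0.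
have [hf|] := boolP (\sumZ_ k (cabs (f k))%:E < +oo)%E; last first.
  by rewrite -leNgt leye_eq => /eqP ->; rewrite leey.
have cf := zpart_cvg (zsummable_re hf); have ci := zpart_cvg (zsummable_im hf).
have SE : (\sumZ_ k (cabs (f k))%:E = (fine (\sumZ_ k (cabs (f k))%:E))%:E)%E.
  by rewrite fineK// ge0_fin_numE//; apply: sumZ_ge0 => k; rewrite lee_fin.
set S := fine _ in SE.
have S0 : 0 <= S by rewrite fine_ge0//; apply: sumZ_ge0 => k; rewrite lee_fin.
have cS := ge0_zpart_cvg c0 SE.
rewrite SE lee_fin.
have part N : cabs (zpart f N) <= S.
  apply: (@le_trans _ _ (zpart (fun k => cabs (f k)) N)); first exact: cabs_sum.
  rewrite -lee_fin -SE /zpart -sumEFin.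
  rewrite -(big_map (fun j : nat => j%:Z - N%:Z) xpredT (fun k => (cabs (f k))%:E)).
  apply: esum_ge.
  exists [set` (map (fun j : nat => j%:Z - N%:Z) (index_iota 0 (2 * N).+1))]%classic.
    by split => //; exact: finite_seq.
  rewrite -fsbig_seq// map_inj_uniq ?iota_uniq// => x y /addIr [].
  by [].
have sq : cre (zsum f) ^+ 2 + cim (zsum f) ^+ 2 <= S ^+ 2.
  rewrite cre_zsum cim_zsum (cvg_lim _ cf)// (cvg_lim _ ci)//.
  have c : (fun N => cre (zpart f N) ^+ 2 + cim (zpart f N) ^+ 2) @ \oo -->
      zsum_val (fun k => cre (f k)) ^+ 2 + zsum_val (fun k => cim (f k)) ^+ 2.
    under eq_fun do rewrite /zpart cre_sum cim_sum !expr2.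
    by rewrite !expr2; apply: cvgD; apply: cvgM.
  rewrite -(cvg_lim _ c)//; apply: limr_le; first by apply/cvg_ex; eexists; exact: c.
  apply: nearW => N; have := part N; rewrite /cabs => h.
  rewrite -(sqr_sqrtr (_ : 0 <= cre (zpart f N) ^+ 2 + cim (zpart f N) ^+ 2)); last first.
    by rewrite addr_ge0 ?sqr_ge0.
  by rewrite ler_pXn2r ?nnegrE ?sqrtr_ge0.
by rewrite /cabs -[leRHS](ger0_norm S0) -sqrtr_sqr ler_sqrt// sqr_ge0.
Qed.
End Zsum.

(** * Oscillatory integrals in time *)

Section Oscillation.
Variable R : realType.
Implicit Types (x y s t a b : R).

Lemma sin_le x : `|sin x| <= `|x|.
Proof.
wlog x0 : x / 0 <= x.
  move=> h; have [x0|x0] := leP 0 x; first exact: h.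
  by rewrite -normrN -sinN -[in leRHS]normrN h// oppr_ge0 ltW.
have [c _] := @MVT_segment R sin cos 0 x x0 (fun y _ => is_derive_sin y)
  (continuous_subspaceT (@continuous_sin R)).
rewrite sin0 !subr0 => ->; rewrite normrM ler_piMl//.
by rewrite ler_norml cos_geN1 cos_le1.
Qed.

Lemma cabs_Cexpi x : cabs (Cexpi x) = 1.
Proof. by rewrite /cabs /= cos2Dsin2 sqrtr1. Qed.

Lemma CexpiD x y : Cexpi (x + y) = Cexpi x * Cexpi y.
Proof. by apply: cplx_eq; rewrite ?creM ?cimM /= ?cosD ?sinD// addrC [sin x * _]mulrC. Qed.

Lemma Cexpi_dist x y : cabs (Cexpi x - Cexpi y) <= `|x - y|.
Proof.
pose c := (x + y) / 2; pose d := (x - y) / 2.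
have xE : x = c + d by rewrite /c /d; field.
have yE : y = c - d by rewrite /c /d; field.
have -> : x - y = 2 * d by rewrite /d; field.
rewrite {1}xE {1}yE /cabs /= !cosD !sinD cosN sinN.
have -> : (cos c * cos d - sin c * sin d - (cos c * cos d - sin c * - sin d)) ^+ 2 +
    (sin c * cos d + cos c * sin d - (sin c * cos d + cos c * - sin d)) ^+ 2
    = (2 * sin d) ^+ 2 * (cos c ^+ 2 + sin c ^+ 2) by ring.
by clearbody d; rewrite cos2Dsin2 mulr1 sqrtr_sqr !normrM ler_wpM2l ?sin_le.
Qed.

(** Interpolation between the trivial bound 2 and the Lipschitz bound |x - y|. *)
Lemma Cexpi_holder x y th : 0 <= th -> th <= 1 ->
  cabs (Cexpi x - Cexpi y) <= 2 * `|x - y| `^ th.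
Proof.
move=> th0 th1; have [xy|xy] := leP `|x - y| 1; last first.
  apply: (@le_trans _ _ 2).
    by rewrite (le_trans (cabsD _ _))// cabsN !cabs_Cexpi.
  by rewrite ler_peMr// -[leLHS](powRr0 `|x - y|) ler_powR// ltW.
apply: le_trans (Cexpi_dist x y) _.
have [->|d0] := eqVneq `|x - y| 0; first by rewrite mulr_ge0 ?powR_ge0.
have d1 : 0 < `|x - y| <= 1 by rewrite lt_neqAle eq_sym d0 normr_ge0.
apply: le_trans (ger1_powR d1 th1) _; rewrite ler_peMl ?powR_ge0//.
by rewrite ler1n.
Qed.

Definition cderiv (F f : R -> R[i]) : Prop :=
  forall x, is_derive x 1 (fun y => cre (F y)) (cre (f x)) /\
            is_derive x 1 (fun y => cim (F y)) (cim (f x)).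

Lemma is_derive_ext (f g : R -> R) (x df dg : R) : is_derive x 1 f df ->
  (forall y, f y = g y) -> df = dg -> is_derive x 1 g dg.
Proof. by move=> h /funext <- <-. Qed.

Lemma is_derive_scale (f : R -> R) (df c x : R) : is_derive x 1 f df ->
  is_derive x 1 (fun y => c * f y) (c * df).
Proof. by move=> h; exact: (@is_deriveZ R R R f c x 1 df h). Qed.

Lemma cderivD F G f g : cderiv F f -> cderiv G g ->
  cderiv (fun x => F x + G x) (fun x => f x + g x).
Proof.
move=> hF hG x; have [F1 F2] := hF x; have [G1 G2] := hG x; split.
  by apply: is_derive_ext (is_deriveD F1 G1) _ _ => [y|]; rewrite creD.
by apply: is_derive_ext (is_deriveD F2 G2) _ _ => [y|]; rewrite cimD.
Qed.

Lemma cderivZ (c : R[i]) F f : cderiv F f -> cderiv (fun x => c * F x) (fun x => c * f x).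
Proof.
move=> hF x; have [F1 F2] := hF x; split.
  apply: is_derive_ext (is_deriveB (is_derive_scale (cre c) F1) (is_derive_scale (cim c) F2)) _ _.
    by move=> y; rewrite creM.
  by rewrite creM.
apply: is_derive_ext (is_deriveD (is_derive_scale (cre c) F2) (is_derive_scale (cim c) F1)) _ _.
  by move=> y; rewrite cimM.
by rewrite cimM.
Qed.

Lemma cderiv_cst (c : R[i]) : cderiv (fun=> c) (fun=> 0).
Proof. by move=> x; split; exact: is_derive_cst. Qed.

Definition Eint (A x : R) : R[i] :=
  if A == 0 then (x%:C)%C else Cexpi (A * x) / ('i * A%:C)%C.

Lemma Eint_neq0 (A x : R) : A != 0 -> Eint A x = (sin (A * x) / A +i* (- (cos (A * x) / A)))%C.
Proof.
move=> A0; rewrite /Eint (negbTE A0).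
have -> : ('i * A%:C)%C^-1 = (- 'i * (A^-1)%:C)%C :> R[i].
  by rewrite invfM invCi -(fmorphV (real_complex R)).
by apply: cplx_eq; rewrite ?creM ?cimM /=; ring.
Qed.

Lemma cderiv_Eint (A : R) : cderiv (Eint A) (fun x => Cexpi (A * x)).
Proof.
have [->|A0] := eqVneq A 0.
  move=> x; rewrite mul0r /= cos0 sin0 /Eint eqxx /=; split; first exact: is_derive_id.
  exact: is_derive_cst.
have lin x : is_derive x 1 (fun y => A * y) A.
  by have := is_derive_scale A (is_derive_id x 1); rewrite mulr1.
have -> : Eint A = fun x => (sin (A * x) / A +i* (- (cos (A * x) / A)))%C.
  by apply/funext => x; rewrite Eint_neq0.
move=> x /=; split.
  apply: is_derive_ext (is_derive_scale A^-1 (is_derive1_comp (is_derive_sin (A * x)) (lin x))) _ _.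
    by move=> y /=; rewrite mulrC.
  by rewrite mulrCA mulVf// mulr1.
apply: is_derive_ext (is_derive_scale (- A^-1) (is_derive1_comp (is_derive_cos (A * x)) (lin x))) _ _.
  by move=> y /=; rewrite mulNr mulrC.
by rewrite mulNr mulrCA mulVf// mulr1 opprK.
Qed.

Lemma is_derive_continuous (f df : R -> R) : (forall x, is_derive x 1 f (df x)) ->
  continuous f.
Proof.
move=> h x; apply: differentiable_continuous; apply/derivable1_diffP.
exact: ex_derive.
Qed.

Lemma cderiv_continuous F f : cderiv F f ->
  continuous (fun y => cre (F y)) /\ continuous (fun y => cim (F y)).
Proof.
move=> h; split.
  exact: (is_derive_continuous (fun x => (h x).1)).
exact: (is_derive_continuous (fun x => (h x).2)).
Qed.

Lemma Rintegral_FTC (F f : R -> R) s t : s <= t ->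
  (forall x, is_derive x 1 F (f x)) -> continuous f ->
  Rintegral (@lebesgue_measure R) `[s, t]%classic f = F t - F s.
Proof.
move=> st hF cf; have [->|st'] := eqVneq s t.
  by rewrite set_itv1 Rintegral_set1 subrr.
have {st'} st : s < t by rewrite lt_neqAle st' st.
have cF := is_derive_continuous hF.
rewrite /Rintegral (continuous_FTC2 (F := F) st)//.
- exact: continuous_subspaceT.
- split.
  + by move=> x _; exact: ex_derive.
  + exact: (cvg_at_right_filter (cF s)).
  + exact: (cvg_at_left_filter (cF t)).
- by move=> x _; rewrite derive1E; apply: derive_val.
Qed.

(** The derivative [g] of the integrand provides its continuity. *)
Lemma cint_FTC (F f g : R -> R[i]) s t : s <= t -> cderiv F f -> cderiv f g ->
  cint s t f = F t - F s.
Proof.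
move=> st hF hf; have [c1 c2] := cderiv_continuous hf; rewrite /cint.
rewrite (Rintegral_FTC st (fun x => (hF x).1) c1) (Rintegral_FTC st (fun x => (hF x).2) c2).
by case: (F t) (F s) => [a b] [c d].
Qed.

Lemma cderiv_Cexpi (A : R) : cderiv (fun x => Cexpi (A * x)) (fun x => 'i%C * A%:C%C * Cexpi (A * x)).
Proof.
have [->|A0] := eqVneq A 0.
  have -> : (fun x : R => Cexpi (0 * x)) = fun=> Cexpi 0 :> R[i].
    by apply/funext => x; rewrite mul0r.
  have -> : (fun x : R => 'i%C * 0%:C%C * Cexpi (0 * x)) = fun=> 0 :> R[i].
    by apply/funext => x; rewrite mulr0 mul0r.
  exact: cderiv_cst.
have := cderivZ ('i%C * A%:C%C) (cderiv_Eint A).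
rewrite (_ : (fun x => _ * Eint A x) = fun x => Cexpi (A * x))//.
apply/funext => x; rewrite /Eint (negbTE A0) mulrC divfK//.
by rewrite mulf_neq0// ?neq0Ci// (fmorph_eq0 (real_complex R)).
Qed.

Lemma cint_Cexpi (A s t : R) : s <= t ->
  cint s t (fun x => Cexpi (A * x)) = Eint A t - Eint A s.
Proof. by move=> st; rewrite (cint_FTC st (cderiv_Eint A) (cderiv_Cexpi A)). Qed.

(* The integral over s <= y <= x <= t of e^(iAx) e^(iBy), for B != 0. *)
Definition Jint (A B s t : R) : R[i] :=
  (Eint (A + B) t - Eint (A + B) s - Cexpi (B * s) * (Eint A t - Eint A s))
    / ('i * B%:C)%C.

Lemma cint_ext (f g : R -> R[i]) s t : (forall x, s <= x -> x <= t -> f x = g x) ->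
  cint s t f = cint s t g.
Proof.
move=> fg; rewrite /cint; congr (_ +i* _)%C; apply: eq_Rintegral => x;
  by rewrite inE /= in_itv /= => /andP[h1 h2]; rewrite fg.
Qed.

Lemma cint_double (A B s t : R) : s <= t -> B != 0 ->
  cint s t (fun x => Cexpi (A * x) * cint s x (fun y => Cexpi (B * y))) = Jint A B s t.
Proof.
move=> st B0.
pose c : R[i] := ('i * B%:C)%C^-1.
pose d : R[i] := - (c * Cexpi (B * s)).
pose f x := c * Cexpi ((A + B) * x) + d * Cexpi (A * x).
rewrite (@cint_ext _ f); last first.
  move=> x sx _; rewrite cint_Cexpi// /Eint (negbTE B0) -/c /f /d mulrDl CexpiD.
  by rewrite -mulrBl; ring.
have hF := cderivD (cderivZ c (cderiv_Eint (A + B))) (cderivZ d (cderiv_Eint A)).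
have hf := cderivD (cderivZ c (cderiv_Cexpi (A + B))) (cderivZ d (cderiv_Cexpi A)).
rewrite (cint_FTC st hF hf) /Jint -/c /d; ring.
Qed.

Lemma EintB (A s t : R) : A != 0 ->
  Eint A t - Eint A s = (Cexpi (A * t) - Cexpi (A * s)) / ('i * A%:C)%C.
Proof. by move=> A0; rewrite /Eint (negbTE A0) mulrBl. Qed.

(** The triangle s <= y <= x <= t consists of the triangles over [s,u] and [u,t] and the rectangle
    with y in [s,u] and x in [u,t]. *)
Lemma Jint_chen (A B s u t : R) : B != 0 ->
  Jint A B s t - Jint A B s u - Jint A B u t =
  (Eint A t - Eint A u) * (Eint B u - Eint B s).
Proof. by move=> B0; rewrite /Jint (EintB s u B0); ring. Qed.

Lemma Eint_le (A s t : R) : s <= t -> cabs (Eint A t - Eint A s) <= t - s.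
Proof.
move=> st; rewrite /Eint; have [A0|A0] := eqVneq A 0.
  have -> : (t%:C - s%:C)%C = ((t - s)%:C)%C :> R[i] by rewrite rmorphB.
  by rewrite cabs_real ger0_norm// subr_ge0.
rewrite -mulrBl cabsM cabsV cabsM cabs_i mul1r cabs_real ler_pdivrMr ?normr_gt0//.
apply: le_trans (Cexpi_dist _ _) _.
by rewrite -mulrBr normrM mulrC ger0_norm// subr_ge0.
Qed.

Lemma Eint_holder (A s t th : R) : s <= t -> A != 0 -> 0 <= th -> th <= 1 ->
  cabs (Eint A t - Eint A s) <= 2 * (t - s) `^ th * `|A| `^ (th - 1).
Proof.
move=> st A0 th0 th1; rewrite /Eint (negbTE A0).
have nA : 0 < `|A| by rewrite normr_gt0.
rewrite -mulrBl cabsM cabsV cabsM cabs_i mul1r cabs_real ler_pdivrMr//.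
apply: le_trans (Cexpi_holder _ _ th0 th1) _.
rewrite -mulrBr normrM (ger0_norm (_ : 0 <= t - s)) ?subr_ge0// powRM ?subr_ge0//.
rewrite -!mulrA ler_wpM2l// mulrC ler_wpM2l ?powR_ge0//.
have -> : `|A| `^ th = `|A| `^ (th - 1) * `|A| `^ 1.
  rewrite -powRD ?subrK//; apply/implyP => _; exact: lt0r_neq0.
by rewrite powRr1.
Qed.

Lemma Jint_le1 (A B s t : R) :
  cabs (Jint A B s t) <= `|B|^-1 *
    (cabs (Eint (A + B) t - Eint (A + B) s) + cabs (Eint A t - Eint A s)).
Proof.
rewrite /Jint cabsM cabsV cabsM cabs_i mul1r cabs_real mulrC.
rewrite ler_wpM2l ?invr_ge0// (le_trans (cabsD _ _))// lerD2l cabsN.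
by rewrite cabsM cabs_Cexpi mul1r.
Qed.

Lemma iR_neq0 (A : R) : A != 0 -> ('i * A%:C)%C != 0 :> R[i].
Proof. by move=> A0; rewrite mulf_neq0// ?neq0Ci// (fmorph_eq0 (real_complex R)). Qed.

(** Integrating first in the outer variable x gains 1/|A|, where [Jint_le1], which integrates first
    in y, gains 1/|B|. Having both allows division by the larger phase. *)
Lemma Jint_le2 (A B s t : R) : A != 0 -> B != 0 -> A + B != 0 ->
  cabs (Jint A B s t) <= `|A|^-1 *
    (cabs (Eint B t - Eint B s) + cabs (Eint (A + B) t - Eint (A + B) s)).
Proof.
move=> A0 B0 D0.
have -> : Jint A B s t = (Cexpi (A * t) * (Eint B t - Eint B s)
   - (Eint (A + B) t - Eint (A + B) s)) / ('i * A%:C)%C.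
  rewrite /Jint !EintB//.
  have a0 := iR_neq0 A0; have b0 := iR_neq0 B0; have d0 := iR_neq0 D0.
  rewrite !mulrDl !CexpiD.
  have dE : ('i * (A + B)%:C)%C = ('i * A%:C)%C + ('i * B%:C)%C :> R[i].
    by rewrite rmorphD mulrDr.
  rewrite dE in d0 *.
  move: ('i * A%:C)%C ('i * B%:C)%C a0 b0 d0 => a b a0 b0 d0.
  by field; rewrite a0 b0 d0.
rewrite cabsM cabsV cabsM cabs_i mul1r cabs_real mulrC.
rewrite ler_wpM2l ?invr_ge0// (le_trans (cabsD _ _))// cabsN lerD2r.
by rewrite cabsM cabs_Cexpi mul1r.
Qed.
End Oscillation.

(** * Size of the time integrals in X and X2 *)

Section CoefficientBounds.
Variable R : realType.
Local Notation q := (@qz R).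

Lemma powR_balance (a b g : R) : 0 < b -> b <= a -> 0 <= g ->
  a^-1 * b `^ (2 * g - 1) <= a `^ (g - 1) * b `^ (g - 1).
Proof.
move=> b0 ba g0; have a0 : 0 < a by exact: lt_le_trans ba.
rewrite -[a^-1]powR_inv1 ?(ltW a0)//.
have -> : a `^ (g - 1) = a `^ (-1) * a `^ g by rewrite -powR_add//; congr (_ `^ _); ring.
have -> : b `^ (2 * g - 1) = b `^ g * b `^ (g - 1).
  by rewrite -powR_add//; congr (_ `^ _); ring.
rewrite -[leRHS]mulrA ler_wpM2l ?powR_ge0// ler_wpM2r ?powR_ge0//.
by rewrite ge0_ler_powR ?nnegrE ?(ltW a0) ?(ltW b0).
Qed.

Lemma powR_anti10 (x y g : R) : 0 < x -> x <= 10 * y -> 0 <= 2 * g -> 2 * g <= 1 ->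
  y `^ (2 * g - 1) <= 10 * x `^ (2 * g - 1).
Proof.
move=> x0 xy g0 g1.
have y0 : 0 < y by clear -x0 xy; lra.
apply: (@le_trans _ _ ((x / 10) `^ (2 * g - 1))).
  rewrite -[2 * g - 1]opprK; apply: powR_anti; [by rewrite divr_gt0|by rewrite ler_pdivrMr// mulrC|].
  by rewrite oppr_ge0 subr_le0.
rewrite powRM ?invr_ge0 ?(ltW x0)// mulrC ler_wpM2r ?powR_ge0//.
rewrite -powR_inv1// -powRrM mulN1r opprB.
rewrite -[leRHS](powRr1 (_ : 0 <= 10))// ler_powR ?ler1n//.
by rewrite lerBlDr lerDl.
Qed.

(** Divide by the larger of the two phases and bound the remaining single integrals with Hölder
    exponent 2 g; the smaller phase is at most ten times the total one. The constant 22 = 2 + 2 * 10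
    adds the two integrals, and [powR_balance] shares the decay evenly between the phases. *)
Lemma Jint_nonres (A B s t g : R) : s <= t -> A != 0 -> B != 0 -> 0 <= g -> g <= 1 / 2 ->
  `|A| <= 10 * `|A + B| ->
  cabs (Jint A B s t) <= 22 * (t - s) `^ (2 * g) * (`|A| `^ (g - 1) * `|B| `^ (g - 1)).
Proof.
move=> st A0 B0 g0 g2 hD.
have a0 : 0 < `|A| by rewrite normr_gt0.
have b0 : 0 < `|B| by rewrite normr_gt0.
have D0 : A + B != 0 by rewrite -normr_gt0; clear -a0 hD; lra.
have th0 : 0 <= 2 * g by clear -g0; lra.
have th1 : 2 * g <= 1 by clear -g2; lra.
have hA := Eint_holder st A0 th0 th1.
have hB := Eint_holder st B0 th0 th1.
have hAB := Eint_holder st D0 th0 th1.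
have tau0 : 0 <= (t - s) `^ (2 * g) by exact: powR_ge0.
set tau := (t - s) `^ (2 * g) in hA hB hAB tau0 *.
have fin x y : 0 < x -> x <= y -> x <= 10 * `|A + B| ->
   y^-1 * (2 * tau * x `^ (2 * g - 1) + 2 * tau * `|A + B| `^ (2 * g - 1))
   <= 22 * tau * (y `^ (g - 1) * x `^ (g - 1)).
  move=> x0 xy xd; have y0 : 0 < y by exact: lt_le_trans xy.
  have := powR_anti10 x0 xd th0 th1; set u := x `^ (2 * g - 1) => hu.
  apply: (@le_trans _ _ (22 * tau * (y^-1 * u))).
    rewrite [leRHS]mulrCA ler_wpM2l ?invr_ge0 ?(ltW y0)//.
    have : 2 * tau * `|A + B| `^ (2 * g - 1) <= 2 * tau * (10 * u) by rewrite ler_wpM2l// mulr_ge0.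
    clear; lra.
  by rewrite ler_wpM2l ?mulr_ge0// powR_balance.
have [ba|/ltW ab] := leP `|B| `|A|.
  apply: le_trans (Jint_le2 s t A0 B0 D0) _.
  apply: le_trans (fin _ _ b0 ba (le_trans ba hD)).
  by rewrite ler_wpM2l ?invr_ge0// lerD.
apply: le_trans (Jint_le1 A B s t) _; rewrite [`|A| `^ _ * _]mulrC.
apply: le_trans (fin _ _ a0 ab hD); rewrite ler_wpM2l ?invr_ge0// addrC.
exact: lerD.
Qed.

(** A small total phase makes |A| and |B| comparable, so the term with phase A is bounded as a
    product. The term with the total phase is kept as it is, because that phase may vanish. *)
Lemma Jint_res (A B s t g : R) : s <= t -> A != 0 -> B != 0 -> 0 <= g -> g <= 1 / 2 ->
  10 * `|A + B| < `|A| ->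
  cabs (Jint A B s t) <= 4 * (t - s) `^ (2 * g) * (`|A| `^ (g - 1) * `|B| `^ (g - 1))
    + 2 * `|A|^-1 * cabs (Eint (A + B) t - Eint (A + B) s).
Proof.
move=> st A0 B0 g0 g2 hD.
have a0 : 0 < `|A| by rewrite normr_gt0.
have b0 : 0 < `|B| by rewrite normr_gt0.
have th0 : 0 <= 2 * g by clear -g0; lra.
have th1 : 2 * g <= 1 by clear -g2; lra.
have hA := Eint_holder st A0 th0 th1.
have tau0 : 0 <= (t - s) `^ (2 * g) by exact: powR_ge0.
set tau := (t - s) `^ (2 * g) in hA tau0 *.
have ab : `|A| <= 2 * `|B|.
  have := ler_normB (A + B) B; rewrite addrK; clear -hD a0; lra.
have ab1 : `|B|^-1 <= 2 * `|A|^-1.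
  by rewrite -[2 * _]invrK invfM invrK lef_pV2 ?posrE ?mulr_gt0// ?invr_gt0// mulrC ler_pdivrMr// mulrC.
apply: le_trans (Jint_le1 A B s t) _; rewrite mulrDr addrC lerD//; last first.
  by rewrite ler_wpM2r ?cabs_ge0.
apply: le_trans (ler_wpM2l (_ : 0 <= `|B|^-1) hA) _; first by rewrite invr_ge0.
have -> : 4 * tau * (`|A| `^ (g - 1) * `|B| `^ (g - 1)) =
   2 * tau * (2 * (`|B| `^ (g - 1) * `|A| `^ (g - 1))) by ring.
rewrite mulrCA ler_wpM2l ?mulr_ge0//.
rewrite -[`|B|^-1]powR_inv1 ?(ltW b0)//.
have -> : `|A| `^ (2 * g - 1) = `|A| `^ g * `|A| `^ (g - 1).
  by rewrite -powR_add//; congr (_ `^ _); ring.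
have -> : `|B| `^ (g - 1) = `|B| `^ (-1) * `|B| `^ g.
  by rewrite -powR_add//; congr (_ `^ _); ring.
rewrite [leRHS](_ : _ = `|B| `^ (-1) * (2 * `|B| `^ g * `|A| `^ (g - 1))); last by ring.
rewrite ler_wpM2l ?powR_ge0// ler_wpM2r ?powR_ge0//.
apply: (@le_trans _ _ ((2 * `|B|) `^ g)); first by rewrite ge0_ler_powR ?nnegrE ?mulr_ge0.
rewrite powRM// ler_wpM2r ?powR_ge0// ler1_powR ?ler1n//.
by rewrite (le_trans g2)//; clear; lra.
Qed.

Lemma pow3_le (x s : R) : 0 <= x -> s <= 0 -> (3 * x) `^ s <= x `^ s.
Proof.
move=> x0 s0; rewrite powRM// ler_piMl ?powR_ge0//.
by rewrite -[leRHS](powRr0 (3 : R)) ler_powR// ler1n.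
Qed.

Lemma absz_norm (z : int) : (`|z|%N)%:R = `|z%:~R| :> R.
Proof. by rewrite natr_absz intr_norm. Qed.

(** The factor |k| times the power g - 1 of |k j (k - j)|: the size of the coefficients of X when
    time regularity [g] is extracted. *)
Definition xker (g : R) (k j : int) : R :=
  q k `^ g * q j `^ (g - 1) * q (k - j) `^ (g - 1).

Definition phase1 (k j : int) : R := (-3 * k * j * (k - j))%:~R.

Lemma normr_m3 : `|(-3)%:~R| = 3 :> R.
Proof. by rewrite -[(-3)%:~R]/(- 3%:R : R) normrN normr_nat. Qed.

Lemma abs_phase1 (k j : int) : k != 0 -> j != 0 -> k - j != 0 ->
  `|phase1 k j| = 3 * (q k * q j * q (k - j)).
Proof.
move=> k0 j0 l0; by rewrite /phase1 !intrM !normrM normr_m3 -!qz_neq0// !mulrA.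
Qed.

Lemma Jint_coef_bound (T g : R) : 0 <= g -> g <= 1 / 2 -> 0 <= T ->
  exists2 C : R, 0 <= C & forall s t (k i j : int), s <= t -> t - s <= T ->
  k != 0 -> i != 0 -> j != 0 -> k - i - j != 0 -> k - i != 0 ->
  q k * q (k - i) * cabs (Jint (phase1 k i) (phase1 (k - i) j) s t) <=
  C * (t - s) `^ (2 * g) * (xker g k i * xker g (k - i) j +
    (nres k i j)%:R * (q i `^ (-1) * q ((k - i) * (i + j) * (k - j)) `^ (- (1 - 2 * g)))).
Proof.
(* The 2 comes from [Eint_holder] for a nonzero total phase. For a vanishing one the integral equals
   t - s, which is at most T^(1 - 2g) (t - s)^(2g). *)
move=> g0 g2 T0; pose c := 2 + T `^ (1 - 2 * g).
have c0 : 0 <= c by rewrite addr_ge0 ?powR_ge0.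
exists (22 + c) => [|s t k i j st stT k0 i0 j0 l0 m0]; first by rewrite addr_ge0.
have aA := abs_phase1 k0 i0 m0; have aB := abs_phase1 m0 j0 l0.
have DE : phase1 k i + phase1 (k - i) j = (-3 * ((k - i) * (i + j) * (k - j)))%:~R.
  by rewrite /phase1 -intrD; congr (_%:~R); ring.
set A := phase1 k i in aA DE *; set B := phase1 (k - i) j in aB DE *.
set D' := (k - i) * (i + j) * (k - j) in DE *.
have [Q0 Qi Qj Ql] : [/\ 0 < q k, 0 < q i, 0 < q j & 0 < q (k - i - j)] by split; exact: qz_gt0.
have Qm : 0 < q (k - i) by exact: qz_gt0.
have A0 : A != 0 by rewrite -normr_gt0 aA !mulr_gt0.
have B0 : B != 0 by rewrite -normr_gt0 aB !mulr_gt0.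
have gm1 : g - 1 <= 0 by clear -g2; lra.
have tau0 : 0 <= (t - s) `^ (2 * g) by exact: powR_ge0.
have X0 : 0 <= xker g k i * xker g (k - i) j by rewrite !mulr_ge0 ?powR_ge0.
have XK : q k * q (k - i) * (`|A| `^ (g - 1) * `|B| `^ (g - 1)) <= xker g k i * xker g (k - i) j.
  rewrite aA aB.
  apply: (@le_trans _ _ (q k * q (k - i) * ((q k * q i * q (k - i)) `^ (g - 1)
     * (q (k - i) * q j * q (k - i - j)) `^ (g - 1)))).
    rewrite ler_wpM2l ?mulr_ge0 ?(ltW Q0) ?(ltW Qm)//.
    by rewrite ler_pM ?powR_ge0// pow3_le// !mulr_ge0 ?qz_ge0.
  rewrite !powRM ?mulr_ge0 ?qz_ge0//.
  have e x : 0 < x -> x `^ g = x * x `^ (g - 1).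
    by move=> x0; rewrite -{2}[x]powRr1 ?(ltW x0)// -powR_add// subrKC.
  by rewrite /xker !e// le_eqVlt; apply/orP; left; apply/eqP; ring.
have [hr|hr] := boolP (nres k i j); last first.
  rewrite mul0r addr0.
  have hD : `|A| <= 10 * `|A + B|.
    have : (`|(k * i)%R| <= 10 * `|((i + j) * (k - j))%R|)%N.
      by move: hr; rewrite /nres k0 i0 j0 l0 m0 /= -leqNgt.
    rewrite -(ler_nat R) natrM !absz_norm => h.
    have AE : A = (-3 * (k - i))%:~R * (k * i)%:~R.
      by rewrite /A /phase1 -intrM; congr (_%:~R); ring.
    have ABE : A + B = (-3 * (k - i))%:~R * ((i + j) * (k - j))%:~R.
      by rewrite DE /D' -intrM; congr (_%:~R); ring.
    by rewrite ABE AE !normrM mulrCA ler_wpM2l.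
  have h := Jint_nonres st A0 B0 g0 g2 hD.
  apply: le_trans (ler_wpM2l _ h) _; first by rewrite mulr_ge0 ?qz_ge0.
  rewrite mulrCA; apply: le_trans (ler_wpM2l _ XK) _; first by rewrite mulr_ge0.
  by rewrite ler_wpM2r// ler_wpM2r// lerDl.
have hD : 10 * `|A + B| < `|A|.
  have : (10 * `|((i + j) * (k - j))%R| < `|(k * i)%R|)%N by case/and5P: hr => _ _ _ _ /andP[].
  rewrite -(ltr_nat R) natrM !absz_norm => h.
  have AE : A = (-3 * (k - i))%:~R * (k * i)%:~R.
    by rewrite /A /phase1 -intrM; congr (_%:~R); ring.
  have ABE : A + B = (-3 * (k - i))%:~R * ((i + j) * (k - j))%:~R.
    by rewrite DE /D' -intrM; congr (_%:~R); ring.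
  rewrite ABE AE !normrM mulrCA ltr_pM2l// normr_gt0 intr_eq0 mulf_neq0//.
have h := Jint_res st A0 B0 g0 g2 hD.
have th0 : 0 <= 2 * g by clear -g0; lra.
have th1 : 2 * g <= 1 by clear -g2; lra.
have dl0 : 0 <= 1 - 2 * g by clear -g2; lra.
have ED : cabs (Eint (A + B) t - Eint (A + B) s) <= c * (t - s) `^ (2 * g) * q D' `^ (- (1 - 2 * g)).
  have [D'0|D'0] := eqVneq D' 0.
    rewrite D'0 /qz powR1 mulr1.
    apply: le_trans (Eint_le (A + B) st) _.
    have ts0 : 0 <= t - s by rewrite subr_ge0.
    have [->|tsn] := eqVneq (t - s) 0; first by rewrite mulr_ge0 ?powR_ge0.
    have ts1 : 0 < t - s by rewrite lt_neqAle eq_sym tsn.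
    have E : t - s = (t - s) `^ (1 - 2 * g) * (t - s) `^ (2 * g).
      by rewrite -powR_add// subrK powRr1.
    rewrite {1}E ler_wpM2r ?powR_ge0// /c.
    apply: (@le_trans _ _ (T `^ (1 - 2 * g))); first by rewrite ge0_ler_powR ?nnegrE.
    by rewrite lerDr.
  have AB0 : A + B != 0 by rewrite DE intr_eq0 mulf_neq0.
  apply: le_trans (Eint_holder st AB0 th0 th1) _.
  have -> : - (1 - 2 * g) = 2 * g - 1 by ring.
  apply: ler_pM; rewrite ?mulr_ge0 ?powR_ge0//.
    by rewrite ler_wpM2r// /c lerDl powR_ge0.
  have -> : `|A + B| = 3 * q D'.
    by rewrite DE intrM normrM normr_m3 -qz_neq0.
  by apply: pow3_le; [exact: qz_ge0|rewrite subr_le0].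
have QA : q k * q (k - i) * (2 * `|A|^-1) <= q i `^ (-1).
  rewrite aA powR_inv1 ?(ltW Qi)//.
  have -> : q k * q (k - i) * (2 * (3 * (q k * q i * q (k - i)))^-1) = 2 / 3 * (q i)^-1.
    by field; rewrite !gt_eqF.
  by rewrite ler_piMl ?invr_ge0 ?(ltW Qi)//; clear; lra.
apply: le_trans (ler_wpM2l _ h) _; first by rewrite mulr_ge0 ?qz_ge0.
rewrite mul1r !mulrDr; apply: lerD.
  rewrite mulrCA; apply: le_trans (ler_wpM2l _ XK) _; first by rewrite mulr_ge0.
  by rewrite ler_wpM2r// ler_wpM2r//; clear -c0; lra.
rewrite [leLHS]mulrA; apply: le_trans (ler_pM _ _ QA ED) _; rewrite ?cabs_ge0//.
  by rewrite !mulr_ge0 ?qz_ge0 ?invr_ge0.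
rewrite [leLHS](_ : _ = c * (t - s) `^ (2 * g) * (q i `^ (-1) * q D' `^ (- (1 - 2 * g)))); last by ring.
rewrite ler_wpM2r ?mulr_ge0 ?powR_ge0// ler_wpM2r// lerDr.
by clear; lra.
Qed.
End CoefficientBounds.

(** * Coefficients of X and X2 as Fourier multipliers *)

Section Coefficients.
Variable R : realType.
Local Notation q := (@qz R).
Implicit Types (f : dist R).

Definition coef1 (t s : R) (k j : int) : R[i] :=
  if (j == 0) || (j == k) then 0 else
  (Cexpi (phase1 R k j * s) - Cexpi (phase1 R k j * t)) / (6 * j * (k - j))%:~R.

Lemma XopE t s f1 f2 k :
  Xop t s f1 f2 k = zsum (fun j => coef1 t s k j * (f1 j * f2 (k - j))).
Proof.
rewrite /Xop; congr zsum; apply/funext => j; rewrite /coef1.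
by case: ifP => _; rewrite ?mul0r// -!mulrA.
Qed.

Definition coef2 (t s : R) (k i j : int) : R[i] :=
  if (i == 0) || (i == k) then 0 else if (j == 0) || (j == k - i) then 0 else
  2 * ('i%C * k%:~R / 2) * ('i%C * (k - i)%:~R / 2)
    * cint s t (fun x => Cexpi (phase1 R k i * x)
        * cint s x (fun y => Cexpi (phase1 R (k - i) j * y))).

Lemma X2opE t s f1 f2 f3 k :
  X2op t s f1 f2 f3 k =
  zsum (fun i => zsum (fun j => coef2 t s k i j * (f1 i * (f2 j * f3 (k - i - j))))).
Proof.
rewrite /X2op; congr zsum; apply/funext => i; rewrite /coef2.
case: ifP => _.
  apply/esym; rewrite /zsum; apply: cplx_eq => /=.
    rewrite (_ : (fun N => _) = fun=> 0) ?lim_cst//; apply/funext => N.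
    by rewrite big1// => n _; rewrite mul0r.
  rewrite (_ : (fun N => _) = fun=> 0) ?lim_cst//; apply/funext => N.
  by rewrite big1// => n _; rewrite mul0r.
congr zsum; apply/funext => j.
by case: ifP => _; rewrite ?mul0r// -!mulrA.
Qed.

Lemma phase1_0 j : phase1 R 0 j = 0.
Proof. by rewrite /phase1 mulr0 !mul0r. Qed.

Lemma phase1_neq0 k j : k != 0 -> j != 0 -> k - j != 0 -> phase1 R k j != 0.
Proof.
by move=> k0 j0 l0; rewrite -normr_gt0 abs_phase1// !mulr_gt0// qz_gt0.
Qed.

Lemma intC (z : int) : ((z%:~R : R)%:C)%C = z%:~R :> R[i].
Proof. exact: (rmorph_int (real_complex R)). Qed.

Lemma intrC_neq0 (z : int) : z != 0 -> (z%:~R : R[i]) != 0.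
Proof. by move=> z0; rewrite intr_eq0. Qed.

(** The time integral of the coefficient of Xdot: the factor k in front cancels against the phase -3
    k j (k - j) and leaves 6 j (k - j). For k = 0 both sides vanish. In this form [coef1] fits the
    Chen relation of [Jint]. *)
Lemma coef1E t s k j : j != 0 -> j != k ->
  coef1 t s k j = 'i%C * k%:~R / 2 * (Eint (phase1 R k j) t - Eint (phase1 R k j) s).
Proof.
move=> j0 jk; rewrite /coef1 (negbTE j0) (negbTE jk) /=.
have l0 : k - j != 0 by rewrite subr_eq0 eq_sym.
have [->|k0] := eqVneq k 0.
  by rewrite phase1_0 !mul0r subrr mul0r mulr0 !mul0r.
rewrite (EintB _ _ (phase1_neq0 k0 j0 l0)).
have e : ('i * (phase1 R k j)%:C)%C = 'i%C * (-3 * k * j * (k - j))%:~R :> R[i].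
  by rewrite /phase1 -intC.
rewrite e; move: (Cexpi _) (Cexpi _) => x y.
have i0 : 'i%C != 0 :> R[i] by exact: neq0Ci.
rewrite !intrM.
have e3 : ((-3)%:~R : R[i]) = - 3 by [].
have e6 : ((6 : int)%:~R : R[i]) = 6 by [].
rewrite e3 e6.
have := intrC_neq0 k0; have := intrC_neq0 j0; have := intrC_neq0 l0.
move: (k%:~R) (j%:~R) ((k - j)%:~R) 'i%C i0 => a b c ii ii0 c0 b0 a0.
by field; rewrite a0 b0 c0 ii0.
Qed.

Lemma coef1_bound t s k j g : 0 <= g -> g <= 1 -> s <= t ->
  cabs (coef1 t s k j) <= (t - s) `^ g * xker g k j.
Proof.
move=> g0 g1 st; have r0 : 0 <= (t - s) `^ g * xker g k j.
  by rewrite /xker !mulr_ge0 ?powR_ge0.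
rewrite /coef1; case: ifP => [_|]; first by rewrite cabs0.
move/negbT; rewrite negb_or => /andP[j0 jk].
have l0 : k - j != 0 by rewrite subr_eq0 eq_sym.
have [k0|k0] := eqVneq k 0.
  by rewrite k0 phase1_0 !mul0r subrr mul0r cabs0 -k0.
have Qj : 0 < q j by exact: qz_gt0.
have Ql : 0 < q (k - j) by exact: qz_gt0.
have Qk : 0 < q k by exact: qz_gt0.
rewrite cabsM cabsV cabs_int !intrM !normrM -(qz_neq0 R j0) -(qz_neq0 R l0).
have -> : `|(6 : int)%:~R : R| = 6 by exact: normr_nat.
rewrite ler_pdivrMr ?mulr_gt0//.
apply: le_trans (Cexpi_holder _ _ g0 g1) _.
rewrite -mulrBr normrM abs_phase1// distrC (ger0_norm (_ : 0 <= t - s)) ?subr_ge0//.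
rewrite !powRM ?subr_ge0 ?mulr_ge0 ?qz_ge0//.
have e x : 0 < x -> x `^ g = x * x `^ (g - 1).
  by move=> x0; rewrite -{2}[x]powRr1 ?(ltW x0)// -powR_add// subrKC.
rewrite /xker (e (q j))// (e (q (k - j)))//.
have h3 : 3 `^ g <= 3 :> R by rewrite ler1_powR// ler1n.
rewrite [leLHS](_ : _ = 3 `^ g * (2 * (t - s) `^ g * q k `^ g * (q j * q j `^ (g - 1))
   * (q (k - j) * q (k - j) `^ (g - 1)))); last by ring.
rewrite [leRHS](_ : _ = 3 * (2 * (t - s) `^ g * q k `^ g * (q j * q j `^ (g - 1))
   * (q (k - j) * q (k - j) `^ (g - 1)))); last by ring.
by rewrite ler_wpM2r// !mulr_ge0 ?powR_ge0 ?qz_ge0.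
Qed.

Lemma coef2E t s k i j : s <= t -> i != 0 -> i != k -> j != 0 -> j != k - i ->
  coef2 t s k i j = 2 * ('i%C * k%:~R / 2) * ('i%C * (k - i)%:~R / 2)
    * Jint (phase1 R k i) (phase1 R (k - i) j) s t.
Proof.
move=> st i0 ik j0 jl; rewrite /coef2 (negbTE i0) (negbTE ik) (negbTE j0) (negbTE jl) /=.
rewrite cint_double//; apply: phase1_neq0 => //; first by rewrite subr_eq0 eq_sym.
by rewrite subr_eq0 eq_sym.
Qed.

Lemma coef2_chen t u s k i j : s <= u -> u <= t ->
  coef2 t s k i j = coef2 t u k i j + coef2 u s k i j
    + 2 * (coef1 t u k i * coef1 u s (k - i) j).
Proof.
move=> su ut; have st := le_trans su ut.
have [i0|i0] := eqVneq i 0.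
  by rewrite i0 /coef2 /coef1 eqxx /= mul0r mulr0 !addr0.
have [ik|ik] := eqVneq i k.
  by rewrite ik /coef2 /coef1 eqxx orbT /= mul0r mulr0 !addr0.
have [j0|j0] := eqVneq j 0.
  by rewrite j0 /coef2 /coef1 (negbTE i0) (negbTE ik) eqxx /= mulr0 mulr0 !addr0.
have [jl|jl] := eqVneq j (k - i).
  by rewrite jl /coef2 /coef1 (negbTE i0) (negbTE ik) eqxx orbT /= mulr0 mulr0 !addr0.
rewrite !coef2E// !coef1E//.
have B0 : phase1 R (k - i) j != 0.
  by apply: phase1_neq0 => //; rewrite subr_eq0 eq_sym.
have := Jint_chen (phase1 R k i) s u t B0.
set A := phase1 R k i; set B := phase1 R (k - i) j.
move=> h; have -> : Jint A B s t = Jint A B s u + Jint A B u t + (Eint A t - Eint A u) * (Eint B u - Eint B s).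
  by rewrite -h; ring.
ring.
Qed.

Lemma coef2_bound (T g : R) : 0 <= g -> g <= 1 / 2 -> 0 <= T ->
  exists2 C : R, 0 <= C & forall s t (k i j : int), s <= t -> t - s <= T ->
  cabs (coef2 t s k i j) <=
  C * (t - s) `^ (2 * g) * (xker g k i * xker g (k - i) j +
    (nres k i j)%:R * (q i `^ (-1) * q ((k - i) * (i + j) * (k - j)) `^ (- (1 - 2 * g)))).
Proof.
move=> g0 g2 T0; have [C C0 HC] := Jint_coef_bound g0 g2 T0.
exists C => // s t k i j st stT.
have rhs0 : 0 <= C * (t - s) `^ (2 * g) * (xker g k i * xker g (k - i) j +
    (nres k i j)%:R * (q i `^ (-1) * q ((k - i) * (i + j) * (k - j)) `^ (- (1 - 2 * g)))).
  by rewrite /xker !(mulr_ge0, addr_ge0) ?powR_ge0.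
have [i0|i0] := eqVneq i 0; first by rewrite [coef2 _ _ _ _ _](_ : _ = 0) ?cabs0// i0 /coef2 eqxx.
have [ik|ik] := eqVneq i k.
  by rewrite [coef2 _ _ _ _ _](_ : _ = 0) ?cabs0// ik /coef2 eqxx orbT.
have [j0|j0] := eqVneq j 0.
  by rewrite [coef2 _ _ _ _ _](_ : _ = 0) ?cabs0// j0 /coef2 (negbTE i0) (negbTE ik) eqxx.
have [jl|jl] := eqVneq j (k - i).
  by rewrite [coef2 _ _ _ _ _](_ : _ = 0) ?cabs0// jl /coef2 (negbTE i0) (negbTE ik) eqxx orbT.
rewrite coef2E//.
have [k0|k0] := eqVneq k 0.
  by rewrite [X in cabs X](_ : _ = 0) ?cabs0// k0 mulr0 mul0r mulr0 !mul0r.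
have m0 : k - i != 0 by rewrite subr_eq0 eq_sym.
have l0 : k - i - j != 0 by rewrite subr_eq0 eq_sym.
apply: le_trans (HC s t k i j st stT k0 i0 j0 l0 m0).
rewrite cabsM ler_wpM2r ?cabs_ge0//.
rewrite !cabsM !cabsV !cabs_i !cabs_int cabs_nat -!qz_neq0// !mul1r.
rewrite [leLHS](_ : _ = (q k * q (k - i)) / 2); last by field.
by rewrite ler_piMr ?mulr_ge0 ?qz_ge0//; clear; lra.
Qed.
End Coefficients.

Lemma lty_of_mul (R : realType) (c : R) (x : \bar R) : 0 < c -> (0 <= x)%E ->
  (c%:E * x < +oo)%E -> (x < +oo)%E.
Proof.
move=> c0; case: x => [r| |] // _; first by rewrite !ltry.
by rewrite gt0_muley// lte_fin.
Qed.

(** * Boundedness of X and X2 on Fourier-Lebesgue spaces *)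

Section FourierLebesgue.
Variable R : realType.
Local Notation q := (@qz R).
Implicit Types (f : dist R) (p : \bar R).

Definition wseq (al : R) f (k : int) : R := jbr R k `^ al * cabs (f k).

Lemma flnormE al p f : flnorm al p f = lpn p (fun k => (wseq al f k)%:E).
Proof.
case: p => [r| |] //=; congr (_ `^ _)%E; apply: eq_esum => k _.
Qed.

Lemma wseq_ge0 al f k : 0 <= wseq al f k.
Proof. by rewrite mulr_ge0 ?powR_ge0 ?cabs_ge0. Qed.

Lemma flnorm_ge0 al p f : (0 <= flnorm al p f)%E.
Proof. by rewrite flnormE; apply: lpn_ge0 => k; rewrite lee_fin wseq_ge0. Qed.

Lemma jbr_gt0 k : 0 < jbr R k.
Proof. by rewrite /jbr sqrtr_gt0 ltr_pwDl ?sqr_ge0. Qed.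

Lemma jbr_ge_qz k : q k <= jbr R k.
Proof.
have [->|k0] := eqVneq k 0; first by rewrite /jbr expr0n /= addr0 sqrtr1.
by rewrite qz_neq0// -sqrtr_sqr /jbr ler_sqrt ?addr_ge0 ?sqr_ge0// lerDr.
Qed.

Lemma jbr_le_qz k : jbr R k <= 2 * q k.
Proof.
have q0 : 0 <= 2 * q k by rewrite mulr_ge0 ?qz_ge0.
rewrite -[leRHS](ger0_norm q0) -sqrtr_sqr /jbr ler_sqrt ?sqr_ge0//.
have q1 := qz_ge1 R k; have : k%:~R ^+ 2 <= q k ^+ 2.
  have [->|k0] := eqVneq k 0; first by rewrite expr0n /= sqr_ge0.
  by rewrite qz_neq0// real_normK// num_real.
by move: q1; clear; nra.
Qed.

Lemma jbr_powR (s : R) k : jbr R k `^ s <= 2 `^ `|s| * q k `^ s.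
Proof.
apply: powR_ratio; [exact: jbr_gt0|exact: qz_gt0|exact: jbr_le_qz|].
by rewrite (le_trans (jbr_ge_qz k))// ler_peMl ?(ltW (jbr_gt0 k))// ler1n.
Qed.

Lemma cabs_wseq al f k : cabs (f k) <= 2 `^ `|al| * (q k `^ (- al) * wseq al f k).
Proof.
have -> : cabs (f k) = jbr R k `^ (- al) * wseq al f k.
  by rewrite /wseq mulrA -powR_add ?jbr_gt0// addNr powRr0 mul1r.
by rewrite [leRHS]mulrA ler_wpM2r ?wseq_ge0// -[`|al|]normrN jbr_powR.
Qed.

Lemma flnormD al p (f g : dist R) : (1 <= p)%E ->
  (flnorm al p (fun k => (f k + g k)%R) <= flnorm al p f + flnorm al p g)%E.
Proof.
move=> p1; rewrite !flnormE.
have w0 h k : (0 <= (wseq al h k)%:E)%E by rewrite lee_fin wseq_ge0.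
apply: le_trans (lpnD p1 (w0 f) (w0 g)).
apply: le_lpn => // k; rewrite -EFinD lee_fin /wseq -mulrDr ler_wpM2l ?powR_ge0//.
exact: cabsD.
Qed.

Lemma flnormN al p f : flnorm al p (fun k => - f k) = flnorm al p f.
Proof. by rewrite !flnormE; apply: eq_lpn => k; rewrite /wseq cabsN. Qed.

Lemma flnorm0 al p : (1 <= p)%E -> flnorm al p (fun=> 0) = 0%E.
Proof.
move=> p1; rewrite flnormE.
rewrite (@eq_lpn _ _ _ (fun k => (0%:E * 0%:E)%E)); last first.
  by move=> k; rewrite /wseq cabs0 mulr0 mul0e.
by rewrite (lpnZ (f := fun=> 0%:E))// mul0e.
Qed.

Lemma trilinear_bounded_comp p (W : int -> int -> R) : (1 <= p)%E ->
  (forall k j, 0 <= W k j) -> bilinear_bounded p W ->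
  trilinear_bounded p (fun k i j => W k i * W (k - i) j).
Proof.
move=> p1 W0 [C C0 HC]; exists (C * C); first by rewrite mulr_ge0.
move=> a b c A B D a0 b0 c0 A0 B0 D0 hA hB hD.
have CBD : 0 <= C * B * D by rewrite !mulr_ge0.
have hG := HC b c B D b0 c0 B0 D0 hB hD.
have G0 k : (0 <= bilinear_op W b c k)%E by exact: bilinear_op_ge0.
have [g g0 gE] := lpn_fin_seq p1 G0 (le_lt_trans hG (ltry _)).
rewrite gE in hG.
have -> : C * C * A * B * D = C * A * (C * B * D) by ring.
apply: le_trans (HC a g A (C * B * D) a0 g0 A0 CBD hA hG).
rewrite le_eqVlt; apply/orP; left; apply/eqP; apply: eq_lpn => k.
apply: eq_esum => i _.
have gi : (g (k - i))%:E = bilinear_op W b c (k - i) by rewrite gE.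
rewrite mulrA EFinM gi /bilinear_op -sumZZ ?mulr_ge0//; last first.
  by move=> j; rewrite lee_fin !mulr_ge0.
by apply: eq_esum => j _; rewrite -EFinM; congr EFin; ring.
Qed.

Variables (p : \bar R) (al g : R).
Hypotheses (p1 : (1 <= p)%E) (g3 : 1 / 3 < g) (g2 : g <= 1 / 2) (al2 : - (1 / 2) < al)
  (alp : 3 * g - 1 - recp p < al).

Let W k j := bker (q k) (q j) (q (k - j)) al g.

Let W0 k j : 0 <= W k j.
Proof. by rewrite /W /bker !mulr_ge0 ?powR_ge0. Qed.

(** One comparison factor between bracket and [q] for each of the frequencies k, j and k - j; [K2]
    does the same for the four frequencies of X2. *)
Let K1 : R := (2 `^ `|al|) ^+ 3.

Let K10 : 0 <= K1.
Proof. by rewrite exprn_ge0 ?powR_ge0. Qed.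

Let g0 : 0 <= g.
Proof. by have h := g3; lra. Qed.

Let g1 : g <= 1.
Proof. by have h := g2; lra. Qed.

Lemma coef1_weighted t s (f1 f2 : dist R) k j : s <= t ->
  jbr R k `^ al * cabs (coef1 t s k j * (f1 j * f2 (k - j))) <=
  K1 * (t - s) `^ g * (W k j * (wseq al f1 j * wseq al f2 (k - j))).
Proof.
move=> st; have c2 : 0 <= 2 `^ `|al| :> R by exact: powR_ge0.
rewrite !cabsM.
apply: (@le_trans _ _ ((2 `^ `|al| * q k `^ al) * ((t - s) `^ g * xker g k j
   * ((2 `^ `|al| * (q j `^ (- al) * wseq al f1 j))
   * (2 `^ `|al| * (q (k - j) `^ (- al) * wseq al f2 (k - j))))))).
  by rewrite !ler_pM ?mulr_ge0 ?powR_ge0 ?cabs_ge0 ?jbr_powR ?coef1_bound ?cabs_wseq.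
rewrite le_eqVlt; apply/orP; left; apply/eqP.
rewrite /W /bker /xker /K1.
have e (x : R) : 0 < x -> x `^ (- (1 + al - g)) = x `^ (g - 1) * x `^ (- al).
  by move=> x0; rewrite -powR_add//; congr (_ `^ _); ring.
by rewrite !e ?qz_gt0// (powR_add g al (qz_gt0 R k)); ring.
Qed.

Lemma coef1_sum_le t s (f1 f2 : dist R) k : s <= t ->
  ((jbr R k `^ al)%:E * (\sumZ_ j (cabs (coef1 t s k j * (f1 j * f2 (k - j)))%R)%:E) <=
  (K1 * (t - s) `^ g)%:E * bilinear_op W (wseq al f1) (wseq al f2) k)%E.
Proof.
move=> st; rewrite -sumZZ ?powR_ge0//; last by move=> j; rewrite lee_fin cabs_ge0.
rewrite -sumZZ ?mulr_ge0 ?powR_ge0//; last first.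
  move=> j; rewrite lee_fin; apply: mulr_ge0; first exact: W0.
  by apply: mulr_ge0; exact: wseq_ge0.
by apply: le_sumZ => j; rewrite -!EFinM lee_fin coef1_weighted.
Qed.

(** Summability is recorded along with the bound, since linearity, symmetry and Chen's relations of
    [zsum] depend on it. *)
Lemma Xop_bound : exists2 C : R, 0 <= C & forall t s f1 f2 A B, s <= t ->
  0 <= A -> 0 <= B -> (flnorm al p f1 <= A%:E)%E -> (flnorm al p f2 <= B%:E)%E ->
  (flnorm al p (Xop t s f1 f2) <= (C * (t - s) `^ g * A * B)%:E)%E /\
  forall k, zsummable (fun j => coef1 t s k j * (f1 j * f2 (k - j))).
Proof.
have [C C0 HC] := bilinear_bounded_bker p1 g3 g2 al2 alp.
exists (K1 * C) => [|t s f1 f2 A B st A0 B0]; first by rewrite mulr_ge0.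
rewrite !flnormE => hA hB.
have h := HC (wseq al f1) (wseq al f2) A B (wseq_ge0 _ _) (wseq_ge0 _ _) A0 B0 hA hB.
have KT : 0 <= K1 * (t - s) `^ g by rewrite mulr_ge0 ?powR_ge0.
have op0 k : (0 <= bilinear_op W (wseq al f1) (wseq al f2) k)%E.
  by apply: bilinear_op_ge0 => // j; exact: wseq_ge0.
split.
  apply: (@le_trans _ _ (lpn p (fun k => (K1 * (t - s) `^ g)%:E
      * bilinear_op W (wseq al f1) (wseq al f2) k)%E)).
    apply: le_lpn => // k; first by rewrite lee_fin wseq_ge0.
    apply: le_trans (coef1_sum_le f1 f2 k st).
    rewrite /wseq EFinM lee_wpmul2l ?lee_fin ?powR_ge0// XopE.
    exact: cabs_zsum_le.
  rewrite lpnZ//.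
  have -> : (K1 * C * (t - s) `^ g * A * B)%:E = ((K1 * (t - s) `^ g)%:E * (C * A * B)%:E)%E.
    by rewrite -EFinM; congr EFin; ring.
  by rewrite lee_wpmul2l.
move=> k; rewrite /zsummable.
have fin : ((K1 * (t - s) `^ g)%:E * bilinear_op W (wseq al f1) (wseq al f2) k < +oo)%E.
  rewrite lte_mul_pinfty// (le_lt_trans _ (ltry (C * A * B)))//.
  by apply: le_trans h; exact: lpn_point.
have := le_lt_trans (coef1_sum_le f1 f2 k st) fin.
by apply: lty_of_mul; [rewrite powR_gt0 ?jbr_gt0|
  apply: sumZ_ge0 => j; rewrite lee_fin cabs_ge0].
Qed.

Let V k i j := W k i * W (k - i) j + nker al g k i j.

Let V0 k i j : 0 <= V k i j.
Proof. by apply: addr_ge0; [exact: mulr_ge0|exact: nker_ge0]. Qed.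

Let K2 : R := (2 `^ `|al|) ^+ 4.

Let K20 : 0 <= K2.
Proof. by rewrite exprn_ge0 ?powR_ge0. Qed.

Lemma X2op_bound (T : R) : 0 <= T ->
  exists2 C : R, 0 <= C & forall t s f1 f2 f3 A B D, s <= t -> t - s <= T ->
  0 <= A -> 0 <= B -> 0 <= D -> (flnorm al p f1 <= A%:E)%E ->
  (flnorm al p f2 <= B%:E)%E -> (flnorm al p f3 <= D%:E)%E ->
  (flnorm al p (X2op t s f1 f2 f3) <= (C * (t - s) `^ (2 * g) * A * B * D)%:E)%E /\
  forall k, (\sumZ_ i (\sumZ_ j
    (cabs (coef2 t s k i j * (f1 i * (f2 j * f3 (k - i - j))))%R)%:E) < +oo)%E.
Proof.
move=> T0; have [C2 C20 HC2] := coef2_bound g0 g2 T0.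
have BB := bilinear_bounded_bker p1 g3 g2 al2 alp.
have TT := trilinear_boundedD p1 (fun k i j => mulr_ge0 (W0 k i) (W0 (k - i) j))
  (nker_ge0 al g) (trilinear_bounded_comp p1 W0 BB) (trilinear_bounded_nker p1 g3 g2 al2 alp).
have [C C0 HC] : trilinear_bounded p V by exact: TT.
exists (K2 * C2 * C) => [|t s f1 f2 f3 A B D st stT A0 B0 D0]; first by rewrite !mulr_ge0.
rewrite !flnormE => hA hB hD.
have h := HC (wseq al f1) (wseq al f2) (wseq al f3) A B D (wseq_ge0 _ _) (wseq_ge0 _ _)
  (wseq_ge0 _ _) A0 B0 D0 hA hB hD.
set K := K2 * C2 * (t - s) `^ (2 * g).
have K0 : 0 <= K by rewrite !mulr_ge0 ?powR_ge0.
have op0 k : (0 <= trilinear_op V (wseq al f1) (wseq al f2) (wseq al f3) k)%E.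
  by apply: trilinear_op_ge0 => // j; exact: wseq_ge0.
have c2 : 0 <= 2 `^ `|al| :> R by exact: powR_ge0.
have pt k i j : jbr R k `^ al * cabs (coef2 t s k i j * (f1 i * (f2 j * f3 (k - i - j)))) <=
    K * (V k i j * (wseq al f1 i * (wseq al f2 j * wseq al f3 (k - i - j)))).
  rewrite !cabsM.
  apply: (@le_trans _ _ ((2 `^ `|al| * q k `^ al) * (C2 * (t - s) `^ (2 * g)
    * (xker g k i * xker g (k - i) j +
    (nres k i j)%:R * (q i `^ (-1) * q ((k - i) * (i + j) * (k - j)) `^ (- (1 - 2 * g))))
   * ((2 `^ `|al| * (q i `^ (- al) * wseq al f1 i))
   * ((2 `^ `|al| * (q j `^ (- al) * wseq al f2 j))
   * (2 `^ `|al| * (q (k - i - j) `^ (- al) * wseq al f3 (k - i - j)))))))).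
    by rewrite !ler_pM ?mulr_ge0 ?powR_ge0 ?cabs_ge0 ?jbr_powR ?HC2 ?cabs_wseq.
  rewrite le_eqVlt; apply/orP; left; apply/eqP.
  rewrite /K /K2 /V /W /bker /xker /nker.
  have e (x : R) : 0 < x -> x `^ (- (1 + al - g)) = x `^ (g - 1) * x `^ (- al).
    by move=> x0; rewrite -powR_add//; congr (_ `^ _); ring.
  have m1 : q (k - i) `^ (- al) * q (k - i) `^ al = 1 by rewrite -powR_add ?qz_gt0// addNr powRr0.
  rewrite !e ?qz_gt0// (powR_add g al (qz_gt0 R k)) (powR_add g al (qz_gt0 R (k - i))).
  (* Inserts the weight at the intermediate frequency k - i, which turns the product of two [xker]
     into a product of two [bker]. *)
  have m2 x : x = x * (q (k - i) `^ (- al) * q (k - i) `^ al) by rewrite m1 mulr1.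
  rewrite [q k `^ g * q i `^ (g - 1) * q (k - i) `^ (g - 1)]m2.
  ring.
have sumle k : ((jbr R k `^ al)%:E * (\sumZ_ i (\sumZ_ j
    (cabs (coef2 t s k i j * (f1 i * (f2 j * f3 (k - i - j))))%R)%:E))
    <= K%:E * trilinear_op V (wseq al f1) (wseq al f2) (wseq al f3) k)%E.
  rewrite -sumZZ ?powR_ge0//; last first.
    by move=> i; apply: sumZ_ge0 => j; rewrite lee_fin cabs_ge0.
  rewrite /trilinear_op -sumZZ//; last first.
    move=> i; apply: sumZ_ge0 => j; rewrite lee_fin; apply: mulr_ge0; first exact: V0.
    exact: mulr_ge0 (wseq_ge0 _ _ _) (mulr_ge0 (wseq_ge0 _ _ _) (wseq_ge0 _ _ _)).
  apply: le_sumZ => i; rewrite -sumZZ ?powR_ge0//; last by move=> j; rewrite lee_fin cabs_ge0.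
  rewrite -sumZZ//; last first.
    move=> j; rewrite lee_fin; apply: mulr_ge0; first exact: V0.
    exact: mulr_ge0 (wseq_ge0 _ _ _) (mulr_ge0 (wseq_ge0 _ _ _) (wseq_ge0 _ _ _)).
  by apply: le_sumZ => j; rewrite -!EFinM lee_fin pt.
split.
  apply: (@le_trans _ _ (lpn p (fun k => K%:E
      * trilinear_op V (wseq al f1) (wseq al f2) (wseq al f3) k)%E)).
    apply: le_lpn => // k; first by rewrite lee_fin wseq_ge0.
    apply: le_trans (sumle k).
    rewrite /wseq EFinM lee_wpmul2l ?lee_fin ?powR_ge0// X2opE.
    apply: le_trans (cabs_zsum_le _) _; apply: le_sumZ => i; exact: cabs_zsum_le.
  rewrite lpnZ//.
  have -> : (K2 * C2 * C * (t - s) `^ (2 * g) * A * B * D)%:E = (K%:E * (C * A * B * D)%:E)%E.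
    by rewrite -EFinM /K; congr EFin; ring.
  by rewrite lee_wpmul2l.
move=> k.
have fin : (K%:E * trilinear_op V (wseq al f1) (wseq al f2) (wseq al f3) k < +oo)%E.
  rewrite lte_mul_pinfty// (le_lt_trans _ (ltry (C * A * B * D)))//.
  by apply: le_trans h; exact: lpn_point.
have := le_lt_trans (sumle k) fin.
apply: lty_of_mul; first by rewrite powR_gt0 ?jbr_gt0.
by apply: sumZ_ge0 => i; apply: sumZ_ge0 => j; rewrite lee_fin cabs_ge0.
Qed.
End FourierLebesgue.

(** * Linearity, symmetry and Chen's relations under absolute summability *)

Section OperatorAlgebra.
Variable R : realType.
Implicit Types (f : dist R).

Definition xsum t s f1 f2 := forall k, zsummable (fun j => coef1 t s k j * (f1 j * f2 (k - j))).

Definition x2sum t s f1 f2 f3 := forall k, (\sumZ_ i (\sumZ_ j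
  (cabs (coef2 t s k i j * (f1 i * (f2 j * f3 (k - i - j))))%R)%:E) < +oo)%E.

Lemma Xop_add t s f1 f1' f2 : xsum t s f1 f2 -> xsum t s f1' f2 ->
  Xop t s (fladd f1 f1') f2 = fladd (Xop t s f1 f2) (Xop t s f1' f2).
Proof.
move=> h h'; apply/funext => k; rewrite /fladd !XopE -zsumD//.
by congr zsum; apply/funext => j; ring.
Qed.

Lemma coef1_sym (t s : R) k j : coef1 t s k (k - j) = coef1 t s k j.
Proof.
rewrite /coef1 subKr.
have -> : (k - j == 0) || (k - j == k) = (j == 0) || (j == k).
  rewrite orbC subr_eq0 (eq_sym k); congr (_ || _).
  by apply/eqP/eqP => [/eqP|->]; rewrite ?subr0// subr_eq addrC -subr_eq subrr eq_sym => /eqP.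
case: ifP => // _.
have -> : phase1 R k (k - j) = phase1 R k j by rewrite /phase1 subKr; congr (_%:~R); ring.
by congr (_ / _%:~R); ring.
Qed.

Lemma Xop_sym t s f1 f2 : xsum t s f1 f2 -> Xop t s f1 f2 = Xop t s f2 f1.
Proof.
move=> h; apply/funext => k; rewrite !XopE -(zsum_reindex (subl_bij k) (h k)).
by congr zsum; apply/funext => j; rewrite subKr coef1_sym [f1 _ * _]mulrC.
Qed.

Lemma coef1_chen (t u s : R) k j : coef1 t s k j = coef1 t u k j + coef1 u s k j.
Proof.
rewrite /coef1; case: ifP => _; first by rewrite addr0.
by rewrite -mulrDl; congr (_ / _); ring.
Qed.

Lemma Xop_chen t u s f1 f2 : xsum t u f1 f2 -> xsum u s f1 f2 ->
  Xop t s f1 f2 = fladd (Xop t u f1 f2) (Xop u s f1 f2).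
Proof.
move=> h h'; apply/funext => k; rewrite /fladd !XopE -zsumD//.
by congr zsum; apply/funext => j; rewrite (coef1_chen t u s) mulrDl.
Qed.

Lemma zsum2D (F G : int -> int -> R[i]) :
  (\sumZ_ i (\sumZ_ j (cabs (F i j))%:E) < +oo)%E ->
  (\sumZ_ i (\sumZ_ j (cabs (G i j))%:E) < +oo)%E ->
  zsum (fun i => zsum (fun j => F i j + G i j)) =
  zsum (fun i => zsum (F i)) + zsum (fun i => zsum (G i)).
Proof.
have key (H : int -> int -> R[i]) : (\sumZ_ i (\sumZ_ j (cabs (H i j))%:E) < +oo)%E ->
    (forall i, zsummable (H i)) /\ zsummable (fun i => zsum (H i)).
  move=> hH; have c0 i : (0 <= \sumZ_ j (cabs (H i j))%:E)%E.
    by apply: sumZ_ge0 => j; rewrite lee_fin cabs_ge0.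
  split => [i|].
    apply: le_lt_trans hH.
    exact: (sumZ_point (f := fun i => (\sumZ_ j (cabs (H i j))%:E)%E)).
  apply: le_lt_trans hH; apply: le_sumZ => i; exact: cabs_zsum_le.
move=> /key[F1 F2] /key[G1 G2]; rewrite -zsumD//.
by congr zsum; apply/funext => i; rewrite zsumD.
Qed.

Lemma X2op_add1 t s f1 f1' f2 f3 : x2sum t s f1 f2 f3 -> x2sum t s f1' f2 f3 ->
  X2op t s (fladd f1 f1') f2 f3 = fladd (X2op t s f1 f2 f3) (X2op t s f1' f2 f3).
Proof.
move=> h h'; apply/funext => k; rewrite /fladd !X2opE -zsum2D//.
by congr zsum; apply/funext => i; congr zsum; apply/funext => j; ring.
Qed.

Lemma X2op_add2 t s f1 f2 f2' f3 : x2sum t s f1 f2 f3 -> x2sum t s f1 f2' f3 ->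
  X2op t s f1 (fladd f2 f2') f3 = fladd (X2op t s f1 f2 f3) (X2op t s f1 f2' f3).
Proof.
move=> h h'; apply/funext => k; rewrite /fladd !X2opE -zsum2D//.
by congr zsum; apply/funext => i; congr zsum; apply/funext => j; ring.
Qed.

Lemma X2op_add3 t s f1 f2 f3 f3' : x2sum t s f1 f2 f3 -> x2sum t s f1 f2 f3' ->
  X2op t s f1 f2 (fladd f3 f3') = fladd (X2op t s f1 f2 f3) (X2op t s f1 f2 f3').
Proof.
move=> h h'; apply/funext => k; rewrite /fladd !X2opE -zsum2D//.
by congr zsum; apply/funext => i; congr zsum; apply/funext => j; ring.
Qed.

Lemma sumZ2_cabsD (F G : int -> int -> R[i]) :
  (\sumZ_ i (\sumZ_ j (cabs (F i j))%:E) < +oo)%E ->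
  (\sumZ_ i (\sumZ_ j (cabs (G i j))%:E) < +oo)%E ->
  (\sumZ_ i (\sumZ_ j (cabs (F i j + G i j)%R)%:E) < +oo)%E.
Proof.
move=> hF hG; apply: le_lt_trans (lte_add_pinfty hF hG).
rewrite -esumD; last 2 first.
- by move=> i _; apply: sumZ_ge0 => j; rewrite lee_fin cabs_ge0.
- by move=> i _; apply: sumZ_ge0 => j; rewrite lee_fin cabs_ge0.
apply: le_sumZ => i; rewrite -esumD; last 2 first.
- by move=> j _; rewrite lee_fin cabs_ge0.
- by move=> j _; rewrite lee_fin cabs_ge0.
by apply: le_sumZ => j; rewrite -EFinD lee_fin cabsD.
Qed.

Lemma X2op_chen t u s f1 f2 f3 : s <= u -> u <= t ->
  x2sum t s f1 f2 f3 -> x2sum t u f1 f2 f3 -> x2sum u s f1 f2 f3 ->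
  xsum u s f2 f3 -> xsum t u f1 (Xop u s f2 f3) ->
  X2op t s f1 f2 f3 = fladd (fladd (X2op t u f1 f2 f3) (X2op u s f1 f2 f3))
    (fladd (Xop t u f1 (Xop u s f2 f3)) (Xop t u f1 (Xop u s f2 f3))).
Proof.
move=> su ut h1 h2 h3 h4 h5; apply/funext => k; rewrite /fladd.
have h23 := sumZ2_cabsD (h2 k) (h3 k).
(* Summability of the composed coefficients follows from Chen's relation for [coef2]: they are a
   difference of summable terms. *)
have h6 : (\sumZ_ i (\sumZ_ j
    (cabs (2 * (coef1 t u k i * coef1 u s (k - i) j) * (f1 i * (f2 j * f3 (k - i - j))))%R)%:E)
    < +oo)%E.
  have hN : (\sumZ_ i (\sumZ_ j (cabs (-
    (coef2 t u k i j * (f1 i * (f2 j * f3 (k - i - j)))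
    + coef2 u s k i j * (f1 i * (f2 j * f3 (k - i - j)))))%R)%:E) < +oo)%E.
    by apply: le_lt_trans h23; apply: le_sumZ => i; apply: le_sumZ => j; rewrite cabsN.
  apply: le_lt_trans (sumZ2_cabsD (h1 k) hN).
  apply: le_sumZ => i; apply: le_sumZ => j.
  rewrite lee_fin le_eqVlt; apply/orP; left; apply/eqP; congr cabs.
  rewrite (coef2_chen k i j su ut).
  move: (coef2 t u k i j) (coef2 u s k i j) (coef1 t u k i) (coef1 u s (k - i) j)
    (f1 i * (f2 j * f3 (k - i - j))) => a b c d e; ring.
have -> : Xop t u f1 (Xop u s f2 f3) k + Xop t u f1 (Xop u s f2 f3) k =
   zsum (fun i => zsum (fun j => 2 * (coef1 t u k i * coef1 u s (k - i) j) * (f1 i * (f2 j * f3 (k - i - j))))).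
  rewrite XopE -zsumD//; congr zsum; apply/funext => i.
  rewrite XopE.
  have -> : coef1 t u k i * (f1 i * zsum (fun j => coef1 u s (k - i) j * (f2 j * f3 (k - i - j))))
    + coef1 t u k i * (f1 i * zsum (fun j => coef1 u s (k - i) j * (f2 j * f3 (k - i - j))))
    = 2 * coef1 t u k i * f1 i * zsum (fun j => coef1 u s (k - i) j * (f2 j * f3 (k - i - j))).
    by ring.
  rewrite -zsumZ//; congr zsum; apply/funext => j; ring.
rewrite !X2opE -zsum2D// -zsum2D//.
congr zsum; apply/funext => i; congr zsum; apply/funext => j.
by rewrite (coef2_chen k i j su ut) !mulrDl.
Qed.
End OperatorAlgebra.

(** * The Fourier-Lebesgue space as a group *)

Section DriverOnSubspace.
Variables (R : realType) (V : zmodType) (W : Type) (add : W -> W -> W) (val : V -> W).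
Variables (N : V -> R) (X : R -> R -> V -> V -> V) (X2 : R -> R -> V -> V -> V -> V).
Variables (X0 : R -> R -> W -> W -> W) (X20 : R -> R -> W -> W -> W -> W).
Variables (S1 : R -> R -> W -> W -> Prop) (S2 : R -> R -> W -> W -> W -> Prop).
Variables (T g c : R).
Hypotheses (N_ge0 : forall x, 0 <= N x) (N_0 : N 0 = 0) (N_opp : forall x, N (- x) = N x).
Hypotheses (N_add : forall x y, N (x + y) <= N x + N y) (valI : injective val).
Hypothesis valD : forall x y, val (x + y) = add (val x) (val y).
Hypothesis valX : forall t s x y, s <= t -> val (X t s x y) = X0 t s (val x) (val y).
Hypothesis valX2 : forall t s x y z, s <= t -> t - s <= T ->
  val (X2 t s x y z) = X20 t s (val x) (val y) (val z).
Hypothesis sX : forall t s x y, s <= t -> S1 t s (val x) (val y).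
Hypothesis sX2 : forall t s x y z, s <= t -> t - s <= T -> S2 t s (val x) (val y) (val z).
Hypothesis X0D : forall t s a b d, S1 t s a d -> S1 t s b d ->
  X0 t s (add a b) d = add (X0 t s a d) (X0 t s b d).
Hypothesis X0C : forall t s a b, S1 t s a b -> X0 t s a b = X0 t s b a.
Hypothesis X20D1 : forall t s a b d e, S2 t s a d e -> S2 t s b d e ->
  X20 t s (add a b) d e = add (X20 t s a d e) (X20 t s b d e).
Hypothesis X20D2 : forall t s a b d e, S2 t s a b e -> S2 t s a d e ->
  X20 t s a (add b d) e = add (X20 t s a b e) (X20 t s a d e).
Hypothesis X20D3 : forall t s a b d e, S2 t s a b d -> S2 t s a b e ->
  X20 t s a b (add d e) = add (X20 t s a b d) (X20 t s a b e).
Hypothesis X0chen : forall t u s a b, S1 t u a b -> S1 u s a b ->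
  X0 t s a b = add (X0 t u a b) (X0 u s a b).
Hypothesis X20chen : forall t u s a b d, s <= u -> u <= t ->
  S2 t s a b d -> S2 t u a b d -> S2 u s a b d -> S1 u s b d -> S1 t u a (X0 u s b d) ->
  X20 t s a b d = add (add (X20 t u a b d) (X20 u s a b d))
    (add (X0 t u a (X0 u s b d)) (X0 t u a (X0 u s b d))).
Hypothesis X_le : forall t s x y, s <= t -> N (X t s x y) <= c * (t - s) `^ g * N x * N y.
Hypothesis X2_le : forall t s x y z, s <= t -> t - s <= T ->
  N (X2 t s x y z) <= c * ((t - s) `^ g) ^+ 2 * N x * N y * N z.

(** On sequences the identities hold only for summable arguments. On the subspace summability is
    automatic, and injectivity of [val] carries each identity over. *)
Lemma rough_driver_subspace : rough_driver N X X2 T g c.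
Proof.
have tsT s t : 0 <= s -> t <= T -> t - s <= T.
  by move=> s0 tT; rewrite lerBlDr (le_trans tT)// lerDl.
constructor => //.
- move=> t s x y z s0 st tT; apply: valI.
  by rewrite valD !valX// valD X0D//; exact: sX.
- by move=> t s x y s0 st tT; apply: valI; rewrite !valX// X0C//; exact: sX.
- move=> t s x y z w s0 st tT; have h := tsT _ _ s0 tT; apply: valI.
  by rewrite valD !valX2// valD X20D1//; exact: sX2.
- move=> t s x y z w s0 st tT; have h := tsT _ _ s0 tT; apply: valI.
  by rewrite valD !valX2// valD X20D2//; exact: sX2.
- move=> t s x y z w s0 st tT; have h := tsT _ _ s0 tT; apply: valI.
  by rewrite valD !valX2// valD X20D3//; exact: sX2.
- move=> t u s x y s0 su ut tT; have st := le_trans su ut; apply: valI.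
  by rewrite valD !valX// (X0chen (sX x y ut) (sX x y su)).
- move=> t u s x y z s0 su ut tT; have st := le_trans su ut; apply: valI.
  have h1 := tsT _ _ s0 tT.
  have h2 := tsT _ _ (le_trans s0 su) tT.
  have h3 := tsT _ _ s0 (le_trans ut tT).
  have hx := sX x (X u s y z) ut; rewrite valX// in hx.
  rewrite mulr2n !valD !valX2// !valX//.
  exact: X20chen su ut (sX2 x y z st h1) (sX2 x y z ut h2) (sX2 x y z su h3) (sX y z su) hx.
- by move=> t s x y s0 st tT; exact: X_le.
- by move=> t s x y z s0 st tT; apply: X2_le => //; exact: tsT.
Qed.

Lemma val_rstep t s x : s <= t -> t - s <= T ->
  val (rstep X X2 t s x) =
  add (add (val x) (X0 t s (val x) (val x))) (X20 t s (val x) (val x) (val x)).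
Proof. by move=> st stT; rewrite /rstep !valD valX// valX2. Qed.
End DriverOnSubspace.

Section Space.
Variables (R : realType) (al : R) (p : \bar R).

(* The unused proof argument lets canonical structures recover [1 <= p] from the predicate. *)
Definition FLpred (p1 : (1 <= p)%E) : {pred int -> R[i]} :=
  [pred f | (flnorm al p f < +oo)%E].

Variable p1 : (1 <= p)%E.

Lemma FLpred_zmod_closed : zmod_closed (FLpred p1).
Proof.
split => [|f g]; rewrite !inE.
  by rewrite (flnorm0 al p1) ltry.
move=> hf hg; apply: le_lt_trans (lte_add_pinfty hf (_ : (flnorm al p (fun k => (- g k)%R) < +oo)%E)).
  exact: (flnormD al f (fun k => - g k) p1).
by rewrite flnormN.
Qed.

HB.instance Definition _ := GRing.isZmodClosed.Build (int -> R[i]) (FLpred p1) FLpred_zmod_closed.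

Record FLspace := MkFL { FLval : int -> R[i]; _ : FLval \in FLpred p1 }.

HB.instance Definition _ := [isSub for FLval].
HB.instance Definition _ := [Choice of FLspace by <:].
HB.instance Definition _ := [SubChoice_isSubZmodule of FLspace by <:].

Definition FLnorm (x : FLspace) : R := fine (flnorm al p (FLval x)).

Lemma FLval_inj : injective FLval.
Proof. exact: val_inj. Qed.

Lemma FLval_fin (x : FLspace) : (flnorm al p (FLval x) < +oo)%E.
Proof. by case: x. Qed.

Lemma FLnormE (x : FLspace) : flnorm al p (FLval x) = (FLnorm x)%:E.
Proof. by rewrite /FLnorm fineK// ge0_fin_numE ?FLval_fin// flnorm_ge0. Qed.

Lemma FLnorm_le (x : FLspace) (A : R) :
  (flnorm al p (FLval x) <= A%:E)%E = (FLnorm x <= A).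
Proof. by rewrite FLnormE lee_fin. Qed.

Lemma FLnorm_ge0 (x : FLspace) : 0 <= FLnorm x.
Proof. by rewrite fine_ge0// flnorm_ge0. Qed.

Lemma valFL_add (x y : FLspace) : FLval (x + y) = fladd (FLval x) (FLval y).
Proof. by have := raddfD (\val : FLspace -> int -> R[i]) x y. Qed.

Lemma valFL_opp (x : FLspace) : FLval (- x) = fun k => - FLval x k.
Proof. by have := raddfN (\val : FLspace -> int -> R[i]) x. Qed.

Lemma valFL_sub (x y : FLspace) : FLval (x - y) = flsub (FLval x) (FLval y).
Proof. by have := raddfB (\val : FLspace -> int -> R[i]) x y. Qed.

Lemma FLnorm0 : FLnorm 0 = 0.
Proof.
have v0 : FLval (0 : FLspace) = fun=> 0 by have := raddf0 (\val : FLspace -> int -> R[i]).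
by rewrite /FLnorm v0 flnorm0.
Qed.

Lemma FLnormN (x : FLspace) : FLnorm (- x) = FLnorm x.
Proof. by rewrite /FLnorm valFL_opp flnormN. Qed.

Lemma FLnormD (x y : FLspace) : FLnorm (x + y) <= FLnorm x + FLnorm y.
Proof. by rewrite -FLnorm_le valFL_add EFinD -!FLnormE flnormD. Qed.

(** The default 0 for sequences of infinite norm makes the operators total on the subspace;
    [FLX_val] and [FLX2_val] show that it does not arise on the time intervals in use. *)
Definition FLin (f : int -> R[i]) : FLspace := insubd 0 f.

Lemma FLinK f : (flnorm al p f < +oo)%E -> FLval (FLin f) = f.
Proof. by move=> hf; have := insubdK (0 : FLspace) hf. Qed.

Definition FLX (t s : R) (x y : FLspace) : FLspace := FLin (Xop t s (FLval x) (FLval y)).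

Definition FLX2 (t s : R) (x y z : FLspace) : FLspace :=
  FLin (X2op t s (FLval x) (FLval y) (FLval z)).

Variables (g T : R).
Hypotheses (g3 : 1 / 3 < g) (g2 : g <= 1 / 2) (al2 : - (1 / 2) < al)
  (alp : 3 * g - 1 - recp p < al) (T0 : 0 <= T).

Let kX := Xop_bound p1 g3 g2 al2 alp.
Let kX2 := X2op_bound p1 g3 g2 al2 alp T0.

Lemma FLX_val t s (x y : FLspace) : s <= t ->
  FLval (FLX t s x y) = Xop t s (FLval x) (FLval y).
Proof.
move=> st; have [C C0 HC] := kX; apply: FLinK.
have e (w : FLspace) : (flnorm al p (FLval w) <= (FLnorm w)%:E)%E by rewrite FLnormE.
have [h _] := HC t s _ _ _ _ st (FLnorm_ge0 x) (FLnorm_ge0 y) (e x) (e y).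
exact: le_lt_trans h (ltry _).
Qed.

Lemma FLX_sum t s (x y : FLspace) : s <= t -> xsum t s (FLval x) (FLval y).
Proof.
move=> st; have [C C0 HC] := kX.
have xx : (flnorm al p (FLval x) <= (FLnorm x)%:E)%E by rewrite FLnormE.
have yy : (flnorm al p (FLval y) <= (FLnorm y)%:E)%E by rewrite FLnormE.
by have [] := HC t s (FLval x) (FLval y) _ _ st (FLnorm_ge0 x) (FLnorm_ge0 y) xx yy.
Qed.

Lemma FLX2_val t s (x y z : FLspace) : s <= t -> t - s <= T ->
  FLval (FLX2 t s x y z) = X2op t s (FLval x) (FLval y) (FLval z).
Proof.
move=> st stT; have [C C0 HC] := kX2; apply: FLinK.
have e (w : FLspace) : (flnorm al p (FLval w) <= (FLnorm w)%:E)%E by rewrite FLnormE.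
have [h _] := HC t s _ _ _ _ _ _ st stT (FLnorm_ge0 x) (FLnorm_ge0 y) (FLnorm_ge0 z)
  (e x) (e y) (e z).
exact: le_lt_trans h (ltry _).
Qed.

Lemma FLX2_sum t s (x y z : FLspace) : s <= t -> t - s <= T ->
  x2sum t s (FLval x) (FLval y) (FLval z).
Proof.
move=> st stT; have [C C0 HC] := kX2.
have e (w : FLspace) : (flnorm al p (FLval w) <= (FLnorm w)%:E)%E by rewrite FLnormE.
by have [] := HC t s _ _ _ _ _ _ st stT (FLnorm_ge0 x) (FLnorm_ge0 y) (FLnorm_ge0 z)
  (e x) (e y) (e z).
Qed.

Lemma FLX_le : exists2 C : R, 0 <= C & forall t s (x y : FLspace), s <= t ->
  FLnorm (FLX t s x y) <= C * (t - s) `^ g * FLnorm x * FLnorm y.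
Proof.
have [C C0 H] := kX; exists C => // t s x y st.
have e (w : FLspace) : (flnorm al p (FLval w) <= (FLnorm w)%:E)%E by rewrite FLnormE.
have [h _] := H t s _ _ _ _ st (FLnorm_ge0 x) (FLnorm_ge0 y) (e x) (e y).
by rewrite -FLnorm_le (FLX_val x y st).
Qed.

Lemma FLX2_le : exists2 C : R, 0 <= C & forall t s (x y z : FLspace), s <= t -> t - s <= T ->
  FLnorm (FLX2 t s x y z) <= C * ((t - s) `^ g) ^+ 2 * FLnorm x * FLnorm y * FLnorm z.
Proof.
have [C C0 H] := kX2; exists C => // t s x y z st hT.
have e (w : FLspace) : (flnorm al p (FLval w) <= (FLnorm w)%:E)%E by rewrite FLnormE.
have [h _] := H t s _ _ _ _ _ _ st hT (FLnorm_ge0 x) (FLnorm_ge0 y) (FLnorm_ge0 z)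
  (e x) (e y) (e z).
rewrite -FLnorm_le (FLX2_val x y z st hT); apply: le_trans h _.
by rewrite (mulrC 2) powRrM powR_mulrn ?powR_ge0.
Qed.

Lemma FL_rough_driver : exists2 c : R, 0 <= c &
  rough_driver FLnorm FLX FLX2 T g c.
Proof.
have [C1 C10 H1] := FLX_le; have [C2 C20 H2] := FLX2_le.
exists (C1 + C2); first by rewrite addr_ge0.
apply: (@rough_driver_subspace R FLspace (int -> R[i]) (@fladd R) FLval FLnorm FLX FLX2
  (@Xop R) (@X2op R) (@xsum R) (@x2sum R) T g (C1 + C2)
  FLnorm_ge0 FLnorm0 FLnormN FLnormD FLval_inj valFL_add FLX_val FLX2_val FLX_sum FLX2_sum).
- exact: Xop_add.
- exact: Xop_sym.
- exact: X2op_add1.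
- exact: X2op_add2.
- exact: X2op_add3.
- exact: Xop_chen.
- exact: X2op_chen.
- move=> t s x y st; apply: le_trans (H1 t s x y st) _.
  by rewrite !ler_wpM2r ?FLnorm_ge0 ?powR_ge0// lerDl.
- move=> t s x y z st hT; apply: le_trans (H2 t s x y z st hT) _.
  by rewrite !ler_wpM2r ?FLnorm_ge0 ?exprn_ge0 ?powR_ge0// lerDr.
Qed.

Lemma FL_rstep_val t s (x : FLspace) : s <= t -> t - s <= T ->
  FLval (rstep FLX FLX2 t s x) =
  fladd (fladd (FLval x) (Xop t s (FLval x) (FLval x))) (X2op t s (FLval x) (FLval x) (FLval x)).
Proof. exact: (val_rstep valFL_add FLX_val FLX2_val). Qed.
End Space.

(** With g > 1/3 the first branch of the region is possible only for p < 3/2; there 2 g < 1/p turns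
    -1 + g <= al into the strict inequality. *)
Lemma regD'_bounds (R : realType) (p : \bar R) (al g : R) : (1 <= p)%E -> 1 / 3 < g ->
  regD' p al g -> [/\ g <= 1 / 2, - (1 / 2) < al & 3 * g - 1 - recp p < al].
Proof.
move=> p1 g3 [hD]; rewrite gt_max => /andP[_ al2]; have r1 := recp_le1 p1.
by case: hD => [[_ [|]]|[_ [_ [|]]]] => -[h1 [h2 h3]]; split; lra.
Qed.

(** * The scheme in Fourier-Lebesgue spaces *)

Section Scheme.
Variables (R : realType) (al : R) (p : \bar R) (p1 : (1 <= p)%E) (g T : R).
Hypotheses (g3 : 1 / 3 < g) (g2 : g <= 1 / 2) (al2 : - (1 / 2) < al)
  (alp : 3 * g - 1 - recp p < al) (T0 : 0 < T).

Fixpoint FLscheme (n : nat) (x : FLspace al p1) (i : nat) : FLspace al p1 :=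
  if i is j.+1 then
    rstep (@FLX R al p p1) (@FLX2 R al p p1) (j.+1%:R / n%:R) (j%:R / n%:R) (FLscheme n x j)
  else x.

Lemma FLscheme_val n (x : FLspace al p1) i : (0 < n)%N -> i%:R <= n%:R * T ->
  FLval (FLscheme n x i) = scheme n (FLval x) i.
Proof.
move=> n0; have n0R : 0 < n%:R :> R by rewrite ltr0n.
elim: i => [//|i IH] hi.
have hi' : i%:R <= n%:R * T by apply: le_trans hi; rewrite ler_nat.
have le1 : i%:R / n%:R <= i.+1%:R / n%:R :> R by rewrite ler_pM2r ?invr_gt0// ler_nat.
have le2 : i.+1%:R / n%:R - i%:R / n%:R <= T.
  by rewrite lerBlDr (@le_trans _ _ T)// ?lerDl ?divr_ge0// ler_pdivrMr// mulrC.
rewrite /= -(IH hi').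
exact: (FL_rstep_val g3 g2 al2 alp (ltW T0) (FLscheme n x i) le1 le2).
Qed.

Lemma FL_scheme_error (v : R -> dist R) :
  (forall t, 0 <= t -> t <= T -> (flnorm al p (v t) < +oo)%E) ->
  (exists C : R, forall s t : R, 0 <= s -> s <= T -> 0 <= t -> t <= T ->
     (flnorm al p (flsub (v t) (v s)) <= (C * `|t - s| `^ g)%R%:E)%E) ->
  (forall eps : R, 0 < eps -> exists delta : R, 0 < delta /\
     forall h : R, 0 < h -> h < delta ->
     forall s t : R, 0 <= s -> s <= t -> t <= T -> t - s <= h ->
       (flnorm al p
          (flsub (v t) (fladd (fladd (v s) (Xop t s (v s) (v s)))
                            (X2op t s (v s) (v s) (v s))))
        <= (eps * h)%R%:E)%E) ->
  exists (C : R) (N0 : nat), [/\ 0 <= C, (0 < N0)%N & forall n, (N0 <= n)%N ->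
    forall i, i%:R <= n%:R * T ->
    (flnorm al p (flsub (scheme n (v 0%R) i) (v (i%:R / n%:R)%R)) <=
      (C * n%:R `^ (1 - 3 * g))%R%:E)%E].
Proof.
move=> vfin [C hC] hrem.
have [c c0 drv] := FL_rough_driver p1 g3 g2 al2 alp (ltW T0).
pose w t : FLspace al p1 := FLin al p1 (v t).
have wE t : 0 <= t -> t <= T -> FLval (w t) = v t by move=> t0 tT; apply: FLinK; exact: vfin.
have T0' := ltW T0.
(* The Hölder bound from time 0 gives the uniform bound on the path; the absolute value is there
   because the sign of [C] is unknown. *)
pose M := FLnorm (w 0) + `|C| * T `^ g.
have M0 : 0 <= M by rewrite addr_ge0 ?FLnorm_ge0// mulr_ge0 ?powR_ge0.
have wM t : 0 <= t -> t <= T -> FLnorm (w t) <= M.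
  move=> t0 tT; have -> : w t = w 0 + (w t - w 0) by rewrite addrC subrK.
  apply: le_trans (FLnormD _ _) _; rewrite lerD2l -FLnorm_le valFL_sub !wE//.
  apply: le_trans (hC 0 t (lexx 0) T0' t0 tT) _; rewrite lee_fin subr0 ger0_norm//.
  apply: (@le_trans _ _ (`|C| * t `^ g)); first by rewrite ler_wpM2r ?powR_ge0// ler_norm.
  by rewrite ler_wpM2l// ge0_ler_powR ?nnegrE// (le_trans _ (ltW g3)).
have wrem eps : 0 < eps -> exists delta, 0 < delta /\ forall k, 0 < k -> k < delta ->
    forall s t, 0 <= s -> s <= t -> t <= T -> t - s <= k ->
    FLnorm (w t - rstep (@FLX R al p p1) (@FLX2 R al p p1) t s (w s)) <= eps * k.
  move=> e0; have [d [d0 hd]] := hrem eps e0; exists d; split=> // k k0 kd s t s0 st tT tsk.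
  have hT : t - s <= T by rewrite lerBlDr (le_trans tT)// lerDl.
  have hr := FL_rstep_val g3 g2 al2 alp T0' (w s) st hT.
  rewrite -FLnorm_le valFL_sub hr (wE t (le_trans s0 st) tT) (wE s s0 (le_trans st tT)).
  exact: hd k0 kd _ _ s0 st tT tsk.
have g31 : 1 < 3 * g by have h := g3; lra.
have y0 (n : nat) : FLscheme n (w 0) 0 = w 0 by [].
have ys (n i : nat) : (0 < n)%N -> i.+1%:R <= n%:R * T ->
    FLscheme n (w 0) i.+1 = rstep (@FLX R al p p1) (@FLX2 R al p p1)
      (i.+1%:R / n%:R) (i%:R / n%:R) (FLscheme n (w 0) i) by [].
have [C' [N0 [C'0 N00 H]]] := @rough_scheme_error R (FLspace al p1) (@FLnorm R al p p1)
  (@FLX R al p p1) (@FLX2 R al p p1) T g c M w (fun n => FLscheme n (w 0))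
  g31 c0 M0 T0 drv wM wrem y0 ys.
exists C', N0; split=> // n nN i hi.
have n0 : (0 < n)%N := leq_trans N00 nN.
have t1 : 0 <= i%:R / n%:R :> R by rewrite divr_ge0.
have t2 : i%:R / n%:R <= T by rewrite ler_pdivrMr ?ltr0n// mulrC.
have := H n nN i hi; rewrite -FLnorm_le valFL_sub (wE _ t1 t2) (FLscheme_val _ n0 hi).
by rewrite (wE 0 (lexx 0) T0').
Qed.
End Scheme.

Theorem theorem4 (R : realType) (p : \bar R) (alpha gamma T : R)
    (v0 : dist R) (v : R -> dist R) :
  (1%:E <= p)%E ->
  Num.max (- recp p) (-(1/2)) < alpha ->
  1/3 < gamma ->
  regD' p alpha gamma ->
  in_FL alpha p v0 ->
  0 < T ->
  (* v : [0,T] -> FL^{alpha,p}, v(0) = v0 *)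
  (forall t : R, 0 <= t -> t <= T -> in_FL alpha p (v t)) ->
  v 0 = v0 ->
  (* v is gamma-Hoelder *)
  (exists C : R, forall s t : R, 0 <= s -> s <= T -> 0 <= t -> t <= T ->
     (flnorm alpha p (flsub (v t) (v s)) <= (C * `|t - s| `^ gamma)%R%:E)%E) ->
  (* v_t = v_s + X_ts(v_s,v_s) + X^2_ts(v_s,v_s,v_s) + o(|t-s|) *)
  (forall eps : R, 0 < eps -> exists delta : R, 0 < delta /\
     forall h : R, 0 < h -> h < delta ->
     forall s t : R, 0 <= s -> s <= t -> t <= T -> t - s <= h ->
       (flnorm alpha p
          (flsub (v t) (fladd (fladd (v s) (Xop t s (v s) (v s)))
                            (X2op t s (v s) (v s) (v s))))
        <= (eps * h)%R%:E)%E) ->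
  (* sup_{0 <= i < j <= nT} |Delta^n_i - Delta^n_j| / |i-j|^gamma = O(n^{1-3 gamma}) *)
  exists (C : R) (N : nat), (0 < N)%N /\
    forall n : nat, (N <= n)%N ->
    forall i j : nat, (i < j)%N -> j%:R <= n%:R * T ->
      (flnorm alpha p
         (flsub (flsub (scheme n v0 i) (v (i%:R / n%:R)%R))
               (flsub (scheme n v0 j) (v (j%:R / n%:R)%R)))
       <= (C * n%:R `^ (1 - 3 * gamma) * (j - i)%:R `^ gamma)%R%:E)%E.
Proof.
move=> p1 _ g3 hD _ T0 hv <- hH hR.
have [g2 al2 alp] := regD'_bounds p1 g3 hD.
have vfin t : 0 <= t -> t <= T -> (flnorm alpha p (v t) < +oo)%E.
  by move=> t0 tT; have [_ []] := hv t t0 tT.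
have [C [N [C0 N0 H]]] := FL_scheme_error p1 g3 g2 al2 alp T0 vfin hH hR.
exists (2 * C), N; split=> // n nN i j ij jT.
have iT : i%:R <= n%:R * T by apply: le_trans jT; rewrite ler_nat ltnW.
have g0 : 0 <= gamma by apply: le_trans (ltW g3).
(* Distinct indices satisfy |i - j| >= 1, so the Hölder quotient is bounded by the sup norm of Delta. *)
have ji1 : 1 <= (j - i)%:R `^ gamma.
  have := @ge0_ler_powR R gamma g0 1 (j - i)%:R.
  by rewrite powR1 !nnegrE ler1n subn_gt0; apply.
have := flnormD alpha (flsub (scheme n (v 0) i) (v (i%:R / n%:R)))
  (fun k => - flsub (scheme n (v 0) j) (v (j%:R / n%:R)) k) p1.
rewrite flnormN => /le_trans; apply.
apply: le_trans (leeD (H n nN i iT) (H n nN j jT)) _.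
rewrite -EFinD lee_fin -mulrDl -mulr2n -(mulr_natl C) ler_peMr//.
by rewrite !mulr_ge0 ?powR_ge0.
Qed.
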